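(* Let $P_1,P_2,Q$ be $\sigma$-finite von Neumann algebras with embeddings $\iota_1:Q\hookrightarrow P_1$, $\iota_2:Q\hookrightarrow P_2$ and faithful normal conditional expectations $E_1:P_1\to\iota_1(Q)$, $E_2:P_2\to\iota_2(Q)$, and let $(P,E)=(P_1,E_1:\iota_1)\bigstar_Q(P_2,E_2:\iota_2)$ be the amalgamated free product. Let $(M,E_N^M,u(\theta))=(N,E_D^N)\bigstar_D(\theta,E_{\theta(D)}^N)$ be the HNN extension with $$N:=P_1\oplus P_2\supseteq D:=\iota_1(Q)\oplus\iota_2(Q),\qquad \theta:(\iota_1(x),\iota_2(y))\in D\mapsto(\iota_1(y),\iota_2(x))\in D,\qquad E_D^N=E_{\theta(D)}^N:=E_1\oplus E_2.$$ Put $p:=1_{P_1}\oplus0\in N$ and let $M_0$ be the von Neumann subalgebra of $M$ generated by $N$ and $v:=pu(\theta)$. Then the compressed system $\big(pM_0p,\ F:=E_D^N\circ E_N^M|_{pM_0p}\big)$ is identified with the amalgamated free product $(P,E)$; here $F$ is a conditional expectation onto $\iota_1(Q)\oplus0\cong Q$, and $P_1$, $P_2$ are embedded in $pM_0p$ by $x\mapsto x\oplus0$ and $x\mapsto u(\theta)(0\oplus x)u(\theta)^*$ respectively.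
   Context: HNN extension of von Neumann algebras. For $\sigma$-finite $N\supseteq D$, an injective normal unital $*$-homomorphism $\theta:D\to N$ and faithful normal conditional expectations $E_D^N:N\to D$, $E_{\theta(D)}^N:N\to\theta(D)$, the HNN extension $(N,E_D^N)\bigstar_D(\theta,E_{\theta(D)}^N)$ is the unique triple $(M,E_N^M,u(\theta))$ of a von Neumann algebra $M\supseteq N$, a faithful normal conditional expectation $E_N^M:M\to N$ and a unitary $u(\theta)\in M$ such that $M$ is generated by $N$ and $u(\theta)$ and: (A) $u(\theta)\theta(d)u(\theta)^*=d$ for all $d\in D$; (M) $E_N^M(w)=0$ for every reduced word $w=u(\theta)^{\varepsilon_0}n_1u(\theta)^{\varepsilon_1}\cdots n_\ell u(\theta)^{\varepsilon_\ell}$ ($\ell\ge0$, $n_j\in N$, $\varepsilon_j=\pm1$), reduced meaning that for every $j$ with $\varepsilon_{j-1}\neq\varepsilon_j$: $n_j\in\mathrm{Ker}E_{\theta(D)}^N$ when $\varepsilon_{j-1}=1,\varepsilon_j=-1$, and $n_j\in\mathrm{Ker}E_D^N$ when $\varepsilon_{j-1}=-1,\varepsilon_j=1$. Amalgamated free product of von Neumann algebras. $(P,E)=(P_1,E_1:\iota_1)\bigstar_Q(P_2,E_2:\iota_2)$ is the unique von Neumann algebra $P$ with normal embeddings $\lambda_i:P_i\to P$ such that $\lambda:=\lambda_1\circ\iota_1=\lambda_2\circ\iota_2$ on $Q$, $P$ is generated by $\lambda_1(P_1)\cup\lambda_2(P_2)$, and with a faithful normal conditional expectation $E:P\to\lambda(Q)$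 such that $E\circ\lambda_i=\lambda_i\circ E_i$ and $E(x_1\cdots x_m)=0$ whenever $x_j\in\lambda_{i_j}(\mathrm{Ker}E_{i_j})$ with $i_1\ne i_2\ne\cdots\ne i_m$. ''Identified'' means that there is a $*$-isomorphism $P\to pM_0p$ carrying $E$ to $F$ and compatible with the embeddings of $P_1$ and $P_2$. *)

(* Defs.v *)
From HB Require Import structures.
From mathcomp Require Import all_boot all_order all_algebra.
From mathcomp Require Import complex.
From mathcomp Require Import all_classical all_reals all_analysis.
From mathcomp Require Import ring.

Set Implicit Arguments.
Unset Strict Implicit.
Unset Printing Implicit Defensive.

Import Order.TTheory GRing.Theory Num.Theory.
Import numFieldNormedType.Exports.

Local Open Scope classical_set_scope.
Local Open Scope ring_scope.

(* The inner product is linear in its first argument. *)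
HB.mixin Record CompleteNormedModule_isHilbert (R : realType) H
    & CompleteNormedModule R[i] H := {
  hdot : {dot H for (@Num.conj R[i])} ;
  hdot_normE : forall u : H, `|u| ^+ 2 = hdot u u }.

#[short(type="hilbertType")]
HB.structure Definition Hilbert (R : realType) :=
  {H of CompleteNormedModule R[i] H & CompleteNormedModule_isHilbert R H}.

Lemma hdotDr (R : realType) (H : hilbertType R) (u v w : H) :
  hdot u (v + w) = hdot u v + hdot u w.
Proof. exact: linearDr. Qed.

Lemma hdotZr (R : realType) (H : hilbertType R) (a : R[i]) (u v : H) :
  hdot u (a *: v) = a^* * hdot u v.
Proof. exact: linearr_subproof. Qed.

Lemma hdotC (R : realType) (H : hilbertType R) (u v : H) :
  hdot u v = (hdot v u)^*.
Proof. by rewrite [LHS]hermitian_subproof expr0 mul1r. Qed.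

(* The Hilbert space direct sum; an alias of the product type, because the
   canonical norm on products is the maximum norm. *)
Definition hsum (R : realType) (H1 H2 : hilbertType R) := (H1 * H2)%type.

Section hsum.
Variables (R : realType) (H1 H2 : hilbertType R).
Local Notation C := R[i].

HB.instance Definition _ := GRing.Lmodule.copy (hsum H1 H2) (H1 * H2)%type.

Definition hsum_norm (u : hsum H1 H2) : C := sqrtC (`|u.1| ^+ 2 + `|u.2| ^+ 2).

Lemma hsum_norm_ge0 u : 0 <= hsum_norm u.
Proof. by rewrite sqrtC_ge0 addr_ge0// exprn_ge0. Qed.

Lemma hsum_normE u : hsum_norm u ^+ 2 = `|u.1| ^+ 2 + `|u.2| ^+ 2.
Proof. by rewrite sqrtCK. Qed.

Lemma hsum_normD x y : hsum_norm (x + y) <= hsum_norm x + hsum_norm y.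
Proof.
have s0 := addr_ge0 (hsum_norm_ge0 x) (hsum_norm_ge0 y).
rewrite -(@ler_pXn2r _ 2)// ?nnegrE ?hsum_norm_ge0// hsum_normE.
apply: (@le_trans _ _ ((`|x.1| + `|y.1|) ^+ 2 + (`|x.2| + `|y.2|) ^+ 2)).
  by rewrite lerD// ler_pXn2r ?nnegrE ?addr_ge0// ler_normD.
have e (K : comRingType) (p q : K) : (p + q) ^+ 2 = p ^+ 2 + q ^+ 2 + 2 * (p * q).
  by ring.
rewrite [leRHS]e !hsum_normE.
set a := `|x.1|; set b := `|x.2|; set c := `|y.1|; set d := `|y.2|.
rewrite !e (addrACA (a ^+ 2 + c ^+ 2)) (addrACA (a ^+ 2)) -mulrDr.
rewrite lerD2l ler_pM2l ?ltr0n//.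
have [a0 b0 c0 d0] : [/\ 0 <= a, 0 <= b, 0 <= c & 0 <= d] by rewrite !normr_ge0.
rewrite -(@ler_pXn2r _ 2)// ?nnegrE ?mulr_ge0 ?addr_ge0 ?hsum_norm_ge0 ?mulr_ge0//.
rewrite exprMn !hsum_normE -/a -/b -/c -/d -subr_ge0.
have f (K : comRingType) (p q r s : K) :
  (p ^+ 2 + q ^+ 2) * (r ^+ 2 + s ^+ 2) - (p * r + q * s) ^+ 2 =
  (p * s - q * r) ^+ 2 by ring.
rewrite f.
by rewrite real_exprn_even_ge0// rpredB// realM// ger0_real.
Qed.

Lemma hsum_normZ (l : C) x : hsum_norm (l *: x) = `|l| * hsum_norm x.
Proof.
apply/eqP; rewrite -(@eqrXn2 _ 2)// ?mulr_ge0 ?hsum_norm_ge0//.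
by rewrite exprMn !hsum_normE !normrZ !exprMn mulrDr.
Qed.

Lemma hsum_norm0 x : hsum_norm x = 0 -> x = 0.
Proof.
move=> /(congr1 (fun z => z ^+ 2)); rewrite hsum_normE expr0n/= => /eqP.
rewrite paddr_eq0 ?exprn_ge0// !expf_eq0/= !normr_eq0 => /andP[/eqP e1 /eqP e2].
by case: x e1 e2 => x1 x2 /= -> ->.
Qed.

HB.instance Definition _ :=
  Lmodule_isNormed.Build C (hsum H1 H2) hsum_normD hsum_normZ hsum_norm0.

Lemma hsum_norm1 (x : hsum H1 H2) : `|x.1| <= `|x|.
Proof.
by rewrite -(@ler_pXn2r _ 2)// ?nnegrE// [leRHS]hsum_normE lerDl exprn_ge0.
Qed.

Lemma hsum_norm2 (x : hsum H1 H2) : `|x.2| <= `|x|.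
Proof.
by rewrite -(@ler_pXn2r _ 2)// ?nnegrE// [leRHS]hsum_normE lerDr exprn_ge0.
Qed.

Lemma hsum_norm_le (x : hsum H1 H2) : `|x| <= `|x.1| + `|x.2|.
Proof.
rewrite -(@ler_pXn2r _ 2)// ?nnegrE ?addr_ge0// [leLHS]hsum_normE sqrrD.
by rewrite addrAC lerDl mulrn_wge0// mulr_ge0.
Qed.

Lemma hsum_complete (F : set_system (hsum H1 H2)) :
  ProperFilter F -> cauchy F -> cvg F.
Proof.
move=> FF Fc.
pose p1 (x : hsum H1 H2) : H1 := x.1.
pose p2 (x : hsum H1 H2) : H2 := x.2.
have c1 : cauchy (p1 @ F).
  apply: cauchy_exP => e e0.
  have /cauchyP/(_ e e0)[x Fx] := Fc.
  exists (p1 x); rewrite /fmap /=; apply: filterS Fx => y.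
  rewrite -!ball_normE /= => h.
  exact: le_lt_trans (hsum_norm1 (x - y)) h.
have c2 : cauchy (p2 @ F).
  apply: cauchy_exP => e e0.
  have /cauchyP/(_ e e0)[x Fx] := Fc.
  exists (p2 x); rewrite /fmap /=; apply: filterS Fx => y.
  rewrite -!ball_normE /= => h.
  exact: le_lt_trans (hsum_norm2 (x - y)) h.
have [l1 l1P] := (cvg_ex _).1 (cauchy_cvg (p1 @ F) c1).
have [l2 l2P] := (cvg_ex _).1 (cauchy_cvg (p2 @ F) c2).
apply/cvg_ex; exists ((l1, l2) : hsum H1 H2).
apply/cvgrPdist_lt => e e0; near=> x.
apply: le_lt_trans (hsum_norm_le _) _.
rewrite [e]splitr ltrD//=.
  by near: x; move/cvgrPdist_lt : l1P; apply; rewrite divr_gt0.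
by near: x; move/cvgrPdist_lt : l2P; apply; rewrite divr_gt0.
Unshelve. all: by end_near. Qed.

HB.instance Definition _ := Uniform_isComplete.Build (hsum H1 H2) hsum_complete.

Definition hsum_dot (u v : hsum H1 H2) : C := hdot u.1 v.1 + hdot u.2 v.2.

Lemma hsum_dot_bilinear : bilinear_for
  ( *%R : GRing.Scale.law C C) ((@Num.conj C \; *%R) : GRing.Scale.law C C)
  hsum_dot.
Proof.
split=> [v a x y|u a x y]; rewrite /hsum_dot /=.
    by rewrite !linearDl !linearZl_LR /= mulrDr addrACA.
by rewrite !hdotDr !hdotZr mulrDr addrACA.
Qed.

HB.instance Definition _ :=
  bilinear_isBilinear.Build C _ _ _ _ _ hsum_dot hsum_dot_bilinear.

Lemma hsum_dot_hermitian (x y : hsum H1 H2) :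
  hsum_dot x y = (-1) ^+ false * (hsum_dot y x)^*.
Proof.
by rewrite /hsum_dot expr0 mul1r rmorphD/=; congr (_ + _);
  exact: hdotC.
Qed.

HB.instance Definition _ :=
  isHermitianSesquilinear.Build C _ false _ hsum_dot hsum_dot_hermitian.

Lemma hsum_dotE (u : hsum H1 H2) : `|u| ^+ 2 = hsum_dot u u.
Proof. by rewrite [LHS]hsum_normE /hsum_dot !hdot_normE. Qed.

Lemma hsum_dot_gt0 (u : hsum H1 H2) : u != 0 -> 0 < hsum_dot u u.
Proof. by move=> u0; rewrite -hsum_dotE exprn_gt0// normr_gt0. Qed.

HB.instance Definition _ := isDotProduct.Build C _ hsum_dot hsum_dot_gt0.

HB.instance Definition _ :=
  CompleteNormedModule_isHilbert.Build R (hsum H1 H2) hsum_dotE.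

End hsum.

Section operators.
Variables (R : realType) (H : hilbertType R).
Implicit Types (x y e : H -> H) (S A : set (H -> H)).

Definition bounded_op x := linear x /\ continuous x.

Definition is_adjoint x y := forall u v, hdot (x u) v = hdot u (y v).

Lemma is_adjoint_uniq x y z : is_adjoint x y -> is_adjoint x z -> y = z.
Proof.
move=> hy hz; apply/funext => v; apply/eqP; rewrite -subr_eq0 -normr_eq0 -sqrf_eq0.
rewrite hdot_normE hdotDr -scaleN1r hdotZr rmorphN1 mulN1r.
by rewrite -hy -hz subrr.
Qed.

(* The junk value 0 is only taken by operators without an adjoint, hence never
   by bounded ones. *)
Definition adj x : H -> H := xget (fun=> 0) [set y | is_adjoint x y].

Lemma adjE x y : is_adjoint x y -> adj x = y.
Proof.
by move=> xy; apply: (@is_adjoint_uniq x) => //; apply: (xgetPex _ (ex_intro _ y xy)).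
Qed.

Definition selfadjoint x := is_adjoint x x.

Definition projection e := selfadjoint e /\ e \o e = e.

Definition op_ge0 x := forall u, 0 <= hdot (x u) u.

Definition op_le x y := op_ge0 (y - x).

Definition commutant S : set (H -> H) :=
  [set x | bounded_op x /\ forall y, S y -> x \o y = y \o x].

Definition von_neumann A :=
  [/\ A `<=` bounded_op, (forall x, A x -> A (adj x)) &
      commutant (commutant A) = A].

Definition vN_generated S : set (H -> H) := smallest von_neumann S.

Definition vN_sigma_finite A := forall S,
  (forall e, S e -> A e /\ projection e) ->
  (forall e f, S e -> S f -> e <> f -> e \o f = 0) ->
  countable S.

Definition is_unit A e := A e /\ forall x, A x -> e \o x = x /\ x \o e = x.

Definition directed S :=
  forall x y, S x -> S y -> exists z, [/\ S z, op_le x z & op_le y z].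

Definition is_sup A S s :=
  [/\ A s, (forall x, S x -> op_le x s) &
      forall t, A t -> (forall x, S x -> op_le x t) -> op_le s t].

End operators.

(* Operator algebras are sets of operators, and maps between them are total
   functions of which only the values on the domain A matter. *)
Section maps.
Variables (R : realType) (H K : hilbertType R).
Implicit Types (A : set (H -> H)) (B : set (K -> K)).
Implicit Types f : (H -> H) -> (K -> K).

Definition linear_on A f := forall (a : R[i]) x y, A x -> A y ->
  f (a *: x + y) = a *: f x + f y.

Definition star_morphism A B f :=
  [/\ (forall x, A x -> B (f x)), linear_on A f,
      (forall x y, A x -> A y -> f (x \o y) = f x \o f y) &
      forall x, A x -> f (adj x) = adj (f x)].

(* Increasing nets are represented by directed sets; the set A provides the
   upper bound required of a bounded net. *)
Definition normal_map A B f := forall S s,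
  S !=set0 -> S `<=` A -> (forall x, S x -> selfadjoint x) -> directed S ->
  is_sup A S s -> is_sup B (f @` S) (f s).

(* The unit of a corner is a projection distinct from idfun. *)
Definition normal_embedding A B f :=
  [/\ star_morphism A B f, set_inj A f,
      (forall e, is_unit A e -> is_unit B (f e)) & normal_map A B f].

Definition star_isomorphism A B f := star_morphism A B f /\ set_bij A B f.

End maps.

Section conditional_expectation.
Variables (R : realType) (H : hilbertType R).
Implicit Types (A B : set (H -> H)) (E : (H -> H) -> (H -> H)).

Record cond_exp A B E : Prop := {
  cond_exp_sub : B `<=` A ;
  cond_exp_into : forall x, A x -> B (E x) ;
  cond_exp_id : forall b, B b -> E b = b ;
  cond_exp_linear : linear_on A E ;
  cond_exp_ge0 : forall x, A x -> op_ge0 x -> op_ge0 (E x) ;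
  cond_exp_bimod : forall a x b, B a -> A x -> B b ->
    E (a \o x \o b) = a \o E x \o b }.

Definition fn_cond_exp A B E :=
  [/\ cond_exp A B E,
      (forall x, A x -> E (adj x \o x) = 0 -> x = 0) &
      normal_map A B E].

Definition ker_on A E : set (H -> H) := [set x | A x /\ E x = 0].

End conditional_expectation.

Section direct_sum.
Variables (R : realType) (H1 H2 : hilbertType R).

Definition dsum_op (x : H1 -> H1) (y : H2 -> H2) (u : hsum H1 H2) :
  hsum H1 H2 := (x u.1, y u.2).

Definition dsum (A : set (H1 -> H1)) (B : set (H2 -> H2)) :
  set (hsum H1 H2 -> hsum H1 H2) := [set dsum_op x y | x in A & y in B].

End direct_sum.

Section amalgamated_free_product.
Variables (R : realType) (H1 H2 HQ HP : hilbertType R).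
Variables (P1 : set (H1 -> H1)) (P2 : set (H2 -> H2)) (Q : set (HQ -> HQ)).
Variables (i1 : (HQ -> HQ) -> (H1 -> H1)) (i2 : (HQ -> HQ) -> (H2 -> H2)).
Variables (E1 : (H1 -> H1) -> (H1 -> H1)) (E2 : (H2 -> H2) -> (H2 -> H2)).
Variables (P : set (HP -> HP)).
Variables (l1 : (H1 -> H1) -> (HP -> HP)) (l2 : (H2 -> H2) -> (HP -> HP)).
Variable E : (HP -> HP) -> (HP -> HP).

Definition afp_letter (c : bool * (HP -> HP)) :=
  if c.1 then (l1 @` ker_on P1 E1) c.2 else (l2 @` ker_on P2 E2) c.2.

Definition afp_word (w : seq (bool * (HP -> HP))) : HP -> HP :=
  foldr (fun c x => c.2 \o x) idfun w.

Record amalgamated_free_product : Prop := {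
  afp_vN : von_neumann P ;
  afp_embedding1 : normal_embedding P1 P l1 ;
  afp_embedding2 : normal_embedding P2 P l2 ;
  afp_amalgam : forall q, Q q -> l1 (i1 q) = l2 (i2 q) ;
  afp_generated : P = vN_generated (l1 @` P1 `|` l2 @` P2) ;
  afp_exp : fn_cond_exp P ((l1 \o i1) @` Q) E ;
  afp_exp1 : forall x, P1 x -> E (l1 x) = l1 (E1 x) ;
  afp_exp2 : forall x, P2 x -> E (l2 x) = l2 (E2 x) ;
  afp_free : forall w, w <> [::] -> List.Forall afp_letter w ->
    sorted (fun c d => c.1 != d.1) w -> E (afp_word w) = 0 }.

End amalgamated_free_product.

(* M need not act on the Hilbert space of N, so the inclusion of N in M is a
   normal embedding j, and the expectation of M onto N is j \o EM. *)
Section HNN_extension.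
Variables (R : realType) (HN HM : hilbertType R).
Variables (N D : set (HN -> HN)) (theta : (HN -> HN) -> (HN -> HN)).
Variables (ED Etheta : (HN -> HN) -> (HN -> HN)).
Variables (M : set (HM -> HM)) (j : (HN -> HN) -> (HM -> HM)).
Variables (EM : (HM -> HM) -> (HN -> HN)) (u : HM -> HM).

Definition upow (eps : bool) : HM -> HM := if eps then u else adj u.

(* The word u^e n_1 u^(e_1) ... n_l u^(e_l) is encoded by e and the list of the
   (n_i, e_i), where true stands for 1 and false for -1. *)
Fixpoint hnn_word (e : bool) (w : seq ((HN -> HN) * bool)) : HM -> HM :=
  if w is (n, e') :: w' then upow e \o j n \o hnn_word e' w' else upow e.

Fixpoint hnn_reduced (e : bool) (w : seq ((HN -> HN) * bool)) : Prop :=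
  if w is (n, e') :: w' then
    [/\ N n, (e = true -> e' = false -> ker_on N Etheta n),
        (e = false -> e' = true -> ker_on N ED n) & hnn_reduced e' w']
  else True.

Record HNN_extension : Prop := {
  hnn_vN : von_neumann M ;
  hnn_embedding : normal_embedding N M j ;
  hnn_into : forall x, M x -> N (EM x) ;
  hnn_exp : fn_cond_exp M (j @` N) (j \o EM) ;
  hnn_u : M u ;
  hnn_uV : u \o adj u = idfun ;
  hnn_Vu : adj u \o u = idfun ;
  hnn_generated : M = vN_generated (j @` N `|` [set u]) ;
  hnn_conj : forall d, D d -> u \o j (theta d) \o adj u = j d ;
  hnn_free : forall e w, hnn_reduced e w -> EM (hnn_word e w) = 0 }.

End HNN_extension.

(* Main.v *)
(* The isomorphism is the closure of its restriction to words.  Let G be the von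
   Neumann algebra on HP + HM generated by the pairs (l_i x, k_i x) and (0, 1 - p),
   where k_1 x = x + 0 and k_2 y = u (0 + y) u^*.  An alternating product of centred
   k_i x is, up to its end letters, a reduced word of the HNN extension, so E and F
   both kill alternating centred words and agree on the *-algebra spanned by words.
   The agreement extends to G: every normal positive functional is dominated by
   vector functionals below enough positive elements (Zorn), whence a *-subalgebra
   with the same commutant is dense in the seminorm f(x^* x)^(1/2).  Faithfulness
   of E and F now shows that G, cut down by (1, p), is the graph of an injective map.
   That it is everywhere defined and onto is the reduction theorem: if e is a
   projection in the commutant G' and r e = 0 forces r = 0 in G, then every operator
   e x e commuting with e G' e is of the form r e with r in G.  Finally M_0 consists
   of 2 x 2 matrices over the corner, with v = p u as off-diagonal unit, so p M_0 p is
   generated by k_1 P_1 and k_2 P_2. *)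

From HB Require Import structures.
Require Import Defs.
From mathcomp Require Import all_boot all_order all_algebra.
From mathcomp Require Import complex.
From mathcomp Require Import all_classical all_reals all_analysis.
From mathcomp Require Import ring lra.
Import Order.TTheory GRing.Theory Num.Theory.
Import numFieldNormedType.Exports.
Local Open Scope classical_set_scope.
Local Open Scope ring_scope.

Set Implicit Arguments.
Unset Strict Implicit.
Unset Printing Implicit Defensive.

(** The obstacle is the passage from words to the weak closure. Normality is given only by suprema
    of directed sets, so no continuity is available beforehand. The density theorem replaces the
    completion of the algebra in the seminorm of [f] by minimising sequences, and tests the
    commutation of the missing projection with the algebra on vectors of [H] itself. [E] and [F]
    take values in different algebras and become comparable once they are pulled back to [Q]. A
    pull-back along an embedding is positive because an embedding with an expectation onto its range
    reflects positivity, and this is what the square roots inside the range are for. The pair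
    [(0, 1 - p)] makes up for the unit of the corner: pairs of letters have unit [(1, p)], whereas a
    von Neumann algebra here contains the identity. Because of it, the second component in the graph
    is determined only after multiplication by [p]. *)

(** * Elementary real inequalities *)

Lemma quadratic_ge0_discr (R : realFieldType) (a b c : R) :
  (forall t, 0 <= a * t ^+ 2 + 2 * b * t + c) -> b ^+ 2 <= a * c.
Proof.
move=> h; have c0 : 0 <= c by have := h 0; lra.
have [a0|a0|a0] := ltgtP a 0; last 1 first.
- have [->|b0] := eqVneq b 0; first by rewrite expr0n/= a0 mul0r.
  have := h (- (c + 1) / (2 * b)).
  have -> : a * (- (c + 1) / (2 * b)) ^+ 2 + 2 * b * (- (c + 1) / (2 * b)) + c
      = - 1 by rewrite a0; field.
  lra.
(* For [a < 0] the form is negative at an explicit point of absolute value at least 1 and of sign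
   opposite to [b], chosen so that the terms in [a] and [b] together fall below [- c]. *)
- have [b0|b0] := leP b 0.
    have h1 := h ((1 + c - 2 * b) / - a + 1).
    have e : a * ((1 + c - 2 * b) / - a + 1) = a - (1 + c - 2 * b).
      by field; rewrite lt_eqF.
    set t := _ / _ + 1 in h1 e.
    have t1 : 1 <= t.
      by rewrite /t lerDr divr_ge0//; lra.
    have : (a * t + 2 * b) * t + c < 0 by rewrite e; nra.
    have -> : (a * t + 2 * b) * t + c = a * t ^+ 2 + 2 * b * t + c by ring.
    lra.
  have h1 := h (- ((1 + c + 2 * b) / - a + 1)).
  have e : a * ((1 + c + 2 * b) / - a + 1) = a - (1 + c + 2 * b).
    by field; rewrite lt_eqF.
  set t := _ / _ + 1 in h1 e.
  have t1 : 1 <= t.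
    by rewrite /t lerDr divr_ge0//; lra.
  have : (a * t - 2 * b) * t + c < 0 by rewrite e; nra.
  have -> : (a * t - 2 * b) * t + c = a * (- t) ^+ 2 + 2 * b * (- t) + c by ring.
  lra.
- have := h (- b / a).
  have -> : a * (- b / a) ^+ 2 + 2 * b * (- b / a) + c = (a * c - b ^+ 2) / a.
    by field; rewrite gt_eqF.
  by rewrite pmulr_lge0 ?invr_gt0// subr_ge0.
Qed.

(** The restriction [e <= 1] lets callers absorb terms quadratic in [e] into the constant [c]. *)
Lemma ler_addgt0Ml (R : realFieldType) (a b c : R) :
  (forall e, 0 < e -> e <= 1 -> a <= b + e * c) -> a <= b.
Proof.
move=> h; have [//|ba] := leP a b.
pose e := Num.min 1 ((a - b) / (2 * (`|c| + 1))).
have c1 : 0 < `|c| + 1 by rewrite ltr_wpDl.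
have e0 : 0 < e by rewrite lt_min ltr01/= divr_gt0 ?subr_gt0 ?mulr_gt0.
have e1 : e <= 1 by rewrite ge_min lexx.
have e2 : e <= (a - b) / (2 * (`|c| + 1)) by rewrite ge_min lexx orbT.
have e3 : e * (2 * (`|c| + 1)) <= a - b by rewrite -ler_pdivlMr ?mulr_gt0.
have := h e e0 e1; have := ler_norm c; nra.
Qed.

(** * Real inner products on Hilbert spaces *)

Section hilbert.
Variables (R : realType) (H : hilbertType R).
Local Notation C := R[i].
Implicit Types u v w : H.

(** Inequalities are stated for the real part, as [R] is totally ordered and [R[i]] is not; the
    imaginary part is recovered in [Im_hdot]. *)
Definition rdot u v : R := complex.Re (hdot u v).

Definition nm u : R := Num.sqrt (rdot u u).

Lemma hdotDl u v w : hdot (u + v) w = hdot u w + hdot v w.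
Proof. exact: linearDl. Qed.

Lemma hdotZl (a : C) u v : hdot (a *: u) v = a * hdot u v.
Proof. exact: linearZl_LR. Qed.

Lemma ReD (x y : C) : complex.Re (x + y) = complex.Re x + complex.Re y.
Proof. by case: x y => [a b] [c d]. Qed.

Lemma ReZ (r : R) (x : C) : complex.Re (r%:C%C * x) = r * complex.Re x.
Proof. by case: x => [a b]; rewrite /= mul0r subr0. Qed.

Lemma ReJ (x : C) : complex.Re x^* = complex.Re x.
Proof. by case: x. Qed.

Lemma rdotC u v : rdot u v = rdot v u.
Proof. by rewrite /rdot hdotC ReJ. Qed.

Lemma rdotDl u v w : rdot (u + v) w = rdot u w + rdot v w.
Proof. by rewrite /rdot hdotDl ReD. Qed.

Lemma rdotDr u v w : rdot u (v + w) = rdot u v + rdot u w.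
Proof. by rewrite rdotC rdotDl !(rdotC u). Qed.

Lemma rdotZl (r : R) u v : rdot (r%:C%C *: u) v = r * rdot u v.
Proof. by rewrite /rdot hdotZl ReZ. Qed.

Lemma rdotZr (r : R) u v : rdot u (r%:C%C *: v) = r * rdot u v.
Proof. by rewrite rdotC rdotZl rdotC. Qed.

Lemma rdotNl u v : rdot (- u) v = - rdot u v.
Proof.
have -> : - u = (-1)%:C%C *: u by rewrite rmorphN1 scaleN1r.
by rewrite rdotZl mulN1r.
Qed.

Lemma rdotNr u v : rdot u (- v) = - rdot u v.
Proof. by rewrite rdotC rdotNl rdotC. Qed.

Lemma rdotBl u v w : rdot (u - v) w = rdot u w - rdot v w.
Proof. by rewrite rdotDl rdotNl. Qed.

Lemma rdotBr u v w : rdot u (v - w) = rdot u v - rdot u w.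
Proof. by rewrite rdotDr rdotNr. Qed.

Lemma rdot0l u : rdot 0 u = 0.
Proof. by have := rdotBl 0 0 u; rewrite !subrr. Qed.

Lemma rdot0r u : rdot u 0 = 0.
Proof. by rewrite rdotC rdot0l. Qed.

Lemma hdot_uu u : hdot u u = (rdot u u)%:C%C.
Proof.
have : 0 <= hdot u u by rewrite -hdot_normE exprn_ge0.
by rewrite /rdot => /ger0_real /RRe_real ->.
Qed.

Lemma rdot_ge0 u : 0 <= rdot u u.
Proof. by rewrite -ler0c -hdot_uu -hdot_normE exprn_ge0. Qed.

Lemma nm_ge0 u : 0 <= nm u. Proof. exact: sqrtr_ge0. Qed.

Lemma sqr_nm u : nm u ^+ 2 = rdot u u.
Proof. by rewrite sqr_sqrtr// rdot_ge0. Qed.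

Lemma normE u : `|u| = (nm u)%:C%C.
Proof.
apply/eqP; rewrite -(@eqrXn2 _ 2)// ?ler0c ?nm_ge0//.
by rewrite hdot_normE hdot_uu -rmorphXn/= sqr_nm.
Qed.

Lemma nm0 : nm 0 = 0. Proof. by rewrite /nm rdot0l sqrtr0. Qed.

Lemma nm_eq0 u : nm u = 0 -> u = 0.
Proof. by move=> e; apply/eqP; rewrite -normr_eq0 normE e. Qed.

Lemma rdot_eq0 u : rdot u u = 0 -> u = 0.
Proof. by move=> e; apply: nm_eq0; rewrite /nm e sqrtr0. Qed.

Lemma nmD u v : nm (u + v) <= nm u + nm v.
Proof. by rewrite -lecR rmorphD/= -!normE ler_normD. Qed.

Lemma nmN u : nm (- u) = nm u.
Proof. by rewrite /nm rdotNl rdotNr opprK. Qed.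

Lemma nmB u v : nm (u - v) = nm (v - u).
Proof. by rewrite -nmN opprB. Qed.

Lemma nmZ (a : C) u : nm (a *: u) = Normc.normc a * nm u.
Proof.
apply: complexI; rewrite -normE normrZ normE rmorphM/=; congr (_ * _).
Qed.

Lemma nm_sub u v : nm u <= nm v + nm (u - v).
Proof. by rewrite -{1}(subrK v u) addrC nmD. Qed.

Lemma rdot_CS u v : rdot u v ^+ 2 <= rdot u u * rdot v v.
Proof.
apply: quadratic_ge0_discr => t; have := rdot_ge0 (t%:C%C *: u + v).
rewrite !(rdotDl, rdotDr, rdotZl, rdotZr) (rdotC v u).
by move/le_trans; apply; rewrite le_eqVlt; apply/orP; left; apply/eqP; ring.
Qed.

Lemma rdot_le u v : rdot u v <= nm u * nm v.
Proof.
apply: le_trans (ler_norm _) _.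
rewrite -(@ler_pXn2r _ 2)// ?nnegrE ?mulr_ge0 ?nm_ge0//.
by rewrite real_normK ?num_real// exprMn !sqr_nm rdot_CS.
Qed.

Lemma rdot_inj u v : (forall w, rdot w u = rdot w v) -> u = v.
Proof.
by move=> h; apply/eqP; rewrite -subr_eq0; apply/eqP/rdot_eq0; rewrite rdotBr h subrr.
Qed.

Lemma Im_hdot u v : complex.Im (hdot u v) = rdot u ('i%C *: v).
Proof. by rewrite /rdot hdotZr; case: (hdot u v) => a b /=; ring. Qed.

(** Filters rather than sequences, because limits along directed sets of operators are needed as
    well. *)
Lemma hilbert_complete (T : Type) (F : set_system T) (f : T -> H) :
  ProperFilter F ->
  (forall e, 0 < e -> exists2 A, F A & forall x y, A x -> A y -> nm (f x - f y) < e) ->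
  exists g, forall e, 0 < e -> F [set x | nm (f x - g) < e].
Proof.
move=> FF Fc; have c : cauchy (f @ F).
  apply: (@cauchy_exP _ _ _ (fmap_filter f FF)) => e e0.
  have [r er] : exists r : R, e = r%:C%C.
    by apply/complex_realP; rewrite realE (ltW e0).
  rewrite er ltcR in e0; have [A FA hA] := Fc r e0.
  have [x Ax] := filter_ex FA.
  exists (f x); rewrite /fmap/=; apply: filterS FA => y Ay.
  by rewrite -ball_normE /ball_/= normE er ltcR hA.
have [g gP] := (cvg_ex _).1 (cauchy_cvg (f @ F) c).
exists g => e e0; have e0' : 0 < (e%:C)%C :> C by rewrite ltcR.
have h : F [set x | `|g - f x| < (e%:C)%C].
  exact: ((cvgrPdist_lt (FF := fmap_proper_filter f FF) _ _).1 gP _ e0').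
by apply: filterS h => x /=; rewrite normE ltcR nmB.
Qed.

End hilbert.

Lemma hdot_rdot (R : realType) (H K : hilbertType R) (u v : H) (w z : K) : rdot u v = rdot w z ->
  rdot u ('i%C *: v) = rdot w ('i%C *: z) -> hdot u v = hdot w z.
Proof.
rewrite -!Im_hdot /rdot.
by case: (hdot u v) (hdot w z) => a b [c d] /= -> ->.
Qed.

(** * Subspaces, semi-inner products and minimising sequences *)

Section subspaces.
Variables (R : realType) (X : lmodType R[i]).

Definition rsub (V : set X) :=
  V 0 /\ forall (r : R) x y, V x -> V y -> V (r%:C%C *: x + y).

Definition csub (V : set X) :=
  V 0 /\ forall (a : R[i]) x y, V x -> V y -> V (a *: x + y).

Lemma csub_rsub V : csub V -> rsub V.
Proof. by case=> V0 VD; split=> // r x y; exact: VD. Qed.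

Lemma csubD V x y : csub V -> V x -> V y -> V (x + y).
Proof. by case=> _ VD Vx Vy; rewrite -(scale1r x); exact: VD. Qed.

Lemma csubZ V a x : csub V -> V x -> V (a *: x).
Proof. by case=> V0 VD Vx; rewrite -(addr0 (_ *: _)); exact: VD. Qed.

Lemma csubN V x : csub V -> V x -> V (- x).
Proof. by move=> sV Vx; rewrite -scaleN1r; exact: csubZ. Qed.

Lemma csubB V x y : csub V -> V x -> V y -> V (x - y).
Proof. by move=> sV Vx Vy; apply: csubD => //; exact: csubN. Qed.

(** The form may be degenerate, and [D] need not be complete. Instances are [rdot], the form of a
    positive operator, and [f (adj y \o x)] for a normal positive functional [f]. *)
Record sip (D : set X) (s : X -> X -> R) : Prop := {
  sip_sub : rsub D ;
  sip_lin : forall (r : R) x y z, D x -> D y -> D z ->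
    s (r%:C%C *: x + y) z = r * s x z + s y z ;
  sip_sym : forall x y, D x -> D y -> s x y = s y x ;
  sip_ge0 : forall x, D x -> 0 <= s x x }.

Section sip.
Variables (D : set X) (s : X -> X -> R) (hs : sip D s).

Lemma sipZ (r : R) x : D x -> D (r%:C%C *: x).
Proof.
have [D0 DD] := sip_sub hs; move=> Dx; rewrite -(addr0 (_ *: _)); exact: DD.
Qed.

Lemma sipD x y : D x -> D y -> D (x + y).
Proof.
have [D0 DD] := sip_sub hs; move=> Dx Dy.
rewrite -(scale1r x); have := DD 1 x y Dx Dy; by rewrite rmorph1.
Qed.

Lemma sipN x : D x -> D (- x).
Proof. by move=> Dx; rewrite -scaleN1r -(rmorphN1 (real_complex R)); exact: sipZ. Qed.

Lemma sipB x y : D x -> D y -> D (x - y).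
Proof. by move=> Dx Dy; apply: sipD => //; exact: sipN. Qed.

Lemma sipDl x y z : D x -> D y -> D z -> s (x + y) z = s x z + s y z.
Proof.
move=> Dx Dy Dz; have := sip_lin hs 1 Dx Dy Dz.
by rewrite rmorph1 scale1r mul1r.
Qed.

Lemma sip0l z : D z -> s 0 z = 0.
Proof.
move=> Dz; have [D0 _] := sip_sub hs.
by have /eqP := sipDl D0 D0 Dz; rewrite addr0 -subr_eq subrr eq_sym => /eqP.
Qed.

Lemma sipZl (r : R) x z : D x -> D z -> s (r%:C%C *: x) z = r * s x z.
Proof.
move=> Dx Dz; have [D0 _] := sip_sub hs.
by have := sip_lin hs r Dx D0 Dz; rewrite addr0 => ->; rewrite sip0l// addr0.
Qed.

Lemma sipNl x z : D x -> D z -> s (- x) z = - s x z.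
Proof.
move=> Dx Dz; rewrite -scaleN1r -(rmorphN1 (real_complex R)) sipZl//.
by rewrite mulN1r.
Qed.

Lemma sipBl x y z : D x -> D y -> D z -> s (x - y) z = s x z - s y z.
Proof. by move=> Dx Dy Dz; rewrite sipDl// ?sipNl//; exact: sipN. Qed.

Lemma sipDr x y z : D x -> D y -> D z -> s z (x + y) = s z x + s z y.
Proof.
move=> Dx Dy Dz; rewrite (sip_sym hs)//; last exact: sipD.
by rewrite sipDl// (sip_sym hs Dz Dx) (sip_sym hs Dz Dy).
Qed.

Lemma sipBr x y z : D x -> D y -> D z -> s z (x - y) = s z x - s z y.
Proof.
move=> Dx Dy Dz; rewrite (sip_sym hs)//; last exact: sipB.
by rewrite sipBl// (sip_sym hs Dz Dx) (sip_sym hs Dz Dy).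
Qed.

Lemma sipZr (r : R) x z : D x -> D z -> s z (r%:C%C *: x) = r * s z x.
Proof.
move=> Dx Dz; rewrite (sip_sym hs)//; last exact: sipZ.
by rewrite sipZl// (sip_sym hs Dz Dx).
Qed.

Lemma sip_quad (t : R) x y : D x -> D y ->
  s (t%:C%C *: x + y) (t%:C%C *: x + y) =
  s x x * t ^+ 2 + 2 * s x y * t + s y y.
Proof.
move=> Dx Dy; have Dtx := sipZ t Dx; have Dz := sipD Dtx Dy.
rewrite sipDl// !sipDr// !sipZl// !sipZr// (sip_sym hs Dy Dx); ring.
Qed.

Lemma sip_CS x y : D x -> D y -> s x y ^+ 2 <= s x x * s y y.
Proof.
move=> Dx Dy; apply: quadratic_ge0_discr => t.
by rewrite -sip_quad//; apply/(sip_ge0 hs)/sipD => //; exact: sipZ.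
Qed.

(* A bounded functional [f] is represented by a minimizing sequence of
   [s v v - 2 f v]; [X] need not be complete, so there may be no limit. *)
Lemma riesz_seq (V : set X) (f : X -> R) (K : R) :
  V `<=` D -> rsub V ->
  (forall r x y, V x -> V y -> f (r%:C%C *: x + y) = r * f x + f y) ->
  0 <= K -> (forall x, V x -> f x ^+ 2 <= K * s x x) ->
  exists a : nat -> X, [/\ (forall n, V (a n)),
    (forall n v, V v -> (f v - s v (a n)) ^+ 2 <= n.+1%:R^-1 * s v v) &
    forall n m, s (a n - a m) (a n - a m) <= 2 * (n.+1%:R^-1 + m.+1%:R^-1)].
Proof.
move=> VD [V0 VV] flin K0 fK.
pose J x := s x x - 2 * f x.
(* The bound on [f] gives [2 * f x <= K + s x x], so [J] is bounded below on [V]. *)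
have JK x : V x -> - K <= J x.
  move=> Vx; rewrite /J; have := fK x Vx; have := sip_ge0 hs (VD _ Vx).
  move: (s x x) (f x) => S F S0 FS; rewrite lerNl opprB lerBlDr.
  have SK : 0 <= K + S by rewrite addr_ge0.
  apply: le_trans (ler_norm _) _.
  rewrite -(@ler_pXn2r _ 2)// ?nnegrE// real_normK ?num_real//.
  have := sqr_ge0 (K - S); nra.
have hi : has_inf (J @` V).
  by split; [exists (J 0), 0|exists (- K) => _ [x Vx <-]; exact: JK].
pose d := inf (J @` V).
have dJ x : V x -> d <= J x by move=> Vx; apply: (ge_inf hi.2); exists x.
have /choice[a ha] : forall n : nat, exists x, V x /\ J x < d + n.+1%:R^-1.
  move=> n; have e0 : 0 < (n.+1%:R^-1 : R) by rewrite invr_gt0 ltr0n.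
  by have [_ [x Vx <-] ?] := inf_adherent e0 hi; exists x.
have Va n : V (a n) by have [] := ha n.
(* [a n] minimises [J] up to [n.+1%:R^-1], so [J (t v + a n) - J (a n)] plus this error is a
   nonnegative quadratic polynomial in [t]; its discriminant gives the bound. *)
have key n v : V v -> (f v - s v (a n)) ^+ 2 <= n.+1%:R^-1 * s v v.
  move=> Vv; rewrite mulrC -sqrrN opprB; apply: quadratic_ge0_discr => t.
  have h := dJ _ (VV t _ _ Vv (Va n)); have [_ h'] := ha n.
  rewrite /J sip_quad// ?flin// in h; try exact: VD.
  rewrite /J in h'; move: (f (a n)) (f v) (s v v) (s v (a n)) (s (a n) (a n)) h h'.
  move: (n.+1%:R^-1 : R) => e; clearbody d; clear=> f0 f1 s0 s1 s2 h1 h2.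
  have -> : s0 * t ^+ 2 + 2 * (s1 - f1) * t + e = (s0 * t ^+ 2 + 2 * s1 * t + s2 - 2 * (t * f1 + f0)) - (s2 - 2 * f0) + e by ring.
  lra.
exists a; split=> // n m.
have Dn := VD _ (Va n); have Dm := VD _ (Va m).
have Vb : V (a n - a m).
  rewrite -(scaleN1r (a m)) addrC -(rmorphN1 (real_complex R)); exact: VV.
have Db := VD _ Vb.
have := key n _ Vb; have := key m _ Vb; have := sip_ge0 hs Db.
rewrite [X in _ -> _ -> _ -> X <= _]sipBr//.
have e0 k : 0 <= (k.+1%:R^-1 : R) by rewrite invr_ge0 ler0n.
move: (n.+1%:R^-1 : R) (m.+1%:R^-1 : R) (e0 n) (e0 m) => p q p0 q0.
have -> : s (a n - a m) (a n - a m) = s (a n - a m) (a n) - s (a n - a m) (a m).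
  by rewrite sipBr.
move: (f _) (s _ (a n)) (s _ (a m)) => F x y S0 h1 h2.
(* The value [F] of the functional at [a n - a m] cancels when the two estimates are subtracted. *)
have h : (x - y) ^+ 2 <= (x - y) * (2 * (p + q)).
  have -> : x - y = (F - y) - (F - x) by ring.
  have := sqr_ge0 ((F - y) + (F - x)); nra.
have [->|S1] := eqVneq (x - y) 0; first by rewrite mulr_ge0// addr_ge0.
by rewrite -(@ler_pM2l _ (x - y)) ?lt_neqAle ?S0 1?eq_sym ?S1// -expr2.
Qed.

End sip.
End subspaces.

Lemma near_inv_nat (R : realType) (e : R) : 0 < e ->
  \forall n \near \oo, n.+1%:R^-1 < e.
Proof. by move=> e0; near=> n; near: n; exact: near_infty_natSinv_lt (PosNum e0). Unshelve. all: by end_near. Qed.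

(** * Riesz representation and adjoints *)

Section riesz.
Variables (R : realType).

(** [perp (perp V)] stands for the closure of a subspace. Real orthogonality agrees with the complex
    one when [V] is a complex subspace. *)
Definition perp (H : hilbertType R) (V : set H) : set H :=
  [set u | forall v, V v -> rdot v u = 0].

Lemma rdot_sip (H : hilbertType R) : sip setT (@rdot R H).
Proof.
split=> //; first by move=> r x y z _ _ _; rewrite rdotDl rdotZl.
  by move=> x y _ _; exact: rdotC.
by move=> x _; exact: rdot_ge0.
Qed.

Lemma perp2 (H : hilbertType R) (V : set H) u : V u -> perp (perp V) u.
Proof. by move=> Vu v Vv; rewrite rdotC Vv. Qed.

Lemma perp_eq (H : hilbertType R) (V : set H) g g' :
  perp (perp V) g -> perp (perp V) g' ->
  (forall v, V v -> rdot v g = rdot v g') -> g = g'.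
Proof.
move=> hg hg' e; apply/eqP; rewrite -subr_eq0; apply/eqP/rdot_eq0.
have p : perp V (g - g') by move=> v Vv; rewrite rdotBr e// subrr.
by rewrite {2}/GRing.add/= -/(g - g') rdotBr hg// hg'// subrr.
Qed.

Lemma perp_csub (H : hilbertType R) (V : set H) : csub V -> csub (perp V).
Proof.
move=> [V0 VV]; split=> [v _|a x y hx hy v Vv]; first by rewrite rdot0r.
rewrite rdotDr hy// addr0.
have VZ b : V (b *: v) by rewrite -(addr0 (_ *: _)); exact: VV.
have := hx _ (VZ a^*); by rewrite /rdot hdotZl hdotZr.
Qed.

Lemma riesz (H : hilbertType R) (V : set H) (f : H -> R) (c : R) :
  rsub V ->
  (forall r x y, V x -> V y -> f (r%:C%C *: x + y) = r * f x + f y) ->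
  0 <= c -> (forall x, V x -> `|f x| <= c * nm x) ->
  exists g, [/\ (forall v, V v -> f v = rdot v g), perp (perp V) g & nm g <= c].
Proof.
move=> sV flin c0 fc.
have f2 x : V x -> f x ^+ 2 <= c ^+ 2 * rdot x x.
  move=> Vx; rewrite -sqr_nm -exprMn -[f x ^+ 2]real_normK ?num_real//.
  by rewrite ler_pXn2r ?nnegrE ?mulr_ge0 ?nm_ge0// fc.
have [a [Va hf ha]] := riesz_seq (rdot_sip H) (subsetT V) sV flin (exprn_ge0 2 c0) f2.
have ca e : 0 < e -> exists2 A, (\oo : set_system nat) A &
    forall n m, A n -> A m -> nm (a n - a m) < e.
  move=> e0; exists [set n | n.+1%:R^-1 < e ^+ 2 / 4].
    by apply: near_inv_nat; rewrite divr_gt0// exprn_gt0.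
  move=> n m /= hn hm; rewrite -(@ltr_pXn2r _ 2)// ?nnegrE ?nm_ge0 ?ltW//.
  rewrite sqr_nm; have := ha n m; move: hn hm.
  move: (n.+1%:R^-1 : R) (m.+1%:R^-1 : R) => p q; lra.
have [g hg] := hilbert_complete (F := \oo) _ ca.
have fg v : V v -> f v = rdot v g.
  move=> Vv; have h e : 0 < e -> e <= 1 -> `|f v - rdot v g| <= 0 + e * (2 * nm v).
    move=> e0 e1.
    have : \forall n \near \oo, n.+1%:R^-1 < e ^+ 2 /\ nm (a n - g) < e.
      by apply: filterI; [apply: near_inv_nat; rewrite exprn_gt0|exact: hg].
    move=> /filter_ex[n [n1 n2]].
    have -> : f v - rdot v g = (f v - rdot v (a n)) + rdot v (a n - g).
      by rewrite rdotBr addrA subrK.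
    rewrite (le_trans (ler_normD _ _))// add0r mulrCA mulr_natl mulr2n lerD//.
      rewrite -(@ler_pXn2r _ 2)// ?nnegrE ?mulr_ge0 ?nm_ge0// ?(ltW e0)//.
      rewrite real_normK ?num_real// (le_trans (hf n v Vv))// exprMn sqr_nm.
      by rewrite ler_wpM2r ?rdot_ge0// ltW.
    have l1 := rdot_le v (a n - g); have l2 := rdot_le (- v) (a n - g).
    rewrite nmN rdotNl in l2; rewrite ler_norml; have := nm_ge0 v; nra.
  have := ler_addgt0Ml h; rewrite normr_le0 subr_eq0 => /eqP//.
have gp : perp (perp V) g.
  move=> v pv; apply/eqP; rewrite -normr_le0.
  apply: (@ler_addgt0Ml _ _ _ (nm v)) => e e0 e1.
  have /filter_ex[n /= n2] := hg e e0.
  have e2 : rdot v (a n) = 0 by rewrite rdotC pv.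
  have l1 := rdot_le v (a n - g); have l2 := rdot_le (- v) (a n - g).
  rewrite rdotBr e2 in l1; rewrite nmN rdotNl rdotBr e2 in l2.
  rewrite ler_norml; have := nm_ge0 v; nra.
exists g; split=> //.
(* [g] is only a limit of points of [V], so the bound on [f] is applied at [a n] and passed to the
   limit. *)
have h : nm g ^+ 2 <= c * nm g.
  apply: (@ler_addgt0Ml _ _ _ (c + nm g)) => e e0 e1.
  have /filter_ex[n /= n2] := hg e e0.
  have h1 := fc _ (Va n); rewrite fg// in h1.
  have h2 := nm_sub (a n) g.
  have h3 := rdot_le (g - a n) g; rewrite nmB rdotBl -sqr_nm in h3.
  have := ler_norm (rdot (a n) g); have := nm_ge0 g; nra.
have [g0|g0] := eqVneq (nm g) 0; first by rewrite g0.
by rewrite -(ler_pM2r (_ : 0 < nm g)) ?lt_neqAle ?nm_ge0 1?eq_sym ?g0// -expr2.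
Qed.

(** With [V] the whole space this gives adjoints; with [h] the inclusion, the orthogonal projection
    onto the closure of [V]; otherwise it yields an everywhere defined operator from one given only
    on a subspace. *)
Lemma riesz_adjoint (H K : hilbertType R) (V : set H) (h : H -> K) (c : R) :
  csub V -> (forall a u v, V u -> V v -> h (a *: u + v) = a *: h u + h v) ->
  0 <= c -> (forall u, V u -> nm (h u) <= c * nm u) ->
  exists y : K -> H, [/\ (forall a u v, y (a *: u + v) = a *: y u + y v),
    (forall w, nm (y w) <= c * nm w),
    (forall v w, V v -> hdot (h v) w = hdot v (y w)) &
    forall w, perp (perp V) (y w)].
Proof.
move=> sV hlin c0 hc.
have hZ (b : R[i]) v : V v -> h (b *: v) = b *: h v.
  move=> Vv; have e := hlin 1 0 0 sV.1 sV.1.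
  have h0 : h 0 = 0.
    by apply/eqP; move/eqP: e; rewrite !scale1r addr0 -subr_eq subrr eq_sym.
  by have := hlin b v 0 Vv sV.1; rewrite !addr0 h0 addr0.
have /choice[y hy] : forall w, exists g,
    [/\ (forall v, V v -> rdot (h v) w = rdot v g), perp (perp V) g &
        nm g <= c * nm w].
  move=> w; apply: riesz; [exact: csub_rsub| | |].
  - by move=> r u v Vu Vv; rewrite hlin// rdotDl rdotZl.
  - by rewrite mulr_ge0 ?nm_ge0.
  move=> v Vv; have l1 := rdot_le (h v) w; have l2 := rdot_le (- h v) w.
  rewrite nmN rdotNl in l2; have := hc v Vv; rewrite ler_norml.
  have := nm_ge0 w; nra.
have yV w : perp (perp V) (y w) by have [] := hy w.
have yE v w : V v -> rdot (h v) w = rdot v (y w) by move=> Vv; have [->] := hy w.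
have yH v w : V v -> hdot (h v) w = hdot v (y w).
  move=> Vv; apply: hdot_rdot; first exact: yE.
  (* Imaginary parts reduce to real ones by moving ['i] to the left factor, where [h] is complex
     linear. *)
  have flip (L : hilbertType R) (x z : L) : rdot x ('i%C *: z) = rdot (- 'i%C *: x) z.
    by rewrite /rdot hdotZr hdotZl; case: (hdot x z) => p q /=; ring.
  rewrite !flip -hZ// yE//; exact: csubZ.
exists y; split=> // [a u v|w]; last by have [] := hy w.
apply: (perp_eq (V := V)) => //.
  by apply: (perp_csub (perp_csub sV)).2.
move=> z Vz; rewrite /rdot -yH// !hdotDr !hdotZr.
by rewrite -!yH.
Qed.

End riesz.

(** * Bounded operators and commutants *)

Section bounded.
Variables (R : realType) (H : hilbertType R).
Local Notation C := R[i].
Local Notation bop := (@bounded_op R H).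
Implicit Types (x y z : H -> H) (u v w : H) (S A : set (H -> H)).

Lemma opDE x y u : (x + y) u = x u + y u. Proof. by []. Qed.

Lemma opNE x u : (- x) u = - x u. Proof. by []. Qed.

Lemma opZE (a : C) x u : (a *: x) u = a *: x u. Proof. by []. Qed.

Lemma op0E u : (0 : H -> H) u = 0. Proof. by []. Qed.

Definition opE := (opDE, opNE, opZE, op0E).

Definition opb x (c : R) := 0 <= c /\ forall u, nm (x u) <= c * nm u.

Lemma bounded_opP x : bounded_op x <-> linear x /\ exists c, opb x c.
Proof.
split=> [[xl xc]|[xl [c [c0 xc]]]]; split=> //.
  pose f : {linear H -> H} := HB.pack x (GRing.isLinear.Build C H H *:%R x xl).
  have /linear_bounded_continuous/linear_boundedP fb : continuous f by [].
  have /pinfty_ex_gt0[r r0 hr] := fb.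
  have [c er] : exists c : R, r = c%:C%C.
    by apply/complex_realP; rewrite realE (ltW r0).
  exists c; split=> [|u]; first by rewrite er ltcR in r0; exact: ltW.
  by have := hr u; rewrite /= !normE er -rmorphM lecR.
pose f : {linear H -> H} := HB.pack x (GRing.isLinear.Build C H H *:%R x xl).
change (continuous f); apply/linear_bounded_continuous/linear_boundedP.
near=> r => u; rewrite !normE.
apply: (@le_trans _ _ ((c * nm u)%:C%C)); first by rewrite lecR xc.
rewrite rmorphM/= ler_wpM2r// ?ler0c ?nm_ge0//.
near: r; apply: nbhs_pinfty_ge; by rewrite realE ler0c c0.
Unshelve. all: by end_near. Qed.

Lemma bop_linear x : bounded_op x -> forall a u v, x (a *: u + v) = a *: x u + x v.
Proof. by case=> xl _; exact: xl. Qed.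

Lemma bopD x : bounded_op x -> forall u v, x (u + v) = x u + x v.
Proof. by move=> bx u v; have := bop_linear bx 1 u v; rewrite !scale1r. Qed.

Lemma bop0 x : bounded_op x -> x 0 = 0.
Proof.
move=> bx; apply/eqP; have /eqP := bopD bx 0 0.
by rewrite addr0 -subr_eq subrr eq_sym.
Qed.

Lemma bopZ x : bounded_op x -> forall a u, x (a *: u) = a *: x u.
Proof.
by move=> bx a u; have := bop_linear bx a u 0; rewrite !addr0 bop0// addr0.
Qed.

Lemma bopN x : bounded_op x -> forall u, x (- u) = - x u.
Proof. by move=> bx u; rewrite -scaleN1r bopZ// scaleN1r. Qed.

Lemma bopB x : bounded_op x -> forall u v, x (u - v) = x u - x v.
Proof. by move=> bx u v; rewrite bopD// bopN. Qed.

Lemma bop_bound x : bounded_op x -> exists2 c, 0 < c & forall u, nm (x u) <= c * nm u.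
Proof.
move=> /bounded_opP[_ [c [c0 xc]]]; exists (c + 1); first by rewrite ltr_wpDl.
by move=> u; rewrite (le_trans (xc u))// ler_wpM2r ?nm_ge0// lerDl.
Qed.

Lemma bop_id : bounded_op (@idfun H).
Proof.
by apply/bounded_opP; split=> //; exists 1; split=> // u; rewrite mul1r.
Qed.

Lemma bop_comp x y : bounded_op x -> bounded_op y -> bounded_op (x \o y).
Proof.
move=> bx by_; apply/bounded_opP; split=> [a u v|].
  by rewrite /= (bop_linear by_) (bop_linear bx).
have [c c0 hc] := bop_bound bx; have [d d0 hd] := bop_bound by_.
exists (c * d); split=> [|u]; first by rewrite mulr_ge0// ltW.
by rewrite /= (le_trans (hc _))// -mulrA ler_pM2l.
Qed.

Lemma bop_lin (a : C) x y : bounded_op x -> bounded_op y -> bounded_op (a *: x + y).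
Proof.
move=> bx by_; apply/bounded_opP; split=> [b u v|].
  change (a *: x (b *: u + v) + y (b *: u + v) =
    b *: (a *: x u + y u) + (a *: x v + y v)).
  rewrite (bop_linear bx) (bop_linear by_) !scalerDr !scalerA (mulrC a b).
  by rewrite addrACA.
have [c c0 hc] := bop_bound bx; have [d d0 hd] := bop_bound by_.
have n0 : 0 <= Normc.normc a by case: (a) => p q; rewrite sqrtr_ge0.
exists (Normc.normc a * c + d); split=> [|u].
  by rewrite addr_ge0 ?mulr_ge0// ltW.
rewrite !opE (le_trans (nmD _ _))// mulrDl lerD// nmZ -mulrA ler_wpM2l//.
Qed.

Lemma bop_zero : bounded_op (0 : H -> H).
Proof.
apply/bounded_opP; split=> [a u v|]; first by rewrite !opE scaler0 addr0.
by exists 0; split=> // u; rewrite !opE nm0 mul0r.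
Qed.

Lemma csub_bop : csub (@bounded_op R H).
Proof. by split; [exact: bop_zero|move=> a x y; exact: bop_lin]. Qed.

Lemma adjointC x y : is_adjoint x y -> is_adjoint y x.
Proof. by move=> h u v; rewrite hdotC -h -hdotC. Qed.

Lemma rdot_adj x y : is_adjoint x y -> forall u v, rdot (x u) v = rdot u (y v).
Proof. by move=> h u v; rewrite /rdot h. Qed.

Lemma adj_exists x : bounded_op x -> exists2 y, is_adjoint x y & bounded_op y.
Proof.
move=> bx; have [c c0 hc] := bop_bound bx.
have sT : csub [set: H] by [].
have [y [yl yb yE _]] := riesz_adjoint sT (fun a u v _ _ => bop_linear bx a u v)
  (ltW c0) (fun u _ => hc u).
exists y; first by move=> u v; exact: yE.
by apply/bounded_opP; split=> //; exists c; split=> //; exact: ltW.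
Qed.

Lemma adjP x : bounded_op x -> is_adjoint x (adj x).
Proof. by move=> /adj_exists[y xy _]; rewrite (adjE xy). Qed.

Lemma bop_adj x : bounded_op x -> bounded_op (adj x).
Proof. by move=> /adj_exists[y xy yb]; rewrite (adjE xy). Qed.

Lemma adjK x : bounded_op x -> adj (adj x) = x.
Proof. by move=> bx; apply/adjE/adjointC/adjP. Qed.

Lemma is_adjoint_comp x y x' y' : is_adjoint x x' -> is_adjoint y y' ->
  is_adjoint (x \o y) (y' \o x').
Proof. by move=> hx hy u v; rewrite /= hx hy. Qed.

Lemma is_adjoint_lin (a : C) x y x' y' : is_adjoint x x' -> is_adjoint y y' ->
  is_adjoint (a *: x + y) (a^* *: x' + y').
Proof.
by move=> hx hy u v; rewrite !opE hdotDl hdotZl hdotDr hdotZr conjCK hx hy.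
Qed.

Lemma is_adjoint_id : is_adjoint (@idfun H) idfun.
Proof. by []. Qed.

Lemma hdot0l u : hdot 0 u = 0 :> C.
Proof. by have := hdotZl 0 0 u; rewrite scale0r mul0r. Qed.

Lemma hdot0r u : hdot u 0 = 0 :> C.
Proof. by rewrite hdotC hdot0l conjC0. Qed.

Lemma is_adjoint0 : is_adjoint (0 : H -> H) 0.
Proof. by move=> u v; rewrite !opE hdot0l hdot0r. Qed.

Lemma adj_comp x y : bounded_op x -> bounded_op y -> adj (x \o y) = adj y \o adj x.
Proof. by move=> bx by_; apply/adjE/is_adjoint_comp; exact: adjP. Qed.

Lemma adj_lin a x y : bounded_op x -> bounded_op y ->
  adj (a *: x + y) = a^* *: adj x + adj y.
Proof. by move=> bx by_; apply/adjE/is_adjoint_lin; exact: adjP. Qed.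

Lemma adj_id : adj (@idfun H) = idfun.
Proof. exact/adjE. Qed.

Lemma adj0 : adj (0 : H -> H) = 0.
Proof. exact/adjE/is_adjoint0. Qed.

Lemma adjD x y : bounded_op x -> bounded_op y -> adj (x + y) = adj x + adj y.
Proof. by move=> bx by_; have := adj_lin 1 bx by_; rewrite conjC1 !scale1r. Qed.

Lemma adjZ a x : bounded_op x -> adj (a *: x) = a^* *: adj x.
Proof.
by move=> bx; have := adj_lin a bx bop_zero; rewrite adj0 !addr0.
Qed.

Lemma adjN x : bounded_op x -> adj (- x) = - adj x.
Proof. by move=> bx; rewrite -scaleN1r adjZ// rmorphN1 scaleN1r. Qed.

Lemma adjB x y : bounded_op x -> bounded_op y -> adj (x - y) = adj x - adj y.
Proof.
move=> bx by_; rewrite adjD ?adjN//.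
exact: (csubN csub_bop by_).
Qed.

Lemma selfadjointE x : bounded_op x -> selfadjoint x <-> adj x = x.
Proof.
move=> bx; split=> [|e]; first exact: adjE.
by rewrite /selfadjoint -{2}e; exact: adjP.
Qed.

Record star_alg A : Prop := {
  sa_bop : A `<=` bop ;
  sa_sub : csub A ;
  sa_id : A idfun ;
  sa_comp : forall x y, A x -> A y -> A (x \o y) ;
  sa_adj : forall x, A x -> A (adj x) }.

Lemma compDl x y z : (x + y) \o z = (x \o z) + (y \o z).
Proof. by []. Qed.

Lemma compZl a x z : (a *: x) \o z = a *: (x \o z).
Proof. by []. Qed.

Lemma compBl x y z : (x - y) \o z = (x \o z) - (y \o z).
Proof. by []. Qed.

Lemma comp0l z : (0 : H -> H) \o z = 0.
Proof. by []. Qed.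

Lemma compDr x y z : bounded_op z -> z \o (x + y) = (z \o x) + (z \o y).
Proof. by move=> bz; apply/funext => u; rewrite /= !opE /= bopD. Qed.

Lemma compZr a x z : bounded_op z -> z \o (a *: x) = a *: (z \o x).
Proof. by move=> bz; apply/funext => u; rewrite /= !opE /= bopZ. Qed.

Lemma compNr x z : bounded_op z -> z \o (- x) = - (z \o x).
Proof. by move=> bz; apply/funext => u; rewrite /= !opE /= bopN. Qed.

Lemma compBr x y z : bounded_op z -> z \o (x - y) = (z \o x) - (z \o y).
Proof. by move=> bz; rewrite compDr// compNr. Qed.

Lemma comp0r z : bounded_op z -> z \o (0 : H -> H) = 0.
Proof. by move=> bz; apply/funext => u; rewrite /= !opE bop0. Qed.

Lemma commutant_star_alg S : S `<=` bop -> (forall x, S x -> S (adj x)) ->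
  star_alg (commutant S).
Proof.
move=> Sb Sa; split.
- by move=> x [].
- split=> [|a x y [bx hx] [by_ hy]].
    by split=> [|y Sy]; [exact: bop_zero|rewrite comp0r//; exact: Sb].
  split=> [|z Sz]; first exact: bop_lin.
  by rewrite compDl compZl hx// hy// compDr ?compZr//; exact: Sb.
- by split; [exact: bop_id|].
- move=> x y [bx hx] [by_ hy]; split=> [|z Sz]; first exact: bop_comp.
  by rewrite -[LHS]/(x \o (y \o z)) hy// -[LHS]/((x \o z) \o y) hx.
- move=> x [bx hx]; split=> [|z Sz]; first exact: bop_adj.
  have bz := Sb _ Sz.
  rewrite -[z]adjK// -!adj_comp ?hx//; try exact: bop_adj.
  by apply: Sa.
Qed.

Lemma vN_star_alg A : von_neumann A -> star_alg A.
Proof.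
move=> [Ab Aa <-]; have := commutant_star_alg Ab Aa => hA.
exact: commutant_star_alg (sa_bop hA) (sa_adj hA).
Qed.

Lemma commutantS S T : S `<=` T -> commutant T `<=` commutant S.
Proof. by move=> ST x [bx hx]; split=> // y /ST; exact: hx. Qed.

Lemma commutant2 S : S `<=` bop -> S `<=` commutant (commutant S).
Proof. by move=> Sb x Sx; split=> [|y [by_ hy]]; [exact: Sb|rewrite hy]. Qed.

Lemma commutant_vN S : S `<=` bop -> (forall x, S x -> S (adj x)) ->
  von_neumann (commutant S).
Proof.
move=> Sb Sa; have hA := commutant_star_alg Sb Sa; split.
- exact: sa_bop hA.
- exact: sa_adj hA.
- apply/seteqP; split; first exact/commutantS/commutant2.
  by apply: commutant2 => x [].
Qed.

Lemma vN_mem A x : von_neumann A ->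
  A x <-> bounded_op x /\ forall t, commutant A t -> x \o t = t \o x.
Proof.
move=> [Ab Aa AE]; split=> [Ax|h]; last by rewrite -AE.
by split=> [|t [bt ht]]; [exact: Ab|rewrite ht].
Qed.

Lemma vN_generated_sub S A : von_neumann A -> S `<=` A -> vN_generated S `<=` A.
Proof. by move=> vA SA x; apply. Qed.

Lemma sub_vN_generated S : S `<=` vN_generated S.
Proof. by move=> x Sx A [_ SA]; exact: SA. Qed.

Lemma vN_generatedE S : S `<=` bop -> (forall x, S x -> S (adj x)) ->
  vN_generated S = commutant (commutant S).
Proof.
move=> Sb Sa; have hC := commutant_star_alg Sb Sa.
apply/seteqP; split.
  apply: vN_generated_sub; last exact: commutant2.
  exact: commutant_vN (sa_bop hC) (sa_adj hC).
move=> x hx A [[Ab Aa AE] SA]; rewrite -AE.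
by move: hx; apply: commutantS; exact: commutantS.
Qed.

Lemma vN_generated_adj S : S `<=` bop ->
  vN_generated S = vN_generated (S `|` (@adj R H) @` S).
Proof.
move=> Sb; apply/seteqP; split=> x hx A [vA SA]; apply: hx; split=> //.
  by move=> y Sy; apply: SA; left.
move=> y [Sy|[z Sz <-]]; first exact: SA.
by have [_ + _] := vA; apply; exact: SA.
Qed.

Lemma vN_generated_vN S : S `<=` bop -> von_neumann (vN_generated S).
Proof.
move=> Sb; rewrite vN_generated_adj//.
have Tb : S `|` (@adj R H) @` S `<=` bop.
  by move=> x [/Sb//|[y /Sb by_ <-]]; exact: bop_adj.
have Ta x : (S `|` (@adj R H) @` S) x -> (S `|` (@adj R H) @` S) (adj x).
  move=> [Sx|[y Sy <-]]; [by right; exists x|left].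
  by rewrite adjK//; exact: Sb.
rewrite vN_generatedE//; have hC := commutant_star_alg Tb Ta.
exact: commutant_vN (sa_bop hC) (sa_adj hC).
Qed.

End bounded.

(** * Positive operators and suprema *)

Section positive.
Variables (R : realType) (H : hilbertType R).
Local Notation C := R[i].
Local Notation bop := (@bounded_op R H).
Implicit Types (x y z T : H -> H) (u v w : H) (S A : set (H -> H)).

Lemma rdot_adjoint x y : bounded_op x -> bounded_op y ->
  (forall u v, rdot (x u) v = rdot u (y v)) -> is_adjoint x y.
Proof. by move=> bx by_ h u v; apply: hdot_rdot; rewrite h// (bopZ by_). Qed.

Lemma op_ge0_rdot x : op_ge0 x -> forall u, 0 <= rdot (x u) u.
Proof. by move=> h u; have := h u; rewrite lecE /rdot => /andP[_]. Qed.

(** Polarisation: that the form is real at [u + v] and at [u + 'i *: v] determines [hdot (x u) v]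
    from [hdot (x v) u]. *)
Lemma op_ge0_sa x : bounded_op x -> op_ge0 x -> selfadjoint x.
Proof.
move=> bx x0; have im u : complex.Im (hdot (x u) u) = 0 by exact: ger0_Im.
have imD (p q : C) : complex.Im (p + q) = complex.Im p + complex.Im q.
  by case: p q => [a b] [c d].
move=> u v; rewrite [RHS]hdotC.
have h1 := im (u + v); have h2 := im (u + 'i%C *: v).
rewrite bopD// !(hdotDl, hdotDr) !imD !im in h1.
rewrite bopD// bopZ// !(hdotDl, hdotDr, hdotZl, hdotZr) !imD !im in h2.
move: h1 h2; have := im v.
case: (hdot (x v) u) => a b; case: (hdot (x u) v) => c d.
case: (hdot (x v) v) => p q /= -> h1 h2; apply/eqP; rewrite eq_complex/=.
by apply/andP; split; apply/eqP; lra.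
Qed.

Lemma sa_rdot x : bounded_op x -> selfadjoint x -> forall u v,
  rdot (x u) v = rdot u (x v).
Proof. by move=> bx sx; exact: rdot_adj. Qed.

Lemma op_ge0P x : bounded_op x -> selfadjoint x ->
  (forall u, 0 <= rdot (x u) u) -> op_ge0 x.
Proof.
move=> bx sx x0 u; rewrite lecE; apply/andP; split; last exact: x0.
have := sx u u; rewrite [RHS]hdotC; case: (hdot (x u) u) => a b [].
by move=> e; apply/eqP => /=; lra.
Qed.

Lemma sa_lin (r : R) x y : selfadjoint x -> selfadjoint y ->
  selfadjoint (r%:C%C *: x + y).
Proof.
move=> sx sy; rewrite /selfadjoint.
have h := is_adjoint_lin (r%:C%C) sx sy.
by move: h; have -> : ((r%:C%C)^* : C) = r%:C%C by exact: conjc_real.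
Qed.

Lemma saD x y : selfadjoint x -> selfadjoint y -> selfadjoint (x + y).
Proof. by move=> sx sy; have := sa_lin 1 sx sy; rewrite rmorph1 scale1r. Qed.

Lemma saZ (r : R) x : selfadjoint x -> selfadjoint (r%:C%C *: x).
Proof.
by move=> sx; have := sa_lin r sx (@is_adjoint0 R H); rewrite addr0.
Qed.

Lemma saB x y : selfadjoint x -> selfadjoint y -> selfadjoint (x - y).
Proof.
by move=> sx sy; have := sa_lin (-1) sy sx; rewrite rmorphN1 scaleN1r addrC.
Qed.

Lemma op_leP x y : bounded_op x -> bounded_op y -> selfadjoint x -> selfadjoint y ->
  (forall u, rdot (x u) u <= rdot (y u) u) -> op_le x y.
Proof.
move=> bx by_ sx sy h; apply: op_ge0P; [|exact: saB|].
  by apply: csubB => //; exact: csub_bop.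
by move=> u; rewrite !opE rdotBl subr_ge0.
Qed.

Lemma op_le_rdot x y u : op_le x y -> rdot (x u) u <= rdot (y u) u.
Proof. by move=> h; have := op_ge0_rdot h u; rewrite !opE rdotBl subr_ge0. Qed.

Lemma op_le_trans x y z : op_le x y -> op_le y z -> op_le x z.
Proof.
move=> xy yz u; have := addr_ge0 (xy u) (yz u).
by rewrite -hdotDl !opE addrC addrA subrK.
Qed.

Lemma op_le_refl x : op_le x x.
Proof. by move=> u; rewrite subrr hdot0l. Qed.

Lemma op_sip T : bounded_op T -> op_ge0 T -> sip setT (fun u v => rdot (T u) v).
Proof.
move=> bT T0; split=> //.
- by move=> r x y z _ _ _; rewrite bop_linear// rdotDl rdotZl.
- by move=> x y _ _; rewrite (sa_rdot bT (op_ge0_sa bT T0)) rdotC.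
- by move=> x _; exact: op_ge0_rdot.
Qed.

(** The inequality [T ^ 2 <= c T] without functional calculus: Cauchy-Schwarz for the form of [T],
    at [u] and [T u]. *)
Lemma op_ge0_sqr T (c : R) : bounded_op T -> op_ge0 T ->
  (forall u, rdot (T u) u <= c * rdot u u) ->
  forall u, rdot (T u) (T u) <= c * rdot (T u) u.
Proof.
move=> bT T0 Tc u; have h := sip_CS (op_sip bT T0) (I : setT u) (I : setT (T u)).
have h1 := Tc (T u); have h2 := op_ge0_rdot T0 u; have h3 := rdot_ge0 (T u).
have [->|n0] := eqVneq (rdot (T u) (T u)) 0.
  have [c0|c0] := leP 0 c; first exact: mulr_ge0.
  have : rdot (T u) u <= c * rdot u u := Tc u.
  have := rdot_ge0 u; move: h2; move: (rdot _ _) (rdot _ _) => p q *; nra.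
have n1 : 0 < rdot (T u) (T u) by rewrite lt_neqAle eq_sym n0.
rewrite -(ler_pM2r n1) -expr2; apply: le_trans h _.
by rewrite -mulrA (mulrCA c) ler_wpM2l.
Qed.

Lemma op_ge0_nm T (c : R) : bounded_op T -> op_ge0 T -> 0 <= c ->
  (forall u, rdot (T u) u <= c * rdot u u) -> forall u, nm (T u) <= c * nm u.
Proof.
move=> bT T0 c0 Tc u.
rewrite -(@ler_pXn2r _ 2)// ?nnegrE ?mulr_ge0 ?nm_ge0//.
rewrite exprMn !sqr_nm; apply: le_trans (op_ge0_sqr bT T0 Tc u) _.
by rewrite expr2 -mulrA ler_wpM2l.
Qed.

Lemma op_ge0_eq0 T : bounded_op T -> op_ge0 T -> op_ge0 (- T) -> T = 0.
Proof.
move=> bT T0 T0'; apply/funext => u; apply: nm_eq0; apply/eqP.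
rewrite eq_le nm_ge0 andbT -(mul0r (nm u)); apply: op_ge0_nm => // v.
by rewrite mul0r -oppr_ge0 -rdotNl; exact: (op_ge0_rdot T0' v).
Qed.

Lemma op_le_anti x y : bounded_op x -> bounded_op y -> op_le x y -> op_le y x -> x = y.
Proof.
move=> bx by_ xy yx; apply/eqP; rewrite -subr_eq0; apply/eqP/op_ge0_eq0 => //.
  by apply: csubB => //; exact: csub_bop.
by rewrite opprB.
Qed.

Lemma op_ge0_adjM x : bounded_op x -> op_ge0 (adj x \o x).
Proof.
by move=> bx u; rewrite /= hdotC -(adjP bx) -hdotC hdot_uu ler0c rdot_ge0.
Qed.

Lemma nm_rdot u v (c : R) : 0 <= c -> nm u <= c * nm v -> rdot u v <= c * rdot v v.
Proof.
move=> c0 h; apply: le_trans (rdot_le _ _) _.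
by rewrite -sqr_nm expr2 mulrA ler_wpM2r ?nm_ge0.
Qed.

(** Strong convergence of the directed set [S] to [x], one vector at a time; [is_sup_slim] and
    [slim_is_sup] translate suprema into it and back. *)
Definition slim S x := forall u e, 0 < e ->
  exists2 x0, S x0 & forall y, S y -> op_le x0 y -> nm (x u - y u) < e.

Lemma slim_near S x y0 : directed S -> slim S x -> S y0 -> forall u v e, 0 < e ->
  exists y, [/\ S y, op_le y0 y, nm (x u - y u) < e & nm (x v - y v) < e].
Proof.
move=> dS h Sy0 u v e e0; have [x1 Sx1 h1] := h u e e0.
have [x2 Sx2 h2] := h v e e0.
have [x3 [Sx3 l1 l2]] := dS _ _ Sx1 Sx2; have [x4 [Sx4 l3 l4]] := dS _ _ Sx3 Sy0.
exists x4; split=> //; [apply: h1|apply: h2] => //.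
  exact: op_le_trans l1 l3.
exact: op_le_trans l2 l3.
Qed.

Lemma slim_commute S x t : S !=set0 -> directed S -> slim S x -> bounded_op t ->
  (forall y, S y -> y \o t = t \o y) -> x \o t = t \o x.
Proof.
move=> [y0 Sy0] dS h bt ht; apply/funext => u /=.
apply/eqP; rewrite -subr_eq0; apply/eqP/nm_eq0/eqP.
rewrite eq_le nm_ge0 andbT; have [c c0 hc] := bop_bound bt.
apply: (@ler_addgt0Ml _ _ _ (1 + c)) => e e0 e1; rewrite add0r.
have [y [Sy _ h1 h2]] := slim_near dS h Sy0 (t u) u e0.
have -> : x (t u) - t (x u) = (x (t u) - y (t u)) - t (x u - y u).
  have := congr1 (@^~ u) (ht y Sy) => /= ->.
  by rewrite bopB// opprB addrA subrK.
rewrite (le_trans (nmD _ _))// mulrDr mulr1 lerD// ?(ltW h1)//.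
by rewrite nmN (le_trans (hc _))// mulrC ler_wpM2r// ltW.
Qed.

Lemma slim_rdot S x y0 : directed S -> slim S x -> S y0 -> forall u v e, 0 < e ->
  exists y, [/\ S y, op_le y0 y & `|rdot (x u) v - rdot (y u) v| < e].
Proof.
move=> dS h Sy0 u v e e0.
have v0 : 0 < nm v + 1 by rewrite ltr_wpDl// nm_ge0.
have [y [Sy l h1 _]] := slim_near dS h Sy0 u v (divr_gt0 e0 v0).
exists y; split=> //; rewrite -rdotBl.
have l1 := rdot_le (x u - y u) v; have l2 := rdot_le (- (x u - y u)) v.
rewrite rdotNl nmN in l2; rewrite ltr_pdivlMr// in h1.
have := nm_ge0 (x u - y u); have := nm_ge0 v; rewrite ltr_norml; nra.
Qed.

Lemma slim_sup S x : S !=set0 -> directed S -> slim S x -> bounded_op x ->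
  S `<=` bop -> (forall y, S y -> selfadjoint y) ->
  [/\ selfadjoint x, forall y, S y -> op_le y x &
     forall t, bounded_op t -> (forall y, S y -> op_le y t) -> op_le x t].
Proof.
move=> [y0 Sy0] dS h bx Sb Ssa.
have sx : selfadjoint x.
  apply: rdot_adjoint => // u v; apply/eqP; rewrite -subr_eq0 -normr_le0.
  apply: (@ler_addgt0Ml _ _ _ (nm u + nm v)) => e e0 e1.
  have [y [Sy _ h1 h2]] := slim_near dS h Sy0 u v e0.
  have -> : rdot (x u) v - rdot u (x v) = rdot (x u - y u) v - rdot u (x v - y v).
    by rewrite rdotBl rdotBr (sa_rdot (Sb _ Sy) (Ssa _ Sy) u v); ring.
  have l1 := rdot_le (x u - y u) v; have l2 := rdot_le (- (x u - y u)) v.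
  have l3 := rdot_le u (x v - y v); have l4 := rdot_le (- u) (x v - y v).
  rewrite !rdotNl !nmN in l2 l4; have := nm_ge0 u; have := nm_ge0 v.
  rewrite ler_norml; nra.
split=> //.
  move=> y Sy; apply: op_leP => //; [exact: Sb|exact: Ssa|] => u.
  apply: (@ler_addgt0Ml _ _ _ 1) => e e0 e1.
  have [z [Sz yz]] := slim_rdot dS h Sy u u e0.
  by have := op_le_rdot u yz; rewrite ltr_norml; lra.
move=> t bt ht.
have st : selfadjoint t.
  have b1 : bounded_op (t - y0).
    by apply: csubB => //; [exact: csub_bop|exact: Sb].
  by have := saD (op_ge0_sa b1 (ht _ Sy0)) (Ssa _ Sy0); rewrite subrK.
apply: op_leP => // u; apply: (@ler_addgt0Ml _ _ _ 1) => e e0 e1.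
have [z [Sz _]] := slim_rdot dS h Sy0 u u e0.
by have := op_le_rdot u (ht _ Sz); rewrite ltr_norml; lra.
Qed.

(** Vigier's theorem. The numbers [rdot (y u) u] increase along [S] and are bounded through [b];
    [op_ge0_sqr] turns their convergence into that of [y u]. The limit commutes with the commutant
    of [A], hence lies in [A]. *)
Lemma vigier A S b : von_neumann A -> S !=set0 -> S `<=` A -> bounded_op b ->
  (forall y, S y -> selfadjoint y) -> directed S -> (forall y, S y -> op_le y b) ->
  exists2 x, A x & slim S x.
Proof.
move=> vA [y0 Sy0] SA bb Ssa dS Sb.
have Sbd : S `<=` bop by move=> y /SA; exact: sa_bop (vN_star_alg vA) _.
have bb0 : bounded_op (b - y0) by apply: csubB (csub_bop H) bb (Sbd _ Sy0).
have [c c0 hc] := bop_bound bb0.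
(* For [y0 <= y <= z] the difference [z - y] is dominated by [b - y0], so one constant [c] serves
   all of them. *)
have diff y z u : S y -> S z -> op_le y0 y -> op_le y z ->
    nm (z u - y u) ^+ 2 <= c * (rdot (z u) u - rdot (y u) u) /\
    nm (z u - y u) <= c * nm u.
  move=> Sy Sz y0y yz.
  have bzy : bounded_op (z - y) by apply: csubB (csub_bop H) (Sbd _ Sz) (Sbd _ Sy).
  have le v : rdot ((z - y) v) v <= c * rdot v v.
    apply: le_trans (nm_rdot (ltW c0) (hc v)).
    rewrite !opE !rdotBl lerB//; first exact/op_le_rdot/Sb.
    exact: op_le_rdot.
  split; last exact: op_ge0_nm bzy yz (ltW c0) le u.
  by rewrite sqr_nm -rdotBl; exact: (op_ge0_sqr bzy yz le u).
pose F : set_system (H -> H) :=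
  [set B | exists2 y, S y & [set z | S z /\ op_le y z] `<=` B].
have FF : ProperFilter F.
  apply: Build_ProperFilter => [[y Sy yB]|].
    by apply: (yB y); split=> //; exact: op_le_refl.
  split=> [|B B' [y Sy yB] [y' Sy' yB']|B B' BB' [y Sy yB]].
  - by exists y0.
  - have [z [Sz yz y'z]] := dS _ _ Sy Sy'; exists z => // w [Sw zw]; split.
      by apply: yB; split=> //; exact: op_le_trans yz zw.
    by apply: yB'; split=> //; exact: op_le_trans y'z zw.
  - by exists y => // w /yB /BB'.
have /choice[x hx] : forall u, exists g, forall e, 0 < e ->
    F [set y | nm (y u - g) < e].
  move=> u; apply: hilbert_complete => e e0.
  have hs : has_sup [set rdot (y u) u | y in S].
    split; first by exists (rdot (y0 u) u), y0.
    by exists (rdot (b u) u) => _ [y Sy <-]; exact/op_le_rdot/Sb.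
  pose d := (e / 2) ^+ 2 / c.
  have d0 : 0 < d by rewrite divr_gt0// exprn_gt0// divr_gt0.
  have [_ [y1 Sy1 <-] hy1] := sup_adherent d0 hs.
  have [y [Sy y1y y0y]] := dS _ _ Sy1 Sy0.
  have key z : S z -> op_le y z -> nm (z u - y u) < e / 2.
    move=> Sz yz; have [h _] := diff y z u Sy Sz y0y yz.
    rewrite -(@ltr_pXn2r _ 2)// ?nnegrE ?nm_ge0 ?divr_ge0 ?ltW//.
    apply: le_lt_trans h _; rewrite -ltr_pdivlMl// mulrC -/d.
    have : rdot (z u) u <= sup [set rdot (y u) u | y in S].
      by apply: ub_le_sup; [exact: hs.2|exists z].
    have := op_le_rdot u y1y; lra.
  exists [set z | S z /\ op_le y z]; first by exists y.
  move=> z w [Sz yz] [Sw yw].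
  have -> : z u - w u = (z u - y u) - (w u - y u) by rewrite opprB addrA subrK.
  apply: le_lt_trans (nmD _ _) _; rewrite nmN [e]splitr ltrD ?key//.
have sx : slim S x.
  move=> u e e0; have [y Sy yh] := hx u e e0; exists y => // z Sz yz.
  by rewrite nmB; apply: yh.
have near u e : 0 < e -> F [set y | nm (x u - y u) < e].
  by move=> e0; apply: filterS (hx u e e0) => y /=; rewrite nmB.
have xl : linear x.
  move=> a u v; apply/eqP; rewrite -subr_eq0; apply/eqP/nm_eq0/eqP.
  rewrite eq_le nm_ge0 andbT.
  apply: (@ler_addgt0Ml _ _ _ (1 + (Normc.normc a + 1))) => e e0 e1; rewrite add0r.
  have [y [[h1 h2] [h3 Sy]]] := filter_ex (filterI
    (filterI (near (a *: u + v) e e0) (near u e e0))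
    (filterI (near v e e0) (ex_intro2 _ _ y0 Sy0 (fun z (h : _ /\ _) => h.1)))).
  have by_ := Sbd _ Sy.
  have -> : x (a *: u + v) - (a *: x u + x v) =
      (x (a *: u + v) - y (a *: u + v)) - (a *: (x u - y u) + (x v - y v)).
    rewrite (bop_linear by_) scalerBr; set p := a *: x u; set q := a *: y u.
    by rewrite addrACA -opprD opprB addrA subrK.
  rewrite (le_trans (nmD _ _))// mulrDr mulr1; apply: lerD; first exact: ltW.
  rewrite nmN (le_trans (nmD _ _))// mulrDr mulr1; apply: lerD; last exact: ltW.
  rewrite nmZ mulrC ler_wpM2r ?(ltW h2)//.
  by case: (a) => p q; exact: sqrtr_ge0.
have bx : bounded_op x.
  apply/bounded_opP; split=> //.
  have [c' c'0 hc'] := bop_bound (Sbd _ Sy0).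
  exists (c + c'); split=> [|u]; first by rewrite addr_ge0 ?ltW.
  apply: (@ler_addgt0Ml _ _ _ 1) => e e0 e1; rewrite mulr1.
  have [y [Sy y0y h1 _]] := slim_near dS sx Sy0 u u e0.
  have [_ h2] := diff y0 y u Sy0 Sy (@op_le_refl _) y0y.
  have := nm_sub (x u) (y u); have := nm_sub (y u) (y0 u); have := hc' u.
  rewrite mulrDl; lra.
exists x => //; apply/vN_mem => //; split=> // t [bt ht].
apply: slim_commute sx bt _ => //; first by exists y0.
by move=> y Sy; rewrite ht//; exact: SA.
Qed.

(** A supremum in [A] is compared only with upper bounds in [A]. The strong limit from [vigier] lies
    in [A] and is a supremum too, so the two coincide. *)
Lemma is_sup_slim A S x : von_neumann A -> S !=set0 -> S `<=` A ->
  (forall y, S y -> selfadjoint y) -> directed S -> is_sup A S x -> slim S x.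
Proof.
move=> vA S0 SA Ssa dS [Ax ux lx].
have Ab := sa_bop (vN_star_alg vA).
have [y Ay sy] := vigier vA S0 SA (Ab _ Ax) Ssa dS ux.
have [_ uy ly] := slim_sup S0 dS sy (Ab _ Ay) (fun z Sz => Ab _ (SA z Sz)) Ssa.
have <- : y = x; last by [].
apply: op_le_anti; [exact: Ab|exact: Ab|apply: ly => //; exact: Ab|exact: lx].
Qed.

Lemma slim_is_sup A S x : A x -> A `<=` bop -> S !=set0 -> S `<=` A ->
  (forall y, S y -> selfadjoint y) -> directed S -> slim S x -> is_sup A S x.
Proof.
move=> Ax Ab S0 SA Ssa dS sx.
have [_ ux lx] := slim_sup S0 dS sx (Ab _ Ax) (fun z Sz => Ab _ (SA z Sz)) Ssa.
by split=> // t At; apply: lx; exact: Ab.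
Qed.

End positive.

(** * Normal positive functionals *)

Section normal_functional.
Variables (R : realType) (H : hilbertType R).
Local Notation C := R[i].
Local Notation bop := (@bounded_op R H).
Implicit Types (x y z T : H -> H) (u v w : H) (S Z : set (H -> H)).

(** A nonempty chain is directed and bounded by [b]; its strong limit exists and, by the last
    hypothesis, stays in [Z]. *)
Lemma op_zorn (A : set (H -> H)) b Z x0 : von_neumann A -> bounded_op b ->
  Z `<=` A -> (forall x, Z x -> selfadjoint x) -> (forall x, Z x -> op_le x b) ->
  Z x0 ->
  (forall S x, S !=set0 -> S `<=` Z -> directed S -> A x -> slim S x -> Z x) ->
  exists2 m, Z m & forall y, Z y -> op_le m y -> y = m.
Proof.
move=> vA bb ZA Zsa Zb Zx0 Zlim.
have Ab := sa_bop (vN_star_alg vA).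
have Zbd x : Z x -> bounded_op x by move=> /ZA /Ab.
pose T := {x | Z x}; pose r (s t : T) := `[< op_le (sval s) (sval t) >].
have [||||[m Zm] hm] := @Zorn T r.
- by move=> t; apply/asboolP; exact: op_le_refl.
- move=> s t w /asboolP h1 /asboolP h2; apply/asboolP; exact: op_le_trans h1 h2.
- move=> [s Zs] [t Zt] /asboolP /= h1 /asboolP /= h2; apply: eq_exist.
  by apply: op_le_anti => //; exact: Zbd.
- move=> F Ftot; have [[t0 Ft0]|F0] := pselect (F !=set0); last first.
    by exists (exist _ x0 Zx0) => s Fs; exfalso; apply: F0; exists s.
  pose S := [set sval t | t in F].
  have S0 : S !=set0 by exists (sval t0), t0.
  have SZ : S `<=` Z by move=> _ [[t Zt] _ <-].
  have SA : S `<=` A by move=> x /SZ /ZA.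
  have Ssa y : S y -> selfadjoint y by move=> /SZ /Zsa.
  have dS : directed S.
    move=> _ _ [s Fs <-] [t Ft <-].
    have [/asboolP h|/asboolP h] := Ftot _ _ Fs Ft.
      by exists (sval t); split=> //; [exists t|exact: op_le_refl].
    by exists (sval s); split=> //; [exists s|exact: op_le_refl].
  have [x Ax sx] := vigier vA S0 SA bb Ssa dS (fun y Sy => Zb _ (SZ _ Sy)).
  have [_ ux _] := slim_sup S0 dS sx (Ab _ Ax) (fun y Sy => Ab _ (SA _ Sy)) Ssa.
  have Zx := Zlim _ _ S0 SZ dS Ax sx.
  by exists (exist _ x Zx) => s Fs; apply/asboolP/ux; exists s.
exists m => // y Zy my.
by have [] := hm (exist _ y Zy) (asboolT my).
Qed.

(** [f] plays the real part of a functional, whence real linearity and invariance under adjoints.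
    Normality provides approximants beyond any given [y0], so that two functionals can be
    approximated simultaneously. *)
Record normal_pos (A : set (H -> H)) (f : (H -> H) -> R) : Prop := {
  np_lin : forall (r : R) x y, A x -> A y -> f (r%:C%C *: x + y) = r * f x + f y ;
  np_adj : forall x, A x -> f (adj x) = f x ;
  np_ge0 : forall x, A x -> op_ge0 x -> 0 <= f x ;
  np_normal : forall S x, S !=set0 -> S `<=` A -> (forall y, S y -> selfadjoint y) ->
    directed S -> is_sup A S x ->
    forall y0 e, S y0 -> 0 < e -> exists y, [/\ S y, op_le y0 y & f x - f y < e] }.

Variables (A : set (H -> H)) (vA : von_neumann A) (f : (H -> H) -> R).
Hypothesis hf : normal_pos A f.

Let sA : star_alg A := vN_star_alg vA.
Let Ab : A `<=` bop := sa_bop sA.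
Let Acs : csub A := sa_sub sA.

Lemma npD x y : A x -> A y -> f (x + y) = f x + f y.
Proof.
by move=> Ax Ay; have := np_lin hf 1 Ax Ay; rewrite rmorph1 scale1r mul1r.
Qed.

Lemma np0 : f 0 = 0.
Proof.
have := npD (csubB Acs (sa_id sA) (sa_id sA)) (csubB Acs (sa_id sA) (sa_id sA)).
by rewrite subrr addr0 => /eqP; rewrite -subr_eq subrr eq_sym => /eqP.
Qed.

Lemma npZ (r : R) x : A x -> f (r%:C%C *: x) = r * f x.
Proof. by move=> Ax; have := np_lin hf r Ax Acs.1; rewrite !addr0 np0 addr0. Qed.

Lemma npB x y : A x -> A y -> f (x - y) = f x - f y.
Proof.
move=> Ax Ay; rewrite npD//; last exact: csubN.
by rewrite -scaleN1r -(rmorphN1 (real_complex R)) npZ// mulN1r.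
Qed.

Lemma np_le x y : A x -> A y -> op_le x y -> f x <= f y.
Proof. by move=> Ax Ay xy; rewrite -subr_ge0 -npB// (np_ge0 hf)//; exact: csubB. Qed.

Definition gdot x y : R := f (adj y \o x).

Lemma gdot_in x y : A x -> A y -> A (adj y \o x).
Proof. by move=> Ax Ay; apply: (sa_comp sA) => //; exact: (sa_adj sA). Qed.

Lemma gdot_sip : sip A gdot.
Proof.
split.
- exact: csub_rsub.
- move=> r x y z Ax Ay Az; rewrite /gdot compDr ?compZr; try exact: bop_adj (Ab Az).
  by rewrite (np_lin hf)//; exact: gdot_in.
- move=> x y Ax Ay; rewrite /gdot -(np_adj hf (gdot_in Ax Ay)).
  by rewrite adj_comp ?adjK//; [exact: Ab|exact/bop_adj/Ab|exact: Ab].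
- by move=> x Ax; apply: (np_ge0 hf (gdot_in Ax Ax)); exact/op_ge0_adjM/Ab.
Qed.

Lemma gdot_adj a x y : A a -> A x -> A y -> gdot (a \o x) y = gdot x (adj a \o y).
Proof.
move=> Aa Ax Ay; rewrite /gdot adj_comp; try exact: Ab.
  by rewrite adjK//; exact: Ab.
exact: bop_adj (Ab Aa).
Qed.

Lemma gdot_mul_le x y c : A x -> A y -> 0 <= c -> (forall u, nm (y u) <= c * nm u) ->
  gdot (y \o x) (y \o x) <= c ^+ 2 * gdot x x.
Proof.
move=> Ax Ay c0 yc; have Axx := gdot_in Ax Ax.
have Ayx : A (y \o x) by exact: (sa_comp sA).
rewrite -npZ//; apply: np_le; [exact: gdot_in|exact: csubZ|].
have bx := Ab Ax; have by_ := Ab Ay; have bxx := Ab Axx; have byx := Ab Ayx.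
apply: op_leP.
- exact: Ab (gdot_in Ayx Ayx).
- exact: csubZ (csub_bop H) bxx.
- exact: (op_ge0_sa (Ab (gdot_in Ayx Ayx)) (op_ge0_adjM byx)).
- exact/saZ/(op_ge0_sa bxx (op_ge0_adjM bx)).
move=> u; rewrite opZE rdotZl /= rdotC -(rdot_adj (adjP byx)) [X in _ * X]rdotC.
rewrite -(rdot_adj (adjP bx)) -!sqr_nm -exprMn.
by rewrite ler_pXn2r ?nnegrE ?mulr_ge0 ?nm_ge0// yc.
Qed.

(** On elements [adj x \o x], the functional [f] cut down by [T] is dominated by the vector
    functional of [xi]. Equivalently, [x xi |-> x \o T] is a contraction for the seminorm of
    [gdot]. *)
Definition localized T xi :=
  A T /\ forall x, A x -> gdot (x \o T) (x \o T) <= rdot (x xi) (x xi).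

Lemma localized_comp T xi x : A x -> localized T xi -> localized (x \o T) (x xi).
Proof.
move=> Ax [AT hT]; split=> [|y Ay]; first exact: (sa_comp sA).
exact: (hT (y \o x) (sa_comp sA Ay Ax)).
Qed.

(* Maximality of [m] below turns [f h < <h xi, xi>] into domination of [f] by
   the vector functional of [xi] on the whole order interval below [h - m]. *)
Lemma localized_below h : A h -> op_ge0 h -> op_le h idfun -> h <> 0 ->
  exists T xi, [/\ localized T xi, op_ge0 T, op_le T h & T <> 0].
Proof.
move=> Ah h0 h1 hn0; have bh := Ab Ah.
have [v hv] : exists v, 0 < rdot (h v) v.
  apply: contrapT => /forallNP hN; apply: hn0; apply: op_ge0_eq0 => //.
  apply: op_ge0P; first exact: csubN (csub_bop H) bh.
    by rewrite -(scaleN1r h) -(rmorphN1 (real_complex R)); exact/saZ/op_ge0_sa.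
  by move=> u; rewrite opNE rdotNl oppr_ge0 leNgt; apply/negP/hN.
(* With this scaling [f h] equals [(t - 1) * rdot (h v) v], while the vector functional of [xi]
   takes the value [t ^+ 2 * rdot (h v) v] at [h]. *)
pose t := f h / rdot (h v) v + 1.
have fh0 := np_ge0 hf Ah h0.
have t1 : 1 <= t by rewrite lerDr divr_ge0// ltW.
pose xi := (t%:C)%C *: v.
have fxi : f h < rdot (h xi) xi.
  rewrite /xi (bopZ bh) rdotZl rdotZr.
  have e : f h = (t - 1) * rdot (h v) v by rewrite /t addrK divfK// gt_eqF.
  by rewrite e; nra.
pose Z := [set x | [/\ A x, op_ge0 x, op_le x h & rdot (x xi) xi <= f x]].
have Zsa x : Z x -> selfadjoint x by move=> [Ax x0 _ _]; exact: op_ge0_sa (Ab Ax) x0.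
have [x [] //|x [] //||S x S0 SZ dS Ax sx|m [Am m0 mh fm] mmax] :=
    @op_zorn A h Z 0 vA bh _ Zsa.
- split; [exact: Acs.1|by move=> u; rewrite op0E hdot0l|by rewrite /op_le subr0|].
  by rewrite op0E rdot0l np0.
- have Sb : S `<=` bop by move=> y /SZ[/Ab].
  have Ssa y : S y -> selfadjoint y by move=> /SZ /Zsa.
  have [sax ux lx] := slim_sup S0 dS sx (Ab Ax) Sb Ssa.
  have [y0 Sy0] := S0; have [Ay0 y00 _ _] := SZ _ Sy0.
  split=> //.
  + have : op_le 0 x by apply: op_le_trans (ux _ Sy0); rewrite /op_le subr0.
    by rewrite /op_le subr0.
  + by apply: lx => // y /SZ[].
  apply: (@ler_addgt0Ml _ _ _ 1) => e e0 e1.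
  have [y [Sy _ hy]] := slim_rdot dS sx Sy0 xi xi e0.
  have [Ay _ _ fy] := SZ _ Sy; have := np_le Ay Ax (ux _ Sy).
  move: hy; rewrite ltr_norml; lra.
pose T := h - m.
have AT : A T by exact: csubB.
have bT := Ab AT; have bm := Ab Am.
have sT : selfadjoint T by exact: op_ge0_sa.
have Th : op_le T h by rewrite /op_le /T opprB addrC subrK.
have dom y : A y -> op_ge0 y -> op_le y T -> f y <= rdot (y xi) xi.
  move=> Ay y0 yT; rewrite leNgt; apply/negP => hy.
  have : m + y = m.
    apply: mmax; last by rewrite /op_le addrC addKr.
    split; first exact: csubD.
    - by move=> u; rewrite opDE hdotDl addr_ge0.
    - by move: yT; rewrite /op_le /T opprD addrA.
    by rewrite opDE rdotDl npD// lerD// ltW.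
  move=> /eqP; rewrite -subr_eq0 addrC addKr => /eqP y_0.
  by move: hy; rewrite y_0 np0 op0E rdot0l ltxx.
have Tle u : rdot (T u) (T u) <= 1 * rdot (T u) u.
  apply: op_ge0_sqr => // w; rewrite mul1r.
  by apply: le_trans (op_le_rdot w Th) _; exact: op_le_rdot w h1.
exists T, (T xi); split=> //; last first.
  move=> T0; move: fm; rewrite leNgt => /negP; apply.
  by have -> : m = h by apply/eqP; rewrite eq_sym -subr_eq0 -/T T0.
split=> // x Ax; have [c c0 hc] := bop_bound (Ab Ax).
have c20 : 0 < c ^+ 2 by exact: exprn_gt0.
have AxT : A (x \o T) by exact: (sa_comp sA).
(* The factor [c ^- 2] and the inequality [T ^ 2 <= T] put this element below [T], where [dom]
   applies. *)
pose y := ((c ^- 2)%:C)%C *: (adj (x \o T) \o (x \o T)).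
have Ayy := gdot_in AxT AxT; have Ay : A y by exact: csubZ.
have yE u : rdot (y u) u = c ^- 2 * rdot (x (T u)) (x (T u)).
  by rewrite /y opZE rdotZl /= rdotC -(rdot_adj (adjP (Ab AxT))).
have say : selfadjoint y by exact/saZ/(op_ge0_sa (Ab Ayy))/op_ge0_adjM/Ab.
have c2V : 0 < c ^- 2 by rewrite invr_gt0.
have := dom y Ay; rewrite yE npZ// ler_pM2l//; apply.
  by apply: op_ge0P => //; [exact: Ab|move=> u; rewrite yE mulr_ge0 ?rdot_ge0// ltW].
apply: op_leP => //; [exact: Ab|] => u; rewrite yE ler_pdivrMl//.
apply: (@le_trans _ _ (c ^+ 2 * rdot (T u) (T u))).
  by rewrite -!sqr_nm -exprMn ler_pXn2r ?nnegrE ?mulr_ge0 ?nm_ge0// ltW.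
by rewrite ler_pM2l//; have := Tle u; rewrite mul1r.
Qed.

Inductive locspan : (H -> H) -> Prop :=
| locspan0 : locspan 0
| locspanD T xi x : localized T xi -> locspan x -> locspan (T + x).

Lemma locspan_in x : locspan x -> A x.
Proof.
elim=> [|T xi y [AT _] _ Ay]; first exact: Acs.1.
exact: csubD.
Qed.

Lemma locspan_comp x y : A x -> locspan y -> locspan (x \o y).
Proof.
move=> Ax; elim=> [|T xi z hT _ IH]; first by rewrite (comp0r (Ab Ax)); exact: locspan0.
rewrite (compDr _ _ (Ab Ax)).
exact: locspanD (localized_comp Ax hT) IH.
Qed.

Lemma gdotD_le x y : A x -> A y ->
  gdot (x + y) (x + y) <= 2 * gdot x x + 2 * gdot y y.
Proof.
move=> Ax Ay; have h := sip_ge0 gdot_sip (sipB gdot_sip Ax Ay).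
have Axy := sipD gdot_sip Ax Ay; have Axy' := sipB gdot_sip Ax Ay.
move: h; rewrite (sipBl gdot_sip)// !(sipBr gdot_sip)//.
rewrite (sipDl gdot_sip)// !(sipDr gdot_sip)// (sip_sym gdot_sip Ay Ax); lra.
Qed.

(** A maximal [m <= 1] among the positive elements approximable by [locspan] is [1], since otherwise
    [localized_below] adds a localized element below [1 - m]. Approximability passes to suprema
    because [(x - y) ^ 2 <= x - y], so that [f x - f y] controls the seminorm. *)
Lemma locspan_dense_id e : 0 < e ->
  exists2 y, locspan y & gdot (idfun - y) (idfun - y) < e.
Proof.
move=> e0; pose I1 := @idfun H.
have AI : A I1 := sa_id sA.
have sI : selfadjoint I1 := @is_adjoint_id _ _.
have I1ge0 : op_ge0 I1 by move=> u; rewrite hdot_uu ler0c rdot_ge0.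
pose Z := [set x | [/\ A x, op_ge0 x, op_le x I1 &
  forall e, 0 < e -> exists2 y, locspan y & gdot (x - y) (x - y) < e]].
have Zsa x : Z x -> selfadjoint x by move=> [Ax x0 _ _]; exact: op_ge0_sa (Ab Ax) x0.
have [x [] //|x [] //||S x S0 SZ dS Ax sx|m [Am m0 mI hm] mmax] :=
    @op_zorn A I1 Z 0 vA (bop_id H) _ Zsa.
- split; [exact: Acs.1|by move=> u; rewrite op0E hdot0l|by rewrite /op_le subr0|].
  move=> d d0; exists 0; first exact: locspan0.
  by rewrite subr0 /gdot comp0r ?np0//; exact: bop_adj (bop_zero H).
- have SA : S `<=` A by move=> y /SZ[].
  have Sb : S `<=` bop by move=> y /SA /Ab.
  have Ssa y : S y -> selfadjoint y by move=> /SZ /Zsa.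
  have [sax ux lx] := slim_sup S0 dS sx (Ab Ax) Sb Ssa.
  have [y0 Sy0] := S0; have [Ay0 y00 _ _] := SZ _ Sy0.
  have xI : op_le x I1 by apply: lx => // [|y /SZ[]//]; exact: bop_id.
  split=> //.
    have : op_le 0 x by apply: op_le_trans (ux _ Sy0); rewrite /op_le subr0.
    by rewrite /op_le subr0.
  move=> d d0; have d4 : 0 < d / 4 by rewrite divr_gt0.
  have sup := slim_is_sup Ax Ab S0 SA Ssa dS sx.
  have [y [Sy _ hy]] := np_normal hf S0 SA Ssa dS sup Sy0 d4.
  have [Ay yge0 _ /(_ _ d4)[z lz hz]] := SZ _ Sy; exists z => //.
  have Axy : A (x - y) by exact: csubB.
  have Ayz : A (y - z) by apply: csubB => //; exact: locspan_in.
  have -> : x - z = (x - y) + (y - z) by rewrite addrA subrK.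
  apply: le_lt_trans (gdotD_le Axy Ayz) _.
  suff : gdot (x - y) (x - y) <= f x - f y by lra.
  rewrite -npB//; apply: np_le => //; first exact: gdot_in.
  have xy0 : op_ge0 (x - y) := ux _ Sy.
  have sxy := op_ge0_sa (Ab Axy) xy0.
  apply: op_leP => //; try exact/Ab; try exact/Ab/gdot_in.
    by apply: op_ge0_sa; [exact/Ab/gdot_in|exact/op_ge0_adjM/Ab].
  move=> u; rewrite /= rdotC -(rdot_adj (adjP (Ab Axy))).
  rewrite -[leRHS]mul1r; apply: op_ge0_sqr => //; first exact: Ab.
  move=> v; rewrite mul1r opDE opNE rdotDl rdotNl.
  have := op_ge0_rdot yge0 v; have := op_le_rdot v xI; rewrite /I1 /=; lra.
have [e1|/eqP mn1] := eqVneq I1 m; first by rewrite -/I1 e1; exact: hm.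
have AT : A (I1 - m) by exact: csubB.
have [||T [xi [lT T0 Th Tn0]]] := localized_below AT mI.
- by rewrite /op_le opprB addrC subrK.
- by move=> /eqP; rewrite subr_eq0 => /eqP.
exfalso; apply: Tn0; have [AT' _] := lT.
suff : T + m = m by move=> /eqP; rewrite -subr_eq0 addrK => /eqP.
apply: mmax; last by rewrite /op_le addrK.
split; first exact: csubD.
- by move=> u; rewrite opDE hdotDl addr_ge0.
- by move: Th; rewrite /op_le addrAC opprD addrA addrAC.
move=> d d0; have [y ly hy] := hm d d0; exists (T + y); first exact: locspanD lT ly.
by rewrite opprD addrACA subrr add0r.
Qed.

Lemma locspan_dense x e : A x -> 0 < e ->
  exists2 y, locspan y & gdot (x - y) (x - y) < e.
Proof.
move=> Ax e0; have [c c0 hc] := bop_bound (Ab Ax).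
have c2 : 0 < c ^+ 2 by exact: exprn_gt0.
have [y ly hy] := locspan_dense_id (divr_gt0 e0 c2).
exists (x \o y); first exact: locspan_comp.
have AI : A (idfun - y) by apply: csubB => //; [exact: sa_id|exact: locspan_in].
have -> : x - (x \o y) = x \o (idfun - y) by rewrite compBr//; exact: Ab.
apply: le_lt_trans (gdot_mul_le AI Ax (ltW c0) hc) _.
by rewrite mulrC -ltr_pdivlMr.
Qed.

End normal_functional.

(** * Limits at a fixed rate *)

Section dl.
Variable R : realType.

(** Square root of the error in [riesz_seq]: the rate at which the approximants of the density
    theorem converge. *)
Definition dl (n : nat) : R := Num.sqrt n.+1%:R^-1.

Lemma dl_ge0 n : 0 <= dl n. Proof. exact: sqrtr_ge0. Qed.

Lemma sqr_dl n : dl n ^+ 2 = n.+1%:R^-1.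
Proof. by rewrite sqr_sqrtr// invr_ge0. Qed.

Lemma dl_small e : 0 < e -> exists n, dl n < e.
Proof.
move=> e0; have /filter_ex[n hn] := near_inv_nat (exprn_gt0 2 e0).
by exists n; rewrite -(@ltr_pXn2r _ 2)// ?nnegrE ?dl_ge0 ?ltW// sqr_dl.
Qed.

Lemma dl_lim (X Y K : R) : (forall n, X <= Y + K * dl n) -> X <= Y.
Proof.
move=> h; apply: (@ler_addgt0Ml _ _ _ `|K|) => e e0 _.
have [n hn] := dl_small e0; have := h n; have := dl_ge0 n.
have := ler_norm K; have := normr_ge0 K; nra.
Qed.

Lemma dl_eq (X Y K : R) : (forall n, `|X - Y| <= K * dl n) -> X = Y.
Proof.
move=> h; apply/eqP; rewrite -subr_eq0 -normr_le0.
by apply: (@dl_lim _ _ K) => n; rewrite add0r.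
Qed.

Lemma dl_cauchy (r : nat -> R) (K : R) :
  (forall n m, r n - r m <= K * (dl n + dl m)) ->
  exists l, forall n, `|r n - l| <= K * dl n.
Proof.
move=> h; pose B := [set r n - K * dl n | n in setT].
have ubB m : ubound B (r m + K * dl m).
  by move=> _ [n _ <-]; have := h n m; lra.
have hB : has_sup B by split; [exists (r 0 - K * dl 0), 0|exists (r 0 + K * dl 0)].
exists (sup B) => n; rewrite ler_norml; apply/andP; split.
  suff : sup B <= r n + K * dl n by lra.
  by apply: ge_sup => //; exact: hB.1.
suff : r n - K * dl n <= sup B by lra.
by apply: ub_le_sup; [exact: hB.2|exists n].
Qed.

End dl.

(** * Density of subalgebras *)

Section density.
Variables (R : realType) (H : hilbertType R).
Local Notation C := R[i].
Local Notation bop := (@bounded_op R H).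
Local Notation dl := (dl R).
Implicit Types (x y z g T : H -> H) (u v w : H) (S Z : set (H -> H)).

Variables (A : set (H -> H)) (vA : von_neumann A) (f : (H -> H) -> R).
Hypothesis hf : normal_pos A f.
Variable Ah : set (H -> H).
Hypotheses (sAh : star_alg Ah) (AhA : Ah `<=` A)
  (Ahd : commutant Ah `<=` commutant A).

Let sA : star_alg A := vN_star_alg vA.
Let Ab : A `<=` bop := sa_bop sA.
Let Acs : csub A := sa_sub sA.
Local Notation gdot := (gdot f).
Let gs : sip A gdot.
Proof. exact: gdot_sip. Qed.

Definition gn x : R := Num.sqrt (gdot x x).

Lemma gn_ge0 x : 0 <= gn x. Proof. exact: sqrtr_ge0. Qed.

Lemma sqr_gn x : A x -> gn x ^+ 2 = gdot x x.
Proof. by move=> Ax; rewrite sqr_sqrtr// (sip_ge0 gs Ax). Qed.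

Lemma gdot_le x y : A x -> A y -> `|gdot x y| <= gn x * gn y.
Proof.
move=> Ax Ay; rewrite -(@ler_pXn2r _ 2)// ?nnegrE ?mulr_ge0 ?gn_ge0//.
by rewrite real_normK ?num_real// exprMn !sqr_gn//; exact: (sip_CS gs Ax Ay).
Qed.

Lemma gn_mul x y c : A x -> A y -> 0 <= c -> (forall u, nm (y u) <= c * nm u) ->
  gn (y \o x) <= c * gn x.
Proof.
move=> Ax Ay c0 yc; have Ayx : A (y \o x) by exact: (sa_comp sA).
rewrite -(@ler_pXn2r _ 2)// ?nnegrE ?mulr_ge0 ?gn_ge0//.
by rewrite exprMn !sqr_gn//; exact: (gdot_mul_le vA hf Ax Ay c0 yc).
Qed.

(** A minimising sequence for the functional [g |-> gdot g y] on [Ah]: it approximates the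
    projection of [y] onto the closure of [Ah]. Outside [A] the sequence is a default value. *)
Lemma apx_ex y : exists a : nat -> H -> H, A y -> [/\ (forall n, Ah (a n)),
  (forall n g, Ah g -> `|gdot g y - gdot g (a n)| <= dl n * gn g) &
  forall n m, gn (a n - a m) <= 2 * (dl n + dl m)].
Proof.
have [Ay|] := pselect (A y); last by exists (fun=> 0).
have := riesz_seq (V := Ah) (f := fun g => gdot g y) (K := gdot y y) gs AhA.
case.
- by apply: csub_rsub; exact: sa_sub.
- by move=> r v w /AhA Av /AhA Aw; exact: (sip_lin gs).
- exact: (sip_ge0 gs).
- by move=> v /AhA Av; rewrite mulrC; exact: (sip_CS gs Av Ay).
move=> a [ha h1 h2]; exists a => _; split=> // [n v hv|n m].
  have Av := AhA hv.
  rewrite -(@ler_pXn2r _ 2)// ?nnegrE ?mulr_ge0 ?gn_ge0 ?dl_ge0//.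
  by rewrite real_normK ?num_real// exprMn sqr_dl sqr_gn// h1.
have Anm : A (a n - a m) by apply: csubB => //; exact: AhA.
rewrite -(@ler_pXn2r _ 2)// ?nnegrE ?mulr_ge0 ?addr_ge0 ?gn_ge0 ?dl_ge0//.
rewrite sqr_gn//; apply: le_trans (h2 n m) _.
rewrite -!sqr_dl; have := dl_ge0 R n; have := dl_ge0 R m; nra.
Qed.

Definition apx y : nat -> H -> H := sval (cid (apx_ex y)).

Lemma apxP y : A y -> [/\ (forall n, Ah (apx y n)),
  (forall n g, Ah g -> `|gdot g y - gdot g (apx y n)| <= dl n * gn g) &
  forall n m, gn (apx y n - apx y m) <= 2 * (dl n + dl m)].
Proof. exact: (svalP (cid (apx_ex y))). Qed.

Lemma apx_in y n : A y -> A (apx y n).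
Proof. by move=> /apxP[/(_ n)/AhA]. Qed.

Lemma Be_ex x y : exists l, A x -> A y ->
  forall n, `|gdot x (apx y n) - l| <= 2 * gn x * dl n.
Proof.
have [[Ax Ay]|h] := pselect (A x /\ A y); last by exists 0 => *; exfalso; exact: h.
have [|l hl] := @dl_cauchy R (fun n => gdot x (apx y n)) (2 * gn x); last by exists l.
move=> n m; have An := apx_in n Ay; have Am := apx_in m Ay.
rewrite -(sipBr gs)//; apply: le_trans (ler_norm _) _.
apply: le_trans (gdot_le Ax (csubB Acs An Am)) _.
by rewrite mulrAC mulrC ler_wpM2r ?gn_ge0//; have [_ _] := apxP Ay; exact.
Qed.

(* [Be x y = <e x, e y>] for the projection [e] onto the closure of [Ah] in the
   (absent) completion of [A] with respect to [gdot]. *)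
Definition Be x y : R := sval (cid (Be_ex x y)).

Lemma BeP x y : A x -> A y ->
  forall n, `|gdot x (apx y n) - Be x y| <= 2 * gn x * dl n.
Proof. exact: (svalP (cid (Be_ex x y))). Qed.

(** Any sequence in [Ah] that represents [gdot g y] at the rate [dl] computes [Be]. Linearity in the
    second argument and the adjoint rule use this with sequences derived from [apx]. *)
Lemma Be_uniq x y (b : nat -> H -> H) K : A x -> A y -> (forall n, Ah (b n)) ->
  0 <= K ->
  (forall n g, Ah g -> `|gdot g y - gdot g (b n)| <= K * dl n * gn g) ->
  forall n, `|gdot x (b n) - Be x y| <= (K + 3) * gn x * dl n.
Proof.
move=> Ax Ay hb K0 hK n; have [ha h1 _] := apxP Ay.
pose d := b n - apx y n.
have hd : Ah d by apply: csubB (sa_sub sAh) _ _.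
have Ad := AhA hd; have Ab' := AhA (hb n); have Aa := AhA (ha n).
have dle : gn d <= (K + 1) * dl n.
  have : gn d ^+ 2 <= (K + 1) * dl n * gn d.
    rewrite sqr_gn// {2}/d (sipBr gs)//.
    have := hK n d hd; have := h1 n d hd; rewrite !ler_norml; nra.
  have := gn_ge0 d; have := dl_ge0 R n; rewrite expr2.
  have [->|d0] := eqVneq (gn d) 0; first by move=> dn _ _; rewrite mulr_ge0// addr_ge0.
  by move=> dn gd; rewrite ler_pM2r// lt_neqAle eq_sym d0.
have hx := gdot_le Ax Ad; rewrite /d (sipBr gs)// -/d in hx.
have := BeP Ax Ay n; have := gn_ge0 x; move: hx dle; rewrite !ler_norml.
have := dl_ge0 R n; nra.
Qed.

Lemma Be_linl r x x' y : A x -> A x' -> A y ->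
  Be (r%:C%C *: x + x') y = r * Be x y + Be x' y.
Proof.
move=> Ax Ax' Ay; have Axx : A (r%:C%C *: x + x') by exact: Acs.2.
apply: (@dl_eq _ _ _ (2 * gn (r%:C%C *: x + x') + `|r| * (2 * gn x) + 2 * gn x')) => n.
have h1 := BeP Axx Ay n; have h2 := BeP Ax Ay n; have h3 := BeP Ax' Ay n.
rewrite (sip_lin gs) in h1; try done; last exact: apx_in.
set X := gdot x _ in h1 h2; set Y := gdot x' _ in h1 h3.
have -> : Be (r%:C%C *: x + x') y - (r * Be x y + Be x' y) =
  - (r * X + Y - Be (r%:C%C *: x + x') y) + r * (X - Be x y) + (Y - Be x' y) by ring.
rewrite 2!(mulrDl _ _ (dl n)) (le_trans (ler_normD _ _))// lerD// (le_trans (ler_normD _ _))//.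
apply: lerD; first by rewrite normrN.
by rewrite normrM -mulrA ler_wpM2l.
Qed.

Lemma Be_linr r x y y' : A x -> A y -> A y' ->
  Be x (r%:C%C *: y + y') = r * Be x y + Be x y'.
Proof.
move=> Ax Ay Ay'; have Ayy : A (r%:C%C *: y + y') by exact: Acs.2.
have [ha h1 _] := apxP Ay; have [ha' h1' _] := apxP Ay'.
have hb n : Ah (r%:C%C *: apx y n + apx y' n) by apply: (sa_sub sAh).2.
have K0 : 0 <= `|r| + 1 by rewrite addr_ge0.
have linr n g : A g -> gdot g (r%:C%C *: apx y n + apx y' n) =
    r * gdot g (apx y n) + gdot g (apx y' n).
  move=> Av; have Aa := apx_in n Ay; have Aa' := apx_in n Ay'.
  by rewrite (sipDr gs)//; [rewrite (sipZr gs)|exact: csubZ].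
have hK n g : Ah g -> `|gdot g (r%:C%C *: y + y') -
    gdot g (r%:C%C *: apx y n + apx y' n)| <= (`|r| + 1) * dl n * gn g.
  move=> hv; have Av := AhA hv.
  rewrite linr// (sipDr gs)//; last exact: csubZ.
  rewrite (sipZr gs)// opprD addrACA -mulrBr.
  rewrite (le_trans (ler_normD _ _))// 2!mulrDl mul1r lerD ?h1'//.
  by rewrite normrM -mulrA ler_wpM2l// h1.
have h2 := Be_uniq Ax Ayy hb K0 hK.
apply: (@dl_eq _ _ _ ((`|r| + 1 + 3) * gn x + `|r| * (2 * gn x) + 2 * gn x)) => n.
have h3 := BeP Ax Ay n; have h4 := BeP Ax Ay' n; have := h2 n; rewrite linr//.
set X := gdot x _ in h3 *; set Y := gdot x _ in h4 * => h5.
have -> : Be x (r%:C%C *: y + y') - (r * Be x y + Be x y') =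
  - (r * X + Y - Be x (r%:C%C *: y + y')) + r * (X - Be x y) + (Y - Be x y') by ring.
rewrite 2!(mulrDl _ _ (dl n)) (le_trans (ler_normD _ _))// lerD//.
rewrite (le_trans (ler_normD _ _))//.
apply: lerD; first by rewrite normrN.
by rewrite normrM -mulrA ler_wpM2l.
Qed.

Lemma BeEl x y : Ah x -> A y -> Be x y = gdot x y.
Proof.
move=> hx Ay; have Ax := AhA hx; apply: (@dl_eq _ _ _ (3 * gn x)) => n.
have [_ h _] := apxP Ay; have := h n x hx; have := BeP Ax Ay n.
rewrite !ler_norml; have := dl_ge0 R n; have := gn_ge0 x; nra.
Qed.

(** Left multiplication by [adj c] preserves [Ah], so it maps approximants of [y] to approximants of
    [adj c \o y]. *)
Lemma Be_adj c x y : Ah c -> A x -> A y -> Be (c \o x) y = Be x (adj c \o y).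
Proof.
move=> hc Ax Ay; have Ac := AhA hc; have Acx : A (c \o x) by exact: (sa_comp sA).
have Aca : A (adj c) by exact: (sa_adj sA).
have Acy : A (adj c \o y) by exact: (sa_comp sA).
have [k k0 hk] := bop_bound (Ab Ac); have [ha h1 _] := apxP Ay.
have hb n : Ah (adj c \o apx y n) by apply: (sa_comp sAh) => //; exact: (sa_adj sAh).
have hK n g : Ah g -> `|gdot g (adj c \o y) - gdot g (adj c \o apx y n)| <=
    k * dl n * gn g.
  move=> hv; have Av := AhA hv.
  rewrite -!(gdot_adj vA)//; try exact: apx_in.
  apply: le_trans (h1 n _ (sa_comp sAh hc hv)) _.
  by rewrite [leRHS]mulrAC [leRHS]mulrC ler_wpM2l ?dl_ge0//; apply: gn_mul => //; exact: ltW.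
have h2 := Be_uniq Ax Acy hb (ltW k0) hK.
apply: (@dl_eq _ _ _ ((k + 3) * gn x + 2 * gn (c \o x))) => n.
have := h2 n; have := BeP Acx Ay n; rewrite (gdot_adj vA)//; last exact: apx_in.
rewrite !ler_norml; nra.
Qed.

Lemma Be_le x y : A x -> A y -> `|Be x y| <= gn x * gn y.
Proof.
move=> Ax Ay; apply: (@dl_lim _ _ _ (3 * gn x)) => n.
have [ha h1 _] := apxP Ay; have Aa := apx_in n Ay.
have gna : gn (apx y n) <= gn y + dl n.
  have : gn (apx y n) ^+ 2 <= gn (apx y n) * (gn y + dl n).
    rewrite sqr_gn//; have := h1 n _ (ha n); have := gdot_le Aa Ay.
    rewrite !ler_norml; nra.
  have [->|d0] := eqVneq (gn (apx y n)) 0; first by rewrite addr_ge0 ?gn_ge0 ?dl_ge0.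
  by rewrite expr2 ler_pM2l// lt_neqAle eq_sym d0 gn_ge0.
have := BeP Ax Ay n; have := gdot_le Ax Aa; have := gn_ge0 x.
rewrite !ler_norml; nra.
Qed.

Lemma BeBl x x' y : A x -> A x' -> A y -> Be (x - x') y = Be x y - Be x' y.
Proof.
move=> Ax Ax' Ay; have := Be_linl (-1) Ax' Ax Ay.
by rewrite rmorphN1 scaleN1r mulN1r ![- _ + _]addrC.
Qed.

Lemma BeBr x y y' : A x -> A y -> A y' -> Be x (y - y') = Be x y - Be x y'.
Proof.
move=> Ax Ay Ay'; have := Be_linr (-1) Ax Ay' Ay.
by rewrite rmorphN1 scaleN1r mulN1r ![- _ + _]addrC.
Qed.

Lemma BeDl x x' y : A x -> A x' -> A y -> Be (x + x') y = Be x y + Be x' y.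
Proof.
by move=> Ax Ax' Ay; have := Be_linl 1 Ax Ax' Ay; rewrite rmorph1 scale1r mul1r.
Qed.

Lemma BeDr x y y' : A x -> A y -> A y' -> Be x (y + y') = Be x y + Be x y'.
Proof.
by move=> Ax Ay Ay'; have := Be_linr 1 Ax Ay Ay'; rewrite rmorph1 scale1r mul1r.
Qed.

Definition orbit (xi : H) : set H := [set y xi | y in A].

Lemma csub_orbit xi : csub (orbit xi).
Proof.
split; first by exists 0; [exact: Acs.1|].
by move=> a _ _ [x Ax <-] [y Ay <-]; exists (a *: x + y) => //; exact: Acs.2.
Qed.

Lemma perp2_orbit a xi u : A a -> perp (perp (orbit xi)) u ->
  perp (perp (orbit xi)) (a u).
Proof.
move=> Aa hu v hv; rewrite rdotC (rdot_adj (adjP (Ab Aa))) rdotC; apply: hu.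
move=> _ [y Ay <-]; rewrite rdotC (rdot_adj (adjointC (adjP (Ab Aa)))) rdotC.
by apply: hv; exists (a \o y) => //; exact: (sa_comp sA).
Qed.

Lemma gn_localized T xi x : A x -> localized A f T xi -> gn (x \o T) <= nm (x xi).
Proof.
move=> Ax [AT hT]; rewrite -(@ler_pXn2r _ 2)// ?nnegrE ?gn_ge0 ?nm_ge0//.
by rewrite sqr_nm sqr_gn ?hT//; exact: (sa_comp sA).
Qed.

(** [G x] is the image of the projection of [x] under the adjoint of the contraction
    [y xi |-> y \o T]. It replaces elements of the absent completion by vectors of [H]. *)
Lemma riesz_localized T xi : localized A f T xi ->
  exists G : (H -> H) -> H, forall x, A x ->
    [/\ (forall y, A y -> rdot (y xi) (G x) = Be (y \o T) x),
        perp (perp (orbit xi)) (G x) & nm (G x) <= gn x].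
Proof.
move=> lT; have AT := lT.1.
suff /choice[G hG] : forall x, exists w, A x ->
    [/\ (forall y, A y -> rdot (y xi) w = Be (y \o T) x),
        perp (perp (orbit xi)) w & nm w <= gn x] by exists G.
move=> x; have [Ax|] := pselect (A x); last by exists 0.
(* A vector of the orbit comes from many [y]. The choice is immaterial: if [y xi = y' xi], then
   [(y - y') \o T] is null for [gdot], which is the content of [wd]. *)
have /choice[Y hY] : forall v, exists y, orbit xi v -> A y /\ y xi = v.
  move=> v; have [[y Ay yv]|h] := pselect (orbit xi v); first by exists y.
  by exists 0.
have AYT v : orbit xi v -> A (Y v \o T).
  by move=> /hY[AY _]; exact: (sa_comp sA).
have wd y v : A y -> y xi = v -> Be (y \o T) x = Be (Y v \o T) x.
  move=> Ay yv; have Vv : orbit xi v by exists y.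
  have [AY Yv] := hY v Vv; have AyT : A (y \o T) by exact: (sa_comp sA).
  apply/eqP; rewrite -subr_eq0 -BeBl//; last exact: AYT.
  rewrite -normr_le0 -(mul0r (gn x)).
  have Ayy : A (y - Y v) by exact: csubB.
  apply: le_trans (Be_le _ Ax) _; first by apply: csubB => //; exact: AYT.
  rewrite ler_wpM2r ?gn_ge0//.
  apply: le_trans (gn_localized Ayy lT) _.
  by rewrite opDE opNE Yv yv subrr nm0.
have [||||g [g1 g2 g3]] := @riesz R H (orbit xi) (fun v => Be (Y v \o T) x) (gn x).
- exact/csub_rsub/csub_orbit.
- move=> r v w Vv Vw; have [AYv Yv] := hY v Vv; have [AYw Yw] := hY w Vw.
  rewrite -(wd (r%:C%C *: Y v + Y w)); last 2 first.
    exact: Acs.2.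
    by rewrite opDE opZE Yv Yw.
  by rewrite compDl compZl Be_linl//; exact: AYT.
- exact: gn_ge0.
- move=> v Vv; have [AYv Yv] := hY v Vv.
  apply: le_trans (Be_le (AYT _ Vv) Ax) _.
  by rewrite mulrC ler_wpM2l ?gn_ge0// -{2}Yv; exact: gn_localized.
exists g => _; split=> // y Ay; rewrite -g1; last by exists y.
by rewrite -(wd y).
Qed.

(** The heart of the density theorem. The adjoint [t] of [x eta |-> G (x \o S)] is an operator on
    [H] that represents [Be] between the orbits of [xi] and [eta]. By [Be_adj] it commutes with
    [Ah], hence by [Ahd] with [z]. *)
Lemma Be_localized T xi (S : H -> H) eta z : localized A f T xi -> localized A f S eta -> A z ->
  Be (z \o T) S = Be T (adj z \o S).
Proof.
move=> lT lS Az; have [G hG] := riesz_localized lT.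
have AT := lT.1; have AS := lS.1.
have G1 x y : A x -> A y -> rdot (y xi) (G x) = Be (y \o T) x.
  by move=> Ax; have [+ _ _] := hG x Ax; apply.
have G2 x : A x -> perp (perp (orbit xi)) (G x) by move=> /hG[].
have G3 x : A x -> nm (G x) <= gn x by move=> /hG[].
have csP := perp_csub (perp_csub (csub_orbit xi)).
have GB x x' : A x -> A x' -> G (x - x') = G x - G x'.
  move=> Ax Ax'; have Axx : A (x - x') by exact: csubB.
  apply: (perp_eq (V := orbit xi)); [exact: G2|by apply: csubB csP _ _; exact: G2|].
  move=> _ [y Ay <-]; rewrite rdotBr !G1// BeBr//; exact: (sa_comp sA).
have GD x x' : A x -> A x' -> G (x + x') = G x + G x'.
  move=> Ax Ax'; have Axx : A (x + x') by exact: csubD.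
  apply: (perp_eq (V := orbit xi)); [exact: G2|by apply: csubD csP _ _; exact: G2|].
  move=> _ [y Ay <-]; rewrite rdotDr !G1// BeDr//; exact: (sa_comp sA).
have GM a x : Ah a -> A x -> G (a \o x) = a (G x).
  move=> ha Ax; have Aa := AhA ha; have Aax : A (a \o x) by exact: (sa_comp sA).
  have haa : Ah (adj a) by exact: (sa_adj sAh).
  apply: (perp_eq (V := orbit xi)); [exact: G2|by apply: perp2_orbit => //; exact: G2|].
  move=> _ [y Ay <-]; have AyT : A (y \o T) by exact: (sa_comp sA).
  rewrite G1// -(rdot_adj (adjointC (adjP (Ab Aa)))).
  rewrite (G1 _ (adj a \o y))//; last by apply: (sa_comp sA) => //; exact: AhA.
  rewrite -[(adj a \o y) \o T]/(adj a \o (y \o T)) (Be_adj haa AyT Ax).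
  by rewrite (adjK (Ab Aa)).
have /choice[X hX] : forall v, exists x, orbit eta v -> A x /\ x eta = v.
  move=> v; have [[x Ax xv]|h] := pselect (orbit eta v); first by exists x.
  by exists 0.
have AcS x : A x -> A (x \o S) by move=> Ax; exact: (sa_comp sA).
have wd x x' : A x -> A x' -> x eta = x' eta -> G (x \o S) = G (x' \o S).
  move=> Ax Ax' e; apply/eqP; rewrite -subr_eq0 -GB//; try exact: AcS.
  have Axx : A (x - x') by exact: csubB.
  apply/eqP/nm_eq0/eqP; rewrite eq_le nm_ge0 andbT.
  have AxxS : A ((x - x') \o S) by exact: AcS.
  apply: le_trans (G3 _ AxxS) _; apply: le_trans (gn_localized Axx lS) _.
  by rewrite opDE opNE e subrr nm0.
pose h v := G (X v \o S).
have hE x : A x -> h (x eta) = G (x \o S).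
  by move=> Ax; have [AX e] := hX (x eta) (ex_intro2 _ _ x Ax erefl); exact: wd.
have hlin a u v : orbit eta u -> orbit eta v -> h (a *: u + v) = a *: h u + h v.
  move=> [x Ax <-] [y Ay <-]; have Aaxy : A (a *: x + y) by exact: Acs.2.
  rewrite -[a *: x eta + y eta]/((a *: x + y) eta) !hE// compDl compZl GD//.
  - congr (_ + _); pose c := a *: @idfun H.
    have hc : Ah c by apply: csubZ (sa_sub sAh) (sa_id sAh).
    exact: (GM c _ hc (AcS _ Ax)).
  - by apply: csubZ => //; exact: AcS.
  - exact: AcS.
have hb u : orbit eta u -> nm (h u) <= 1 * nm u.
  move=> [x Ax <-]; rewrite hE// mul1r; apply: le_trans (G3 _ (AcS _ Ax)) _.
  exact: gn_localized.
have [t [tl tb tE tV]] := riesz_adjoint (csub_orbit eta) hlin ler01 hb.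
have bt : bounded_op t by apply/bounded_opP; split=> //; exists 1; split.
have tR x w : A x -> rdot (G (x \o S)) w = rdot (x eta) (t w).
  by move=> Ax; rewrite -hE// /rdot tE//; exists x.
have ct : commutant Ah t.
  split=> // a ha; apply/funext => w /=; have Aa := AhA ha.
  have haa : Ah (adj a) by exact: (sa_adj sAh).
  apply: (perp_eq (V := orbit eta)); [exact: tV|by apply: perp2_orbit => //; exact: tV|].
  move=> _ [x Ax <-]; rewrite -tR// -(rdot_adj (adjointC (adjP (Ab Aa)))).
  rewrite -(rdot_adj (adjointC (adjP (Ab Aa)))).
  rewrite -(GM _ _ haa (AcS _ Ax)).
  rewrite -[adj a \o (x \o S)]/((adj a \o x) \o S) tR//.
  by apply: (sa_comp sA) => //; exact: AhA.
have [_ tz] := Ahd ct; have tzE w : t (z w) = z (t w) := congr1 (fun g : H -> H => g w) (tz z Az).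
have AI : A idfun := sa_id sA.
have Aza : A (adj z) by exact: (sa_adj sA).
have := G1 S z AS Az; rewrite rdotC -[S]/(idfun \o S) (tR idfun)// tzE.
rewrite -(rdot_adj (adjointC (adjP (Ab Az)))) -[idfun eta]/eta -tR// rdotC.
by rewrite -[xi]/(idfun xi) (G1 _ idfun (AcS _ Aza) AI) => <-.
Qed.

Lemma Be_locspan p q z : locspan A f p -> locspan A f q -> A z ->
  Be (z \o p) q = Be p (adj z \o q).
Proof.
move=> lp lq Az; have bz := Ab Az; have Aza : A (adj z) := sa_adj sA Az.
have bza := Ab Aza; have A0 := Acs.1.
have Be0l y : A y -> Be 0 y = 0.
  by move=> Ay; have := BeBl A0 A0 Ay; rewrite !subrr.
have Be0r x : A x -> Be x 0 = 0.
  by move=> Ax; have := BeBr Ax A0 A0; rewrite !subrr.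
have Aq := locspan_in vA lq; have Azq : A (adj z \o q) by exact: (sa_comp sA).
elim: lp => [|T xi x lT lx IH].
  by rewrite (comp0r bz) !Be0l.
have AT := lT.1; have Ax := locspan_in vA lx.
have AzT : A (z \o T) by exact: (sa_comp sA).
rewrite (compDr _ _ bz) !BeDl// ?IH//; last exact: (sa_comp sA).
congr (_ + _); elim: {Aq Azq IH} lq => [|S eta y lS ly IH].
  by rewrite (comp0r bza) !Be0r.
have AS := lS.1; have Ay := locspan_in vA ly.
rewrite (compDr _ _ bza) !BeDr//; try exact: (sa_comp sA).
by rewrite IH (Be_localized lT lS Az).
Qed.

Lemma gn_locspan x e : A x -> 0 < e -> exists2 y, locspan A f y & gn (x - y) < e.
Proof.
move=> Ax e0; have [y ly hy] := locspan_dense vA hf Ax (exprn_gt0 2 e0).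
exists y => //; have Axy : A (x - y) by apply: csubB => //; exact: locspan_in ly.
by rewrite -(@ltr_pXn2r _ 2)// ?nnegrE ?gn_ge0 ?ltW// sqr_gn.
Qed.

(** Both sides are bounded for [gn] in [p] and [q], and [locspan] is dense, so the rule extends from
    [Be_locspan]. *)
Lemma Be_comp p q z : A p -> A q -> A z -> Be (z \o p) q = Be p (adj z \o q).
Proof.
move=> Ap Aq Az; have Aza : A (adj z) := sa_adj sA Az.
have [k k0 hk] := bop_bound (Ab Az); have [k' k'0 hk'] := bop_bound (Ab Aza).
have cA x y : A x -> A y -> A (x \o y) by exact: (sa_comp sA).
apply/eqP; rewrite -subr_eq0 -normr_le0.
pose K := k * gn q + k * (gn p + 1) + gn p * k' + (gn q + 1) * k'.
apply: (@ler_addgt0Ml _ _ _ K) => e e0 e1; rewrite add0r.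
have [p' lp hp] := gn_locspan Ap e0; have [q' lq hq] := gn_locspan Aq e0.
have Ap' := locspan_in vA lp; have Aq' := locspan_in vA lq.
have App : A (p - p') by exact: csubB.
have Aqq : A (q - q') by exact: csubB.
have tri x y : A x -> A y -> gn y <= gn x + gn (x - y).
  move=> Ax Ay; have Axy : A (x - y) by exact: csubB.
  rewrite -(@ler_pXn2r _ 2)// ?nnegrE ?addr_ge0 ?gn_ge0//.
  have {1}-> : y = x - (x - y) by rewrite opprB addrC subrK.
  move: (x - y) Axy => d Ad; rewrite sqr_gn; last exact: csubB.
  rewrite (sipBl gs) ?(sipBr gs)//; last exact: csubB.
  have := gdot_le Ax Ad; rewrite (sip_sym gs Ad Ax) -!sqr_gn// ler_norml; nra.
have hp' := tri _ _ Ap Ap'; have hq' := tri _ _ Aq Aq'.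
have e1' : Be (z \o p) q - Be p (adj z \o q) =
    Be (z \o (p - p')) q + Be (z \o p') (q - q')
    - Be (p - p') (adj z \o q') - Be p (adj z \o (q - q')).
  rewrite !compBr; try exact: Ab.
  rewrite !BeBl ?BeBr//; try exact: cA; try exact: csubB.
  by rewrite (Be_locspan lp lq Az); ring.
have n1 : `|Be (z \o (p - p')) q| <= k * e * gn q.
  apply: le_trans (Be_le (cA _ _ Az App) Aq) _; rewrite ler_wpM2r ?gn_ge0//.
  by apply: le_trans (gn_mul App Az (ltW k0) hk) _; rewrite ler_pM2l// ltW.
have n2 : `|Be (z \o p') (q - q')| <= k * (gn p + 1) * e.
  apply: le_trans (Be_le (cA _ _ Az Ap') Aqq) _.
  rewrite ler_pM ?gn_ge0//; last exact: ltW.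
  apply: le_trans (gn_mul Ap' Az (ltW k0) hk) _; rewrite ler_pM2l//; lra.
have n3 : `|Be (p - p') (adj z \o q')| <= e * (k' * (gn q + 1)).
  apply: le_trans (Be_le App (cA _ _ Aza Aq')) _.
  rewrite ler_pM ?gn_ge0//; first exact: ltW.
  apply: le_trans (gn_mul Aq' Aza (ltW k'0) hk') _; rewrite ler_pM2l//; lra.
have n4 : `|Be p (adj z \o (q - q'))| <= gn p * (k' * e).
  apply: le_trans (Be_le Ap (cA _ _ Aza Aqq)) _; rewrite ler_wpM2l ?gn_ge0//.
  by apply: le_trans (gn_mul Aqq Aza (ltW k'0) hk') _; rewrite ler_pM2l// ltW.
rewrite e1'; move: n1 n2 n3 n4; rewrite /K !ler_norml.
move: (Be _ _) (Be _ _) (Be _ _) (Be _ _) => b1 b2 b3 b4.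
move=> /andP[? ?] /andP[? ?] /andP[? ?] /andP[? ?]; apply/andP; split; lra.
Qed.

(** The projection does not shrink [z]: moving [z] across turns [Be z z] into
    [Be idfun (adj z \o z)], which is [gdot z z] because [idfun] lies in [Ah]. *)
Theorem dense_subalgebra z e : A z -> 0 < e ->
  exists2 a, Ah a & gdot (z - a) (z - a) < e.
Proof.
move=> Az e0; have AI := sa_id sA; have Aza : A (adj z) := sa_adj sA Az.
have Bzz : Be z z = gdot z z.
  have Azz : A (adj z \o z) by exact: (sa_comp sA).
  rewrite -{1}[z]/(z \o idfun) Be_comp// BeEl//; last exact: sa_id.
  by rewrite -(gdot_adj vA).
(* The squared distance comes out at most [(3 * gn z + dl n) * dl n]; the minimum with [1] yields
   [dl n <= 1]. *)
have [n hn] : exists n, (6 * gn z + 1) * dl n < Num.min e 1.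
  have k0 : 0 < 6 * gn z + 1 by have := gn_ge0 z; lra.
  have m0 : 0 < Num.min e 1 by rewrite lt_min e0 ltr01.
  have [n hn] := dl_small (divr_gt0 m0 k0); exists n.
  by rewrite mulrC -ltr_pdivlMr.
have [ha h1 _] := apxP Az; exists (apx z n) => //; have Aa := apx_in n Az.
rewrite (sipBl gs)//; last exact: csubB.
rewrite !(sipBr gs)// (sip_sym gs Aa Az).
have h2 := h1 n _ (ha n); have h3 := BeP Az Az n; rewrite Bzz in h3.
have h4 := gdot_le Aa Az; rewrite (sip_sym gs Aa Az) in h4 h2.
have gna : gn (apx z n) <= gn z + dl n.
  have : gn (apx z n) ^+ 2 <= gn (apx z n) * (gn z + dl n).
    rewrite sqr_gn//; move: h2 h4; rewrite !ler_norml; nra.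
  have [->|d0] := eqVneq (gn (apx z n)) 0; first by rewrite addr_ge0 ?gn_ge0 ?dl_ge0.
  by rewrite expr2 ler_pM2l// lt_neqAle eq_sym d0 gn_ge0.
move: h3; rewrite -(sqr_gn Aa) -(sqr_gn Az); move: hn; rewrite lt_min ler_norml.
have := dl_ge0 R n; have := gn_ge0 z; have := gn_ge0 (apx z n).
move: (gdot _ _) => X.
move: (gn _) (gn _) (dl n) gna => p q d h p0 q0 d0 /andP[s1 s2] /andP[s3 s4].
have d1 : d <= 1 by nra.
nra.
Qed.

End density.

(* Iterating the inequality squares the ratio at each step, so a doubly
   exponential bound with any constant leaves no room for a first ratio above 1. *)
Lemma iterated_square_bound (R : realType) (a : nat -> R) (N D c : R) :
  0 < c -> 0 <= N -> (forall k, 0 <= a k) ->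
  (forall k, a k ^+ 2 <= N * a k.+1) -> (forall k, a k <= D * c ^+ (2 ^ k)) ->
  a 0 <= c * N.
Proof.
move=> c0 N0 a0 aN aD; have [N0'|N1] := eqVneq N 0.
  by have := aN 0; rewrite N0' mul0r mulr0; have := a0 0; nra.
have Np : 0 < N by rewrite lt_neqAle eq_sym N1.
have cp k : 0 < c ^+ (2 ^ k) by exact: exprn_gt0.
pose b k := a k / (N * c ^+ (2 ^ k)).
have Ncp k : 0 < N * c ^+ (2 ^ k) by rewrite mulr_gt0.
have b2 k : b k ^+ 2 <= b k.+1.
  rewrite /b expr_div_n ler_pdivrMr ?exprn_gt0// mulrAC ler_pdivlMr//.
  rewrite expnS mulnC exprM exprMn.
  have := aN k; have := cp k; set q := c ^+ _ => q0 h.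
  have q2 : 0 < N * q ^+ 2 by rewrite mulr_gt0// exprn_gt0.
  have -> : a k.+1 * (N ^+ 2 * q ^+ 2) = N * a k.+1 * (N * q ^+ 2) by ring.
  by rewrite ler_pM2r.
have bD k : b k <= D / N.
  by rewrite /b invfM mulrA ler_pdivrMr// mulrAC ler_pM2r ?invr_gt0//; exact: aD.
suff : b 0 <= 1.
  by rewrite /b expn0 expr1 ler_pdivrMr ?mulr_gt0// mul1r mulrC.
rewrite leNgt; apply/negP => b1.
pose d := b 0 - 1; have d0 : 0 < d by rewrite subr_gt0.
have bk k : 1 + k.+1%:R * d <= b k.
  elim: k => [|k IH]; first by rewrite mul1r /d addrC subrK.
  apply: le_trans (b2 k).
  have kd : 0 <= k%:R * d by rewrite mulr_ge0// ltW.
  have : 1 + (k%:R + 1) * d <= b k by rewrite natr1.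
  rewrite -(natr1 k.+1) -(natr1 k); nra.
have [n hn] : exists n, D / N < n.+1%:R * d.
  have := near_inv_nat (divr_gt0 d0 (_ : 0 < `|D / N| + 1)).
  have D1 : 0 < `|D / N| + 1 by rewrite ltr_wpDl.
  move=> /(_ D1) /filter_ex[n]; rewrite ltr_pdivlMr// => hn; exists n.
  move: hn; rewrite ltr_pdivrMl// => hn; have := ler_norm (D / N); lra.
have := bk n; have := bD n; lra.
Qed.

(** * Reduction by a projection of the commutant *)

Section reduction.
Variables (R : realType) (H : hilbertType R).
Local Notation bop := (@bounded_op R H).
Implicit Types (x y z e t : H -> H) (u v w : H) (m : seq ((H -> H) * H)).

(** With the operators [t] in the commutant, [opsum m e] is a vector of the span of [B e H], and
    [opsum m x] is the image prescribed for it by the lift of [x]. *)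
Fixpoint opsum m y : H := if m is (t, xi) :: m' then t (y xi) + opsum m' y else 0.

Fixpoint good (B : set (H -> H)) m : Prop :=
  if m is (t, _) :: m' then B t /\ good B m' else True.

Lemma opsum_cat m m' y : opsum (m ++ m') y = opsum m y + opsum m' y.
Proof.
by elim: m => [|[t xi] m IH]; rewrite ?add0r//= IH addrA.
Qed.

Lemma good_cat B m m' : good B m -> good B m' -> good B (m ++ m').
Proof. by move=> + hm'; elim: m => [|[t xi] m IH]//= [Bt /IH]. Qed.

Definition opmul t m := [seq (t \o q.1, q.2) | q <- m].

Lemma opsum_mul t m y : bounded_op t -> opsum (opmul t m) y = t (opsum m y).
Proof.
by move=> bt; elim: m => [|[s xi] m IH]; rewrite /= ?bop0// IH bopD.
Qed.

Lemma good_mul B t m : star_alg B -> B t -> good B m -> good B (opmul t m).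
Proof.
by move=> sB Bt; elim: m => [|[s xi] m IH]//= [Bs /IH]; split=> //; exact: (sa_comp sB).
Qed.

Lemma opsum_bound B m : B `<=` bop -> good B m ->
  exists2 D, 0 <= D & forall y d, (forall u, nm (y u) <= d * nm u) ->
    nm (opsum m y) <= D * d.
Proof.
move=> Bb; elim: m => [|[t xi] m IH] /=; first by exists 0 => // y d _; rewrite nm0 mul0r.
move=> [Bt /IH[D D0 hD]]; have [c c0 hc] := bop_bound (Bb _ Bt).
exists (c * nm xi + D) => [|y d hy]; first by rewrite addr_ge0// mulr_ge0 ?nm_ge0// ltW.
rewrite mulrDl (le_trans (nmD _ _))// lerD ?hD//.
by rewrite (le_trans (hc _))// -mulrA ler_pM2l// mulrC.
Qed.

Variables (A : set (H -> H)) (vA : von_neumann A) (e : H -> H).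
Local Notation B := (commutant A).
Hypotheses (be : bounded_op e) (se : selfadjoint e)
  (efaithful : forall r, A r -> r \o e = 0 -> r = 0).

Let sA : star_alg A := vN_star_alg vA.
Let sB : star_alg B.
Proof. apply: commutant_star_alg; [exact: sa_bop sA|exact: sa_adj sA]. Qed.

Definition reduced y := [/\ bounded_op y, y \o e = y, e \o y = y &
  forall t, B t -> y \o (e \o t \o e) = (e \o t \o e) \o y].

Lemma reduced_adj y : reduced y -> reduced (adj y).
Proof.
move=> [by_ ye ey yt]; have ae : adj e = e by exact: adjE.
split; first exact: bop_adj.
- by rewrite -{2}ey (adj_comp be by_) ae.
- by rewrite -{2}ye (adj_comp by_ be) ae.
move=> t Bt; have bt := sa_bop sB Bt; have Bta := sa_adj sB Bt.
have bete : bounded_op (e \o adj t \o e).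
  by do 2!apply: bop_comp => //; exact: bop_adj.
have ete : adj (e \o adj t \o e) = e \o t \o e.
  exact: adjE (is_adjoint_comp (is_adjoint_comp se (adjointC (adjP bt))) se).
have := congr1 (@adj R H) (yt _ Bta).
by rewrite (adj_comp by_ bete) (adj_comp bete by_) ete => ->.
Qed.

Lemma reduced_comp y z : reduced y -> reduced z -> reduced (y \o z).
Proof.
move=> [by_ ye ey yt] [bz ze ez zt]; split; first exact: bop_comp.
- by rewrite -[LHS]/(y \o (z \o e)) ze.
- by rewrite -[LHS]/((e \o y) \o z) ey.
move=> t Bt; rewrite -[LHS]/(y \o (z \o (e \o t \o e))) (zt _ Bt).
by rewrite -[LHS]/((y \o (e \o t \o e)) \o z) (yt _ Bt).
Qed.

(** The inner products involve only the operators [e \o (adj t' \o t) \o e], and [adj z] commutes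
    with them; so [z] can be moved to the other side. *)
Lemma opsum_dot m m' y z : good B m -> good B m' -> reduced y -> reduced z ->
  hdot (opsum m y) (opsum m' z) = hdot (opsum m (adj z \o y)) (opsum m' e).
Proof.
move=> + + ry rz; have [by_ ye ey yt] := ry; have [baz aze eaz azt] := reduced_adj rz.
have [bz _ _ _] := rz.
elim: m => [|[t xi] m IH] /= gm gm'; first by rewrite !hdot0l.
have [Bt gm2] := gm; rewrite !hdotDl IH//; congr (_ + _) => {IH gm gm2}.
elim: m' gm' => [|[t' xi'] m' IH] /= gm'; first by rewrite !hdot0r.
have [Bt' gm2] := gm'; rewrite !hdotDr IH//; congr (_ + _) => {IH gm' gm2}.
have Bt'a := sa_adj sB Bt'; have bt' := sa_bop sB Bt'.
have h := azt _ (sa_comp sB Bt'a Bt).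
have {}h : adj z (e (adj t' (t (e (y xi))))) = e (adj t' (t (e (adj z (y xi))))).
  exact (congr1 (fun g : H -> H => g (y xi)) h).
have e1 u : e (y u) = y u by exact (congr1 (fun g : H -> H => g u) ey).
have e2 u : e (adj z u) = adj z u by exact (congr1 (fun g : H -> H => g u) eaz).
have e3 u : adj z (e u) = adj z u by exact (congr1 (fun g : H -> H => g u) aze).
rewrite e1 e3 e2 in h.
rewrite -(adjointC (adjP bt')) -(adjointC (adjP bz)) h.
by rewrite se -(adjointC (adjP bt')).
Qed.

(** By [opsum_dot] and Cauchy-Schwarz, the squared norm at [y] is at most the norm at [adj y \o y]
    times [nm (opsum m e)]. Iterating along the powers of [adj x \o x] makes the crude constant of
    [opsum_bound] irrelevant. *)
Lemma opsum_le m x c : good B m -> reduced x -> 0 < c ->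
  (forall u, nm (x u) <= c * nm u) -> nm (opsum m x) <= c * nm (opsum m e).
Proof.
move=> gm rx c0 hc; have [D D0 hD] := opsum_bound (sa_bop sB) gm.
have [bx _ _ _] := rx; have rax := reduced_adj rx.
have hca u : nm (adj x u) <= c * nm u.
  have l := rdot_le (x (adj x u)) u; rewrite (rdot_adj (adjP bx)) -sqr_nm in l.
  have [->|n0] := eqVneq (nm (adj x u)) 0; first by rewrite mulr_ge0 ?nm_ge0// ltW.
  have np : 0 < nm (adj x u) by rewrite lt_neqAle eq_sym n0 nm_ge0.
  rewrite -(ler_pM2r np) -expr2 (le_trans l)// mulrAC ler_wpM2r ?nm_ge0//.
pose w := fix w k := if k is k'.+1 then w k' \o w k' else adj x \o x.
have hw k : [/\ reduced (w k), adj (w k) = w k &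
    forall u, nm (w k u) <= (c ^+ 2) ^+ (2 ^ k) * nm u].
  elim: k => [|k [h1 h2 h3]] /=.
    split; first exact: reduced_comp.
      by rewrite (adj_comp (bop_adj bx) bx) (adjK bx).
    move=> u; rewrite expr1 expr2 -mulrA (le_trans (hca _))// ler_pM2l//.
  have [bw _ _ _] := h1; split; [exact: reduced_comp|by rewrite (adj_comp bw bw) h2|].
  move=> u; rewrite expnS mul2n -addnn exprD -mulrA (le_trans (h3 _))//.
  by rewrite ler_pM2l// exprn_gt0// exprn_gt0.
have sq y : reduced y -> nm (opsum m y) ^+ 2 <=
    nm (opsum m (adj y \o y)) * nm (opsum m e).
  by move=> ry; rewrite sqr_nm {1}/rdot opsum_dot//; exact: rdot_le.
have h0 := sq x rx.
have h1 : nm (opsum m (w 0)) <= c ^+ 2 * nm (opsum m e).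
  apply: (@iterated_square_bound R (fun k => nm (opsum m (w k))) _ D).
  - exact: exprn_gt0.
  - exact: nm_ge0.
  - by move=> k; exact: nm_ge0.
  - by move=> k; have [rw sw _] := hw k; have := sq _ rw; rewrite sw mulrC.
  - by move=> k; have [_ _ bw] := hw k; exact: hD.
rewrite -(@ler_pXn2r _ 2)// ?nnegrE ?mulr_ge0 ?nm_ge0 ?(ltW c0)//.
apply: le_trans h0 _; rewrite exprMn [X in _ <= _ * X]expr2 mulrA.
by rewrite ler_wpM2r ?nm_ge0.
Qed.

(** The assignment [t (e xi) |-> t (x xi)] extends linearly to the span [V] of [B e H] and is
    bounded there by [opsum_le]. It commutes with [B]; its extension to [H] is obtained as a double
    adjoint. *)
Theorem reduction_lift x : reduced x -> exists2 r, A r & r \o e = x.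
Proof.
move=> rx; have [bx xe ex xt] := rx.
pose V := [set v | exists2 m, good B m & opsum m e = v].
have Bb := sa_bop sB.
have BZ a : B (a *: idfun) by apply: csubZ (sa_sub sB) (sa_id sB).
have csV : csub V.
  split; first by exists [::].
  move=> a _ _ [m gm <-] [m' gm' <-]; exists (opmul (a *: idfun) m ++ m').
    by apply: good_cat => //; exact: good_mul.
  by rewrite opsum_cat opsum_mul//; exact: Bb.
have Ve xi : V (e xi).
  by exists [:: (idfun, xi)] => /=; rewrite ?addr0//; split=> //; exact: sa_id.
have Vmul t v : B t -> V v -> V (t v).
  move=> Bt [m gm <-]; exists (opmul t m); first exact: good_mul.
  by rewrite opsum_mul//; exact: Bb.
have ppV t u : B t -> perp (perp V) u -> perp (perp V) (t u).
  move=> Bt hu v hv; have bt := Bb _ Bt; rewrite rdotC (rdot_adj (adjP bt)) rdotC.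
  apply: hu => v' Vv'; rewrite rdotC (rdot_adj (adjointC (adjP bt))) rdotC.
  by apply: hv; exact: Vmul.
have AB z : bounded_op z -> (forall t, B t -> z \o t = t \o z) -> A z.
  by move=> bz hz; apply/vN_mem.
(* The projection [q] onto the closure of [V] commutes with [B] and fixes the range of [e];
   [efaithful] then forces [q = idfun]. *)
have dense u : perp (perp V) u.
  have idV v : V v -> nm (idfun v) <= 1 * nm v by rewrite mul1r.
  have [q [ql qb qE qV]] := @riesz_adjoint R H H V idfun 1 csV
    (fun _ _ _ _ _ => erefl) ler01 idV.
  have bq : bounded_op q by apply/bounded_opP; split=> //; exists 1; split.
  have qR v w : V v -> rdot v w = rdot v (q w) by move=> Vv; rewrite /rdot -qE.
  have Aq : A q.
    apply: AB => // t Bt; apply/funext => w /=; have bt := Bb _ Bt.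
    apply: (perp_eq (V := V)); [exact: qV|by apply: ppV => //; exact: qV|].
    move=> v Vv; rewrite -qR// -!(rdot_adj (adjointC (adjP bt))) -qR//.
    by apply: Vmul => //; exact: (sa_adj sB).
  have qe : (q - idfun) \o e = 0.
    apply/funext => xi; rewrite /= opDE opNE op0E /=; apply/eqP; rewrite subr_eq0.
    apply/eqP; apply: (perp_eq (V := V)); [exact: qV|exact/perp2/Ve|].
    by move=> v Vv; rewrite -qR.
  have /eqP : q - idfun = 0.
    by apply: efaithful qe; apply: csubB (sa_sub sA) Aq (sa_id sA).
  by rewrite subr_eq0 => /eqP qI; rewrite -[u]/(idfun u) -qI; exact: qV.
have /choice[M hM] : forall v, exists m, V v -> good B m /\ opsum m e = v.
  move=> v; have [[m gm mv]|h] := pselect (V v); first by exists m.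
  by exists [::].
have [c c0 hc] := bop_bound bx.
have wd m m' : good B m -> good B m' -> opsum m e = opsum m' e ->
    opsum m x = opsum m' x.
  move=> gm gm' E; apply/eqP; rewrite -subr_eq0; apply/eqP/nm_eq0/eqP.
  pose k := m ++ opmul ((-1) *: idfun) m'.
  have gk : good B k by apply: good_cat => //; exact: good_mul.
  have kE y : opsum k y = opsum m y - opsum m' y.
    by rewrite opsum_cat (opsum_mul _ _ (Bb _ (BZ _))) opZE /= scaleN1r.
  rewrite -kE eq_le nm_ge0 andbT; apply: le_trans (opsum_le gk rx c0 hc) _.
  by rewrite kE E subrr nm0 mulr0.
pose h v := opsum (M v) x.
have hE m : good B m -> h (opsum m e) = opsum m x.
  by move=> gm; have [gM E] := hM (opsum m e) (ex_intro2 _ _ m gm erefl); exact: wd.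
have hlin a u v : V u -> V v -> h (a *: u + v) = a *: h u + h v.
  move=> [m gm <-] [m' gm' <-].
  have e1 : opsum (opmul (a *: idfun) m ++ m') e = a *: opsum m e + opsum m' e.
    by rewrite opsum_cat opsum_mul//; exact: Bb.
  rewrite -e1 !hE//; last by apply: good_cat => //; exact: good_mul.
  by rewrite opsum_cat opsum_mul//; exact: Bb.
have hb u : V u -> nm (h u) <= c * nm u.
  by move=> [m gm <-]; rewrite hE//; exact: opsum_le.
have [y [yl yb yE _]] := riesz_adjoint csV hlin (ltW c0) hb.
have by_ : bounded_op y by apply/bounded_opP; split=> //; exists c; split=> //; exact: ltW.
have yR v w : V v -> rdot (h v) w = rdot v (y w) by move=> Vv; rewrite /rdot yE.
have hmul t v : B t -> V v -> h (t v) = t (h v).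
  move=> Bt [m gm <-]; have bt := Bb _ Bt.
  by rewrite -opsum_mul// !hE ?opsum_mul//; exact: good_mul.
have Ay : A y.
  apply: AB => // t Bt; apply/funext => w /=; have bt := Bb _ Bt.
  have Bta := sa_adj sB Bt.
  apply: (perp_eq (V := V)) => // v Vv.
  rewrite -yR// -!(rdot_adj (adjointC (adjP bt))) -yR ?hmul//; exact: Vmul.
exists (adj y); first exact: (sa_adj sA).
apply/funext => xi /=; apply: rdot_inj => w.
rewrite rdotC (rdot_adj (adjointC (adjP by_))) -yR// rdotC; congr (rdot _ _).
have <- : opsum [:: (idfun, xi)] e = e xi by rewrite /= addr0.
rewrite hE /= ?addr0//; split=> //; exact: sa_id.
Qed.

End reduction.

Lemma expr_small (R : realType) (r e : R) : 0 <= r -> r < 1 -> 0 < e ->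
  exists k, r ^+ k < e.
Proof.
move=> r0 r1 e0; have r1' : `|r| < 1 by rewrite ger0_norm.
have /cvgrPdist_lt/(_ e e0) h := cvg_expr r1'.
have [k hk] := filter_ex h; exists k; move: hk.
by rewrite sub0r normrN ger0_norm// exprn_ge0.
Qed.

(** * Square roots, and embeddings reflecting positivity *)

Section norm_limit.
Variables (R : realType) (H : hilbertType R).
Local Notation C := R[i].
Implicit Types (x y z t : H -> H) (u v w : H) (G : set (H -> H)).

Lemma norm_limit (y : nat -> H -> H) (eta : nat -> R) :
  (forall k, bounded_op (y k)) -> (forall k, 0 <= eta k) ->
  (forall e, 0 < e -> exists k, eta k < e) ->
  (forall k n u, nm (y (k + n)%N u - y k u) <= eta k * nm u) ->
  exists2 l, bounded_op l & forall k u, nm (l u - y k u) <= eta k * nm u.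
Proof.
move=> by_ e0 elim yc.
have /choice[l hl] : forall u, exists g, forall e, 0 < e ->
    (\oo : set_system nat) [set n | nm (y n u - g) < e].
  move=> u; apply: hilbert_complete => e ep.
  have d0 : 0 < e / (2 * (nm u + 1)).
    by rewrite divr_gt0// mulr_gt0// ltr_wpDl ?nm_ge0.
  have [k hk] := elim _ d0; exists [set n | (k <= n)%N]; first exact: nbhs_infty_ge.
  move=> n m /= kn km; have hn := yc k (n - k)%N u; have hm := yc k (m - k)%N u.
  rewrite subnKC// in hn; rewrite subnKC// in hm.
  rewrite ltr_pdivlMr ?mulr_gt0 ?ltr_wpDl ?nm_ge0// in hk.
  have -> : y n u - y m u = (y n u - y k u) - (y m u - y k u).
    by rewrite opprB addrA subrK.
  have := nmD (y n u - y k u) (- (y m u - y k u)); rewrite nmN.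
  have := nm_ge0 u; have := e0 k; nra.
have le k u : nm (l u - y k u) <= eta k * nm u.
  apply: (@ler_addgt0Ml _ _ _ 1) => e ep _; rewrite mulr1.
  have : \forall n \near \oo, nm (y n u - l u) < e /\ (k <= n)%N.
    by apply: filterI; [exact: hl|exact: nbhs_infty_ge].
  move=> /filter_ex[n [h1 h2]].
  have h3 := yc k (n - k)%N u; rewrite subnKC// in h3.
  have -> : l u - y k u = (l u - y n u) + (y n u - y k u) by rewrite addrA subrK.
  by rewrite (le_trans (nmD _ _))// addrC lerD// nmB ltW.
exists l => //; apply/bounded_opP; split.
  move=> a u v; apply/eqP; rewrite -subr_eq0; apply/eqP/nm_eq0/eqP.
  rewrite eq_le nm_ge0 andbT.
  have n0 : 0 <= Normc.normc a by case: (a) => p q; rewrite sqrtr_ge0.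
  apply: (@ler_addgt0Ml _ _ _ (nm (a *: u + v) + (Normc.normc a * nm u + nm v))).
  move=> e ep _; rewrite add0r; have [k hk] := elim e ep.
  have -> : l (a *: u + v) - (a *: l u + l v) =
      (l (a *: u + v) - y k (a *: u + v)) - (a *: (l u - y k u) + (l v - y k v)).
    rewrite (bop_linear (by_ k)) scalerBr; set p := a *: l u; set q := a *: y k u.
    by rewrite addrACA -opprD opprB addrA subrK.
  have h u' : nm (l u' - y k u') <= e * nm u'.
    by rewrite (le_trans (le k u'))// ler_wpM2r ?nm_ge0// ltW.
  rewrite (le_trans (nmD _ _))// mulrDr; apply: lerD; first exact: h.
  rewrite nmN (le_trans (nmD _ _))// mulrDr; apply: lerD; last exact: h.
  by rewrite nmZ mulrCA ler_wpM2l.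
have [c c0 hc] := bop_bound (by_ 0); exists (eta 0 + c); split.
  by rewrite addr_ge0// ltW.
move=> u; have := le 0 u; have := nm_sub (l u) (y 0 u); have := hc u.
by rewrite mulrDl; lra.
Qed.

Lemma near_sa y : bounded_op y ->
  (forall e, 0 < e -> exists x, [/\ bounded_op x, selfadjoint x &
     forall u, nm (y u - x u) <= e * nm u]) -> selfadjoint y.
Proof.
move=> by_ h; apply: rdot_adjoint => // u v; apply/eqP.
rewrite -subr_eq0 -normr_le0; apply: (@ler_addgt0Ml _ _ _ (2 * nm u * nm v)) => e e0 _.
have [x [bx sx hx]] := h e e0.
have -> : rdot (y u) v - rdot u (y v) = rdot (y u - x u) v - rdot u (y v - x v).
  by rewrite rdotBl rdotBr (sa_rdot bx sx u v); ring.
have l1 := rdot_le (y u - x u) v; have l2 := rdot_le (- (y u - x u)) v.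
have l3 := rdot_le u (y v - x v); have l4 := rdot_le (- u) (y v - x v).
rewrite !rdotNl !nmN in l2 l4; have := nm_ge0 u; have := nm_ge0 v.
have := hx u; have := hx v; rewrite ler_norml; nra.
Qed.

(** Norm closedness in the form in which an expectation onto the range of an embedding provides it,
    and which suffices for square roots. *)
Definition sa_closed G := forall y, bounded_op y ->
  (forall e, 0 < e -> exists x, [/\ G x, selfadjoint x &
     forall u, nm (y u - x u) <= e * nm u]) -> G y.

(* [1 - sqrt t] is the fixed point of [y |-> ((1 - t) + y^2) / 2]. *)
Lemma op_sqrt G t (d : R) : star_alg G -> sa_closed G -> G t -> selfadjoint t ->
  0 < d -> d <= 1 ->
  (forall u, d * rdot u u <= rdot (t u) u) -> (forall u, rdot (t u) u <= rdot u u) ->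
  exists x, [/\ G x, selfadjoint x & x \o x = t].
Proof.
move=> sG cG Gt st d0 d1 td t1; have Gb := sa_bop sG; have Gcs := sa_sub sG.
pose z := idfun - t; have Gz : G z by apply: (csubB Gcs (sa_id sG) Gt).
have bz := Gb _ Gz; have sz : selfadjoint z by apply: saB => //; exact: is_adjoint_id.
have zE u : rdot (z u) u = rdot u u - rdot (t u) u by rewrite /z opDE opNE rdotDl rdotNl.
have z0 : op_ge0 z by apply: op_ge0P => // u; rewrite zE subr_ge0.
have zb u : nm (z u) <= (1 - d) * nm u.
  apply: op_ge0_nm => // [|v]; first by rewrite subr_ge0.
  by rewrite zE; have := td v; lra.
(* Since [((1 - d) + r ^+ 2) / 2 <= r], the iteration maps the ball of radius [r] into itself, and
   it contracts there with factor [r]. *)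
pose r := 1 - d / 2; have r0 : 0 <= r by rewrite /r; lra.
have r1 : r < 1 by rewrite /r; lra.
pose y := fix y k := if k is k'.+1 then (2^-1)%:C%C *: (z + (y k' \o y k')) else 0 : H -> H.
have half0 : 0 <= (2^-1 : R) by rewrite invr_ge0.
have nhalf u : nm ((2^-1)%:C%C *: u) = 2^-1 * nm u.
  by rewrite nmZ /= expr0n addr0 sqrtr_sqr ger0_norm.
have yk k : [/\ G (y k), selfadjoint (y k) & forall u, nm (y k u) <= r * nm u].
  elim: k => [|k [Gy sy yb]] /=.
    split; [exact: Gcs.1|exact: is_adjoint0|].
    by move=> u; rewrite op0E nm0 mulr_ge0 ?nm_ge0.
  split.
  - by apply: (csubZ _ Gcs); apply: (csubD Gcs Gz); exact: (sa_comp sG).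
  - by apply/saZ/saD => //; exact: is_adjoint_comp.
  move=> u; rewrite opZE opDE nhalf /=.
  have := nmD (z u) (y k (y k u)); have := zb u; have := yb (y k u); have := yb u.
  have := nm_ge0 u; have := nm_ge0 (y k u); rewrite /r; nra.
have Gy k : G (y k) by have [] := yk k.
have byk k : bounded_op (y k) := Gb _ (Gy k).
have yb k u : nm (y k u) <= r * nm u by have [_ _] := yk k; apply.
have diff k u : nm (y k.+1 u - y k u) <= r ^+ k * nm u.
  elim: k u => [|k IH] u.
    rewrite /= opZE opDE op0E subr0 nhalf /= op0E addr0 expr0 mul1r.
    by have := zb u; have := nm_ge0 u; nra.
  have -> : y k.+2 u - y k.+1 u = (2^-1)%:C%C *:
      (y k.+1 (y k.+1 u - y k u) + (y k.+1 (y k u) - y k (y k u))).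
    rewrite (bopB (byk _)) addrA subrK -[y k.+2 u]/((2^-1)%:C%C *: (z u + y k.+1 (y k.+1 u))).
    rewrite -[X in _ - X = _]/((2^-1)%:C%C *: (z u + y k (y k u))) -scalerBr.
    by rewrite opprD addrACA subrr add0r.
  rewrite nhalf; apply: (@le_trans _ _ (2^-1 * (r * (r ^+ k * nm u) + r ^+ k * (r * nm u)))).
    rewrite ler_wpM2l// (le_trans (nmD _ _))// lerD//.
      by rewrite (le_trans (yb _ _))// ler_wpM2l.
    by rewrite (le_trans (IH _))// ler_wpM2l// exprn_ge0.
  rewrite exprS; lra.
pose tau := (1 - r)^-1; have tau0 : 0 < tau by rewrite invr_gt0 subr_gt0.
have tauE : 1 + r * tau = tau.
  by rewrite /tau; field; rewrite gt_eqF// subr_gt0.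
have tail k n u : nm (y (k + n)%N u - y k u) <= r ^+ k * tau * nm u.
  elim: n k => [|n IH] k.
    by rewrite addn0 subrr nm0 !mulr_ge0 ?nm_ge0// ?exprn_ge0// ltW.
  have -> : y (k + n.+1)%N u - y k u = (y (k.+1 + n)%N u - y k.+1 u) + (y k.+1 u - y k u).
    by rewrite addrA subrK addnS.
  rewrite (le_trans (nmD _ _))// -tauE mulrDr mulr1 mulrDl addrC lerD//.
  by rewrite mulrA -exprSr.
have [||||l bl hl] := @norm_limit y (fun k => r ^+ k * tau) => //.
- by move=> k; rewrite mulr_ge0 ?exprn_ge0// ltW.
- move=> e e0; have [k hk] := expr_small r0 r1 (divr_gt0 e0 tau0).
  by exists k; rewrite -ltr_pdivlMr.
have appr e : 0 < e -> exists k, forall u, nm (l u - y k u) <= e * nm u.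
  move=> e0; have [k hk] := expr_small r0 r1 (divr_gt0 e0 tau0).
  exists k => u; rewrite (le_trans (hl k u))// ler_wpM2r ?nm_ge0//.
  by rewrite -ler_pdivlMr// ltW.
have Gl : G l.
  apply: cG => // e /appr[k hk]; exists (y k); split=> //.
  by have [] := yk k.
have sl : selfadjoint l.
  apply: (near_sa bl) => e /appr[k hk]; exists (y k); split=> //.
  by have [] := yk k.
have lE u : l u = (2^-1)%:C%C *: (z u + l (l u)).
  apply/eqP; rewrite -subr_eq0; apply/eqP/nm_eq0/eqP; rewrite eq_le nm_ge0 andbT.
  pose K := r * tau * nm u + 2^-1 * (r * (tau * nm u) + tau * nm (l u)).
  apply: (@ler_addgt0Ml _ _ _ K) => e e0 _; rewrite add0r.
  have [k hk] := expr_small r0 r1 e0.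
  have rk0 : 0 <= r ^+ k by exact: exprn_ge0.
  have -> : l u - (2^-1)%:C%C *: (z u + l (l u)) = (l u - y k.+1 u) +
      (2^-1)%:C%C *: (y k (y k u - l u) - (l (l u) - y k (l u))).
    rewrite (bopB (byk _)) opprB addrA subrK.
    rewrite -[y k.+1 u]/((2^-1)%:C%C *: (z u + y k (y k u))).
    rewrite -[RHS]addrA; congr (_ + _); rewrite -!scalerN -scalerDr; congr (_ *: _).
    by rewrite addrA [in RHS]opprD subrK opprD.
  rewrite (le_trans (nmD _ _))// nhalf.
  have h1 := hl k.+1 u; have h2 := hl k u; have h3 := hl k (l u).
  have h4 := yb k (y k u - l u); rewrite (nmB (y k u)) in h4.
  have h5 := nmD (y k (y k u - l u)) (- (l (l u) - y k (l u))); rewrite nmN in h5.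
  rewrite exprS in h1.
  have n1 := nm_ge0 u; have n2 := nm_ge0 (l u).
  have m1 : 0 <= tau * nm u by rewrite mulr_ge0// ltW.
  have m2 : 0 <= tau * nm (l u) by rewrite mulr_ge0// ltW.
  have m3 : 0 <= r * (tau * nm u) by rewrite mulr_ge0.
  have q1 : r ^+ k * (tau * nm u) <= e * (tau * nm u) by rewrite ler_wpM2r// ltW.
  have q2 : r ^+ k * (tau * nm (l u)) <= e * (tau * nm (l u)) by rewrite ler_wpM2r// ltW.
  have q3 : r ^+ k * (r * (tau * nm u)) <= e * (r * (tau * nm u)) by rewrite ler_wpM2r// ltW.
  have h4' : r * nm (l u - y k u) <= r * (r ^+ k * tau * nm u) by rewrite ler_wpM2l.
  rewrite /K; nra.
exists (idfun - l); split.
- exact: (csubB Gcs (sa_id sG) Gl).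
- by apply: saB => //; exact: is_adjoint_id.
apply/funext => u /=; rewrite !(opDE, opNE) /=.
have h2 : l u + l u = z u + l (l u).
  have e2 : (2^-1)%:C%C + (2^-1)%:C%C = 1 :> C.
    rewrite -rmorphD/=; have -> : (2^-1 + 2^-1 : R) = 1 by field.
    by rewrite rmorph1.
  by rewrite {1 2}lE -scalerDl e2 scale1r.
rewrite (bopB bl) opprB.
have -> : u - l u + (l (l u) - l u) = u + l (l u) - (l u + l u).
  by rewrite opprD addrACA.
by rewrite h2 /z opDE opNE /= opprD opprB addrACA subrr addr0 addrC subrK.
Qed.

End norm_limit.

(** * Embeddings reflect positivity *)

Section order_reflection.
Variables (R : realType) (H K : hilbertType R).
Variables (A : set (H -> H)) (B : set (K -> K)) (g : (H -> H) -> (K -> K)).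
Variable E : (K -> K) -> (K -> K).
Hypotheses (vA : von_neumann A) (vB : von_neumann B).
Hypotheses (hg : star_morphism A B g) (gi : set_inj A g) (g1 : g idfun = idfun).
Hypothesis hE : cond_exp B (g @` A) E.

Let sA : star_alg A := vN_star_alg vA.
Let sB : star_alg B := vN_star_alg vB.

Lemma image_star_alg : star_alg (g @` A).
Proof.
have [gin glin gmul gadj] := hg; split.
- by move=> _ [x Ax <-]; apply: (sa_bop sB); exact: gin.
- split=> [|a _ _ [x Ax <-] [y Ay <-]].
    exists 0; first exact: (sa_sub sA).1.
    have := glin (-1) 0 0 (sa_sub sA).1 (sa_sub sA).1.
    by rewrite scaler0 addr0 scaleN1r addNr.
  by exists (a *: x + y); [exact: (sa_sub sA).2|exact: glin].
- by exists idfun => //; exact: sa_id.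
- by move=> _ _ [x Ax <-] [y Ay <-]; exists (x \o y); [exact: (sa_comp sA)|exact: gmul].
- by move=> _ [x Ax <-]; exists (adj x); [exact: (sa_adj sA)|exact: gadj].
Qed.

Lemma cond_expB x y : B x -> B y -> E (x - y) = E x - E y.
Proof.
move=> Bx By; have := cond_exp_linear hE (-1) By Bx.
by rewrite !scaleN1r addrC => ->; rewrite addrC.
Qed.

(** If [w] lies between [- e] and [e], so does [E w]. Hence [E] is norm continuous on selfadjoint
    elements and fixes the limits of elements that it fixes. *)
Lemma image_sa_closed : sa_closed (g @` A).
Proof.
move=> y by_ hy; have Bcs := sa_sub sB; have Bb := sa_bop sB.
have gB x : (g @` A) x -> B x := cond_exp_sub hE (t := x).
have By : B y.
  apply/vN_mem => //; split=> // t [bt ht]; apply/funext => u /=.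
  apply/eqP; rewrite -subr_eq0; apply/eqP/nm_eq0/eqP; rewrite eq_le nm_ge0 andbT.
  have [c c0 hc] := bop_bound bt.
  apply: (@ler_addgt0Ml _ _ _ (nm (t u) + c * nm u)) => e e0 _; rewrite add0r.
  have [x [/gB Bx _ hx]] := hy e e0.
  have -> : y (t u) - t (y u) = (y (t u) - x (t u)) - t (y u - x u).
    have := congr1 (fun f : K -> K => f u) (ht _ Bx) => /= e1.
    by rewrite (bopB bt) opprB addrA e1 subrK.
  rewrite (le_trans (nmD _ _))// mulrDr lerD// nmN (le_trans (hc _))//.
  by rewrite mulrCA ler_pM2l.
have sy : selfadjoint y.
  apply: (near_sa by_) => e /hy[x [/gB Bx sx hx]]; exists x; split=> //; exact: Bb.
suff Ey : E y = y by rewrite -Ey; exact: (cond_exp_into hE By).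
apply/funext => u; apply/eqP; rewrite -subr_eq0; apply/eqP/nm_eq0/eqP.
rewrite eq_le nm_ge0 andbT.
apply: (@ler_addgt0Ml _ _ _ (4 * nm u)) => e e0 _; rewrite add0r.
have [x [gx sx hx]] := hy e e0; have Bx := gB _ gx.
pose w := y - x; have Bw : B w by exact: csubB.
have sw : selfadjoint w by exact: saB.
have wle v : `|rdot (w v) v| <= e * rdot v v.
  have := hx v; have l1 := rdot_le (w v) v; have l2 := rdot_le (- w v) v.
  rewrite rdotNl nmN in l2; rewrite -sqr_nm ler_norml.
  have := nm_ge0 v; rewrite -[y v - x v]/(w v); nra.
pose eI := (e%:C)%C *: @idfun K; have BI : B idfun := sa_id sB.
have BeI : B eI by exact: csubZ.
have EeI : E eI = eI.
  apply: (cond_exp_id hE); apply: (csubZ _ (sa_sub image_star_alg)).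
  exact: (sa_id image_star_alg).
have seI : selfadjoint eI by exact/saZ/is_adjoint_id.
have eIE v : rdot (eI v) v = e * rdot v v by rewrite /eI opZE rdotZl.
have BEw : B (E w) by apply: gB; exact: (cond_exp_into hE Bw).
have Bp : B (w + eI) by exact: csubD.
have Bq : B (eI - w) by exact: csubB.
have p0 : op_ge0 (w + eI).
  apply: op_ge0P; [exact: Bb|exact: saD|move=> v].
  rewrite opDE rdotDl eIE; have := wle v; rewrite ler_norml; lra.
have q0 : op_ge0 (eI - w).
  apply: op_ge0P; [exact: Bb|exact: saB|move=> v].
  rewrite opDE opNE rdotDl rdotNl eIE; have := wle v; rewrite ler_norml; lra.
have EDw : E (w + eI) = E w + eI.
  by have := cond_exp_linear hE 1 Bw BeI; rewrite !scale1r EeI.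
have Ep : op_ge0 (E w + eI) by rewrite -EDw; exact: (cond_exp_ge0 hE Bp p0).
have Eq : op_ge0 (eI - E w) by rewrite -{1}EeI -cond_expB//; exact: (cond_exp_ge0 hE Bq q0).
(* [E w + e] lies between [0] and [2 e], and subtracting [e] costs one more [e]. *)
have nEw v : nm (E w v) <= 3 * e * nm v.
  have BEp : B (E w + eI) by exact: csubD.
  have h : nm ((E w + eI) v) <= 2 * e * nm v.
    apply: op_ge0_nm => //; [exact: Bb|lra|move=> v'].
    rewrite opDE rdotDl eIE.
    have := op_ge0_rdot Eq v'; rewrite opDE opNE rdotDl rdotNl eIE; lra.
  have e1 : E w v = (E w + eI) v - eI v by rewrite opDE addrK.
  have e2 : nm (eI v) = e * nm v.
    by rewrite /eI opZE nmZ /= expr0n addr0 sqrtr_sqr ger0_norm// ltW.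
  have := nmD ((E w + eI) v) (- eI v); rewrite -e1 nmN e2; lra.
have e3 : E y u - y u = E w u - (y u - x u).
  rewrite /w cond_expB// (cond_exp_id hE gx) opDE opNE.
  by rewrite opprB addrA subrK.
rewrite e3; have := nmD (E w u) (- (y u - x u)); rewrite nmN.
have := hx u; have := nEw u; lra.
Qed.

(** Scaled by [k], the image of [a + e] lies between [e / k] and [1], so it has a square root in the
    range. By injectivity the square exists already in [A] and exhibits [a + e] as positive. *)
Theorem order_reflect a : A a -> op_ge0 (g a) -> op_ge0 a.
Proof.
move=> Aa ga; have [gin glin gmul gadj] := hg.
have Bb := sa_bop sB; have Acs := sa_sub sA; have Ab := sa_bop sA.
have bga := Bb _ (gin _ Aa); have [c c0 hc] := bop_bound bga.
suff pos (e : R) : 0 < e -> e <= 1 -> op_ge0 (a + (e%:C)%C *: idfun).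
  have ba := Ab _ Aa; have h u e : 0 < e -> e <= 1 ->
      complex.Im (hdot (a u) u) = 0 /\ 0 <= rdot (a u) u + e * rdot u u.
    move=> e0 e1; have := pos e e0 e1 u.
    rewrite opDE opZE hdotDl hdotZl hdot_uu -rmorphM /rdot /=.
    by case: (hdot (a u) u) => p q; rewrite lecE /= addr0 => /andP[/eqP -> h].
  move=> u; have [im _] := h u 1 ltr01 (lexx _).
  rewrite lecE im eqxx /=; apply: (@ler_addgt0Ml _ _ _ (rdot u u)) => e e0 e1.
  by have [_] := h u e e0 e1.
move=> e0 e1; pose k := c + 1; have k0 : 0 < k by rewrite addr_gt0.
pose s := (k^-1)%:C%C *: (a + (e%:C)%C *: idfun) : H -> H.
have AI : A ((e%:C)%C *: idfun) by apply: csubZ => //; exact: sa_id.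
have Aae : A (a + (e%:C)%C *: idfun) by exact: csubD.
have As : A s by exact: csubZ.
have gD x y : A x -> A y -> g (x + y) = g x + g y.
  by move=> Ax Ay; have := glin 1 x y Ax Ay; rewrite !scale1r.
have g0 : g 0 = 0.
  by have := glin (-1) 0 0 Acs.1 Acs.1; rewrite scaler0 addr0 scaleN1r addNr.
have gZ (b : R[i]) x : A x -> g (b *: x) = b *: g x.
  by move=> Ax; have := glin b x 0 Ax Acs.1; rewrite !addr0 g0 addr0.
have gs : g s = (k^-1)%:C%C *: (g a + (e%:C)%C *: idfun).
  by rewrite gZ// gD// gZ ?g1//; exact: sa_id.
have gsE u : rdot (g s u) u = k^-1 * (rdot (g a u) u + e * rdot u u).
  by rewrite gs opZE opDE opZE rdotZl rdotDl rdotZl.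
have [|||||x [[m Am gm] sx xx]] := @op_sqrt R K (g @` A) (g s) (e / k)
    image_star_alg image_sa_closed (ex_intro2 _ _ s As erefl).
- rewrite gs; apply/saZ/saD; first exact: op_ge0_sa.
  exact/saZ/is_adjoint_id.
- by rewrite divr_gt0.
- by rewrite ler_pdivrMr// mul1r /k; lra.
- move=> u; rewrite gsE mulrAC mulrC ler_pM2l ?invr_gt0// lerDr.
  exact: op_ge0_rdot.
- move=> u; rewrite gsE ler_pdivrMl// /k mulrDl mul1r lerD//.
    by apply: nm_rdot => //; exact: ltW.
  by rewrite -[leRHS]mul1r ler_wpM2r ?rdot_ge0.
have bm := Ab _ Am; have Ama := sa_adj sA Am.
have am : adj m = m.
  apply: gi; [exact/mem_set|exact/mem_set|].
  by rewrite gadj// gm; exact: adjE.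
have sE : s = adj m \o m.
  apply: gi; [exact/mem_set|apply/mem_set; exact: (sa_comp sA)|].
  by rewrite gmul// am gm xx.
have -> : a + (e%:C)%C *: idfun = (k%:C)%C *: s :> (H -> H).
  rewrite /s scalerA -rmorphM/= divff ?gt_eqF// rmorph1 scale1r//.
move=> u; rewrite opZE hdotZl mulr_ge0 ?ler0c ?(ltW k0)// sE.
exact: op_ge0_adjM.
Qed.

End order_reflection.

Section morphisms.
Variables (R : realType) (H K : hilbertType R).
Variables (A : set (H -> H)) (B : set (K -> K)) (f : (H -> H) -> (K -> K)).
Hypothesis Acs : csub A.
Hypothesis flin : linear_on A f.

Lemma lin_on0 : f 0 = 0.
Proof. by have := flin (-1) Acs.1 Acs.1; rewrite scaler0 addr0 scaleN1r addNr. Qed.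

Lemma lin_onD x y : A x -> A y -> f (x + y) = f x + f y.
Proof. by move=> Ax Ay; have := flin 1 Ax Ay; rewrite !scale1r. Qed.

Lemma lin_onZ a x : A x -> f (a *: x) = a *: f x.
Proof. by move=> Ax; have := flin a Ax Acs.1; rewrite lin_on0 !addr0. Qed.

Lemma lin_onB x y : A x -> A y -> f (x - y) = f x - f y.
Proof. by move=> Ax Ay; have := flin (-1) Ay Ax; rewrite !scaleN1r ![- _ + _]addrC. Qed.

Lemma linear_pos_le x y : (forall z, A z -> op_ge0 z -> op_ge0 (f z)) ->
  A x -> A y -> op_le x y -> op_le (f x) (f y).
Proof.
by move=> fp Ax Ay xy; rewrite /op_le -lin_onB//; apply: fp => //; exact: csubB.
Qed.

(* Positivity of [f x] is the normality of [f] on the directed set {0, x}. *)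
Lemma normal_map_ge0 x : A `<=` @bounded_op R H -> normal_map A B f ->
  A x -> op_ge0 x -> op_ge0 (f x).
Proof.
move=> Ab fn Ax x0; pose S := [set y : H -> H | y = 0 \/ y = x].
have x0' : op_le 0 x by rewrite /op_le subr0.
have h : is_sup A S x.
  split=> // [y [->|->]//|t At ht]; first exact: op_le_refl.
  by apply: ht; right.
have [||||_ ub _] := fn S x _ _ _ _ h.
- by exists 0; left.
- by move=> y [->|->]//; exact: Acs.1.
- move=> y [->|->]; first exact: is_adjoint0.
  exact: (op_ge0_sa (Ab _ Ax)).
- move=> y z Sy Sz; exists x; split; first by right.
    by case: Sy => ->//; exact: op_le_refl.
  by case: Sz => ->//; exact: op_le_refl.
have := ub (f 0) (ex_intro2 _ _ 0 (or_introl erefl) erefl).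
by rewrite lin_on0 /op_le subr0.
Qed.

End morphisms.

(** * Normal positive maps *)

Section np_maps.
Variable R : realType.

Record npmap (H K : hilbertType R) (A : set (H -> H)) (B : set (K -> K))
    (f : (H -> H) -> (K -> K)) : Prop := {
  nm_into : forall x, A x -> B (f x) ;
  nm_lin : linear_on A f ;
  nm_pos : forall x, A x -> op_ge0 x -> op_ge0 (f x) ;
  nm_normal : normal_map A B f }.

Section positive_maps.
Variables (H K : hilbertType R) (A : set (H -> H)) (B : set (K -> K)).
Variable f : (H -> H) -> (K -> K).
Hypotheses (sA : star_alg A) (Bb : B `<=` @bounded_op R K).
Hypotheses (fB : forall x, A x -> B (f x)) (flin : linear_on A f)
  (fpos : forall x, A x -> op_ge0 x -> op_ge0 (f x)).

(** [x + c] is positive for a bound [c] of [x], so [f x] is a difference of positive operators. *)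
Lemma pos_sa x : A x -> selfadjoint x -> selfadjoint (f x).
Proof.
move=> Ax sx; have Ab := sa_bop sA; have Acs := sa_sub sA.
have [c c0 hc] := bop_bound (Ab _ Ax).
have AI : A ((c%:C)%C *: idfun) by apply: csubZ => //; exact: sa_id.
have I0 : op_ge0 ((c%:C)%C *: @idfun H).
  by move=> u; rewrite opZE hdotZl hdot_uu mulr_ge0 ?ler0c ?rdot_ge0// ltW.
have Ay : A (x + (c%:C)%C *: idfun) by exact: csubD.
have y0 : op_ge0 (x + (c%:C)%C *: idfun).
  apply: op_ge0P; [exact: Ab|by apply: saD => //; exact/saZ/is_adjoint_id|move=> u].
  rewrite opDE opZE rdotDl rdotZl; have h := @nm_rdot R H (- x u) u c (ltW c0).
  by rewrite nmN rdotNl in h; have := h (hc u); rewrite /=; lra.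
have -> : f x = f (x + (c%:C)%C *: idfun) - f ((c%:C)%C *: idfun).
  by rewrite (lin_onD flin)// addrK.
by apply: saB; apply: op_ge0_sa; try exact/Bb/fB; exact: fpos.
Qed.

Lemma pos_adj x : A x -> f (adj x) = adj (f x).
Proof.
move=> Ax; have Ab := sa_bop sA; have Acs := sa_sub sA; have bx := Ab _ Ax.
have Axa := sa_adj sA Ax; have bxa := Ab _ Axa.
(* Twice the real and twice the imaginary part of [x]. *)
pose a := x + adj x; pose b := 'i%C *: (adj x - x).
have Aa : A a by exact: csubD.
have Ab' : A b by apply: csubZ => //; exact: csubB.
have sa : selfadjoint a.
  by apply/selfadjointE; [exact: Ab|rewrite /a adjD// adjK// addrC].
have iJ : ('i%C : R[i])^* = - 'i%C by rewrite /=; apply/eqP; rewrite eq_complex/= oppr0 !eqxx.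
have sb : selfadjoint b.
  apply/selfadjointE; first exact: Ab.
  rewrite /b adjZ; last by apply: csubB => //; exact: csub_bop.
  by rewrite adjB// adjK// iJ scaleNr -scalerN opprB.
have two : (2 : R[i]) != 0 by rewrite pnatr_eq0.
have ii : 'i%C * 'i%C = -1 :> R[i] by rewrite -expr2 sqr_i.
have half2 (z : H -> H) : 2^-1 *: (z + z) = z.
  by rewrite -mulr2n -(scaler_nat 2 z) scalerA mulVf// scale1r.
have e1 : x = 2^-1 *: (a + 'i%C *: b).
  rewrite /a /b scalerA ii scaleN1r opprB addrACA subrr addr0.
  by rewrite half2.
have e2 : adj x = 2^-1 *: (a + (- 'i%C) *: b).
  rewrite /a /b scalerA mulNr ii opprK scale1r [x + _]addrC addrACA subrr addr0.
  by rewrite half2.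
have fa := pos_sa Aa sa; have fb := pos_sa Ab' sb.
have bfa := Bb (fB Aa); have bfb := Bb (fB Ab').
have h : bounded_op ('i%C *: f b) by exact: (csubZ _ (csub_bop K)).
have h2 : bounded_op (f a + 'i%C *: f b) by exact: (csubD (csub_bop K)).
have fE c : f (2^-1 *: (a + c *: b)) = 2^-1 *: (f a + c *: f b).
  have Acb := csubZ c Acs Ab'.
  rewrite (lin_onZ Acs flin); last exact: (csubD Acs Aa Acb).
  by rewrite (lin_onD flin)// (lin_onZ Acs flin).
rewrite e2 fE {1}e1 fE adjZ// adjD// adjZ//.
rewrite (_ : adj (f a) = f a); last exact: adjE.
rewrite (_ : adj (f b) = f b); last exact: adjE.
have -> : ((2^-1 : R[i])^*) = 2^-1 by rewrite fmorphV rmorph_nat.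
by rewrite iJ.
Qed.

End positive_maps.

Lemma npmap_comp (H K L : hilbertType R) (A : set (H -> H)) (B : set (K -> K))
    (D : set (L -> L)) f g : star_alg A -> B `<=` @bounded_op R K -> csub B ->
  npmap A B f -> npmap B D g -> npmap A D (g \o f).
Proof.
move=> sA Bb Bcs hf hg; have Acs := sa_sub sA; split.
- by move=> x Ax; apply: (nm_into hg); exact: (nm_into hf).
- by move=> a x y Ax Ay /=; rewrite (nm_lin hf)// (nm_lin hg)//; exact: (nm_into hf).
- by move=> x Ax x0 /=; apply: (nm_pos hg); [exact: (nm_into hf)|exact: (nm_pos hf)].
move=> S x S0 SA Ssa dS hS; rewrite -image_comp; apply: (nm_normal hg).
- by have [y Sy] := S0; exists (f y), y.
- by move=> _ [y /SA Ay <-]; exact: (nm_into hf).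
- move=> _ [y Sy <-]; apply: (pos_sa sA Bb (nm_into hf) (nm_lin hf) (nm_pos hf)).
    exact: SA.
  exact: Ssa.
- move=> _ _ [y Sy <-] [z Sz <-]; have [w [Sw yw zw]] := dS _ _ Sy Sz.
  exists (f w); split; first by exists w.
    by apply: (linear_pos_le Acs (nm_lin hf) (nm_pos hf)) => //; exact: SA.
  by apply: (linear_pos_le Acs (nm_lin hf) (nm_pos hf)) => //; exact: SA.
exact: (nm_normal hf).
Qed.

Lemma npmap_vector (H K : hilbertType R) (A : set (H -> H)) (B : set (K -> K)) f zeta :
  von_neumann A -> von_neumann B -> npmap A B f ->
  normal_pos A (fun x => rdot (f x zeta) zeta).
Proof.
move=> vA vB hf; have sA := vN_star_alg vA; have sB := vN_star_alg vB.
have Bb := sa_bop sB; have Acs := sa_sub sA.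
have fB := nm_into hf.
split.
- by move=> r x y Ax Ay; rewrite (nm_lin hf)// opDE opZE rdotDl rdotZl.
- move=> x Ax; rewrite (pos_adj sA Bb fB (nm_lin hf) (nm_pos hf))//.
  by rewrite (rdot_adj (adjointC (adjP (Bb _ (fB _ Ax))))) rdotC.
- by move=> x Ax x0; exact/op_ge0_rdot/(nm_pos hf).
move=> S x S0 SA Ssa dS hS y0 e Sy0 e0.
have mono y z : S y -> S z -> op_le y z -> op_le (f y) (f z).
  by move=> Sy Sz; apply: (linear_pos_le Acs (nm_lin hf) (nm_pos hf)); exact: SA.
have T0 : f @` S !=set0 by exists (f y0), y0.
have TB : f @` S `<=` B by move=> _ [y /SA Ay <-]; exact: fB.
have Tsa y : (f @` S) y -> selfadjoint y.
  move=> [z Sz <-]; apply: (pos_sa sA Bb fB (nm_lin hf) (nm_pos hf)); first exact: SA.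
  exact: Ssa.
have dT : directed (f @` S).
  move=> _ _ [y Sy <-] [z Sz <-]; have [w [Sw yw zw]] := dS _ _ Sy Sz.
  by exists (f w); split; [exists w|exact: mono|exact: mono].
have h := is_sup_slim vB T0 TB Tsa dT (nm_normal hf S0 SA Ssa dS hS).
have [_ [[y1 Sy1 <-] _ hy1]] := slim_rdot dT h (ex_intro2 _ _ y0 Sy0 erefl) zeta zeta e0.
have [y [Sy y0y y1y]] := dS _ _ Sy0 Sy1; exists y; split=> //.
have := op_le_rdot zeta (mono _ _ Sy1 Sy y1y).
by move: hy1; rewrite ltr_norml; lra.
Qed.

(* Two normal positive maps that agree on a dense *-subalgebra agree: apply the
   density theorem to the sum of the vector functionals of both maps. *)
Theorem npmap_eq (H K : hilbertType R) (A Ah : set (H -> H)) (B : set (K -> K)) f g :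
  von_neumann A -> von_neumann B -> star_alg Ah -> Ah `<=` A ->
  commutant Ah `<=` commutant A -> npmap A B f -> npmap A B g ->
  (forall a, Ah a -> f a = g a) -> forall x, A x -> f x = g x.
Proof.
move=> vA vB sAh AhA Ahd hf hg fg; have sA := vN_star_alg vA.
have sB := vN_star_alg vB; have Acs := sa_sub sA; have Bcs := sa_sub sB.
have re x zeta : A x -> rdot (f x zeta) zeta = rdot (g x zeta) zeta.
  move=> Ax; pose f1 y := rdot (f y zeta) zeta; pose g1 y := rdot (g y zeta) zeta.
  have n1 : normal_pos A f1 := npmap_vector zeta vA vB hf.
  have n2 : normal_pos A g1 := npmap_vector zeta vA vB hg.
  have n12 : normal_pos A (fun y => f1 y + g1 y).
    split.
    - by move=> r y z Ay Az; rewrite (np_lin n1)// (np_lin n2)//; ring.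
    - by move=> y Ay; rewrite (np_adj n1)// (np_adj n2).
    - by move=> y Ay y0; rewrite addr_ge0// ?(np_ge0 n1)// (np_ge0 n2).
    move=> S y S0 SA Ssa dS hS y0 e Sy0 e0; have e2 : 0 < e / 2 by rewrite divr_gt0.
    have [z1 [Sz1 l1 h1]] := np_normal n1 S0 SA Ssa dS hS Sy0 e2.
    have [z2 [Sz2 l2 h2]] := np_normal n2 S0 SA Ssa dS hS Sz1 e2.
    exists z2; split=> //; first exact: (op_le_trans l1 l2).
    have := np_le vA n1 (SA _ Sz1) (SA _ Sz2) l2; lra.
  have AI : A idfun := sa_id sA.
  have gI (h : (H -> H) -> R) (nh : normal_pos A h) y : A y ->
      h y ^+ 2 <= gdot h y y * h idfun.
    by move=> Ay; have := sip_CS (gdot_sip vA nh) Ay AI; rewrite /gdot adj_id.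
  have p1 : 0 <= f1 idfun.
    by apply: (np_ge0 n1 AI) => u; rewrite hdot_uu ler0c rdot_ge0.
  have p2 : 0 <= g1 idfun.
    by apply: (np_ge0 n2 AI) => u; rewrite hdot_uu ler0c rdot_ge0.
  apply/eqP; rewrite -subr_eq0 -normr_le0.
  apply: (@ler_addgt0Ml _ _ _ (f1 idfun + g1 idfun + 2)) => e e0 e1; rewrite add0r.
  have [a ha hxa] := dense_subalgebra vA n12 sAh AhA Ahd Ax (exprn_gt0 2 e0).
  have Aa := AhA _ ha; have Axa : A (x - a) by exact: csubB.
  have q1 := sip_ge0 (gdot_sip vA n1) Axa; have q2 := sip_ge0 (gdot_sip vA n2) Axa.
  have s12 : gdot f1 (x - a) (x - a) + gdot g1 (x - a) (x - a) < e ^+ 2 by [].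
  have bnd (h : (H -> H) -> R) (nh : normal_pos A h) : 0 <= h idfun ->
      gdot h (x - a) (x - a) <= e ^+ 2 -> `|h (x - a)| <= e * (h idfun + 1).
    move=> h0 hle; rewrite -(@ler_pXn2r _ 2)// ?nnegrE ?mulr_ge0 ?addr_ge0 ?(ltW e0)//.
    rewrite real_normK ?num_real//; apply: le_trans (gI h nh _ Axa) _.
    rewrite exprMn; apply: le_trans (ler_wpM2r h0 hle) _.
    by rewrite ler_wpM2l ?exprn_ge0 ?(ltW e0)//; nra.
  have b1 := bnd f1 n1 p1; have b2 := bnd g1 n2 p2.
  have -> : rdot (f x zeta) zeta - rdot (g x zeta) zeta = f1 (x - a) - g1 (x - a).
    by rewrite (npB vA n1)// (npB vA n2)// /f1 /g1 (fg a ha); ring.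
  have {}b1 : `|f1 (x - a)| <= e * (f1 idfun + 1) by apply: b1; lra.
  have {}b2 : `|g1 (x - a)| <= e * (g1 idfun + 1) by apply: b2; lra.
  by apply: le_trans (ler_normB _ _) _; lra.
move=> x Ax; have Bf := nm_into hf Ax; have Bg := nm_into hg Ax.
apply/eqP; rewrite -subr_eq0; apply/eqP.
have bfg : bounded_op (f x - g x) by apply: (sa_bop sB); exact: csubB.
(* Agreement of real parts at [x] and at ['i *: x] is agreement of the complex forms, and a bounded
   operator with zero form vanishes. *)
have z0 u : hdot ((f x - g x) u) u = 0.
  have e1 : complex.Re (hdot ((f x - g x) u) u) = 0.
    by rewrite -/(rdot _ _) opDE opNE rdotBl re// subrr.
  have Aix : A ('i%C *: x) by exact: csubZ.
  have e2 : complex.Re ('i%C * hdot ((f x - g x) u) u) = 0.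
    rewrite -hdotZl -/(rdot _ _) opDE opNE scalerBr rdotBl.
    have := re _ u Aix; rewrite (lin_onZ Acs (nm_lin hf))// (lin_onZ Acs (nm_lin hg))//.
    by rewrite !opZE => ->; rewrite subrr.
  move: e1 e2; case: (hdot _ _) => a b /= -> h; apply/eqP; rewrite eq_complex/= eqxx /=.
  by apply/eqP; lra.
by apply: op_ge0_eq0 => // u; rewrite ?opNE ?z0// -scaleN1r hdotZl z0 mulr0.
Qed.

(** Reads an expectation onto the range of [g] inside [A]. Positivity and least upper bounds come
    back along [g], which is an order embedding by [order_reflect]. *)
Lemma npmap_inv (H K : hilbertType R) (A : set (H -> H)) (B : set (K -> K))
    (g : (H -> H) -> (K -> K)) E q :
  von_neumann A -> von_neumann B -> star_morphism A B g -> set_inj A g ->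
  g idfun = idfun -> (forall x, A x -> op_ge0 x -> op_ge0 (g x)) ->
  cond_exp B (g @` A) E -> normal_map B (g @` A) E ->
  (forall x, B x -> A (q x) /\ g (q x) = E x) -> npmap B A q.
Proof.
move=> vA vB hg gi g1 gpos hE En qP; have sA := vN_star_alg vA.
have sB := vN_star_alg vB; have Acs := sa_sub sA; have Bcs := sa_sub sB.
have [gin glin _ _] := hg.
have Aq x : B x -> A (q x) by move=> /qP[].
have gq x : B x -> g (q x) = E x by move=> /qP[].
have refl := order_reflect vA vB hg gi g1 hE.
have le_refl x y : A x -> A y -> op_le (g x) (g y) -> op_le x y.
  move=> Ax Ay; rewrite /op_le -(lin_onB glin)//; apply: refl; exact: csubB.
have qlin : linear_on B q.
  move=> a x y Bx By; have Bxy : B (a *: x + y) by exact: Bcs.2.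
  apply: gi; [exact/mem_set/Aq|by apply/mem_set/Acs.2; exact: Aq|].
  by rewrite gq// glin ?gq//; [exact: (cond_exp_linear hE)|exact: Aq|exact: Aq].
split=> //.
  by move=> x Bx x0; apply: refl; [exact: Aq|rewrite gq//; exact: (cond_exp_ge0 hE)].
move=> S x S0 SB Ssa dS hS; have Bx : B x by have [] := hS.
have [_ ub lb] := En S x S0 SB Ssa dS hS.
split; first exact: Aq.
  move=> _ [y Sy <-]; have By := SB _ Sy; apply: le_refl; [exact: Aq|exact: Aq|].
  by rewrite !gq//; apply: ub; exists y.
move=> t At ht; apply: le_refl => //; first exact: Aq.
rewrite gq//; apply: lb; first by exists t.
move=> _ [y Sy <-]; rewrite -gq; last exact: SB.
apply: (linear_pos_le Acs glin gpos) => //; first exact/Aq/SB.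
by apply: ht; exists y.
Qed.

End np_maps.

(** * Direct sums and compressions to a summand *)

Section dsum.
Variables (R : realType) (H1 H2 : hilbertType R).
Implicit Types (x : H1 -> H1) (y : H2 -> H2) (w : hsum H1 H2).
Local Notation HH := (hsum H1 H2).

Lemma hdot_hsum (w w' : HH) : hdot w w' = hdot w.1 w'.1 + hdot w.2 w'.2.
Proof. by []. Qed.

Lemma rdot_hsum (w w' : HH) : rdot w w' = rdot w.1 w'.1 + rdot w.2 w'.2.
Proof. by rewrite /rdot hdot_hsum ReD. Qed.

Definition inj1 (u : H1) : HH := (u, 0).
Definition inj2 (u : H2) : HH := (0, u).

Definition pr1 (r : HH -> HH) : H1 -> H1 := fun u => (r (inj1 u)).1.
Definition pr2 (r : HH -> HH) : H2 -> H2 := fun u => (r (inj2 u)).2.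

Lemma nm_inj1 u : nm (inj1 u) = nm u.
Proof. by rewrite /nm rdot_hsum /= rdot0l addr0. Qed.

Lemma nm_inj2 u : nm (inj2 u) = nm u.
Proof. by rewrite /nm rdot_hsum /= rdot0l add0r. Qed.

Lemma nm_fst w : nm w.1 <= nm w.
Proof. by rewrite ler_sqrt ?rdot_ge0// rdot_hsum lerDl rdot_ge0. Qed.

Lemma nm_snd w : nm w.2 <= nm w.
Proof. by rewrite ler_sqrt ?rdot_ge0// rdot_hsum lerDr rdot_ge0. Qed.

Lemma nm_hsum_le w : nm w <= nm w.1 + nm w.2.
Proof.
rewrite -(@ler_pXn2r _ 2)// ?nnegrE ?addr_ge0 ?nm_ge0//.
rewrite sqr_nm rdot_hsum -!sqr_nm; have := nm_ge0 w.1; have := nm_ge0 w.2; nra.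
Qed.

Lemma inj1_lin a u v : inj1 (a *: u + v) = a *: inj1 u + inj1 v.
Proof. by congr pair; rewrite /= ?scaler0 ?addr0. Qed.

Lemma inj2_lin a u v : inj2 (a *: u + v) = a *: inj2 u + inj2 v.
Proof. by congr pair; rewrite /= ?scaler0 ?addr0. Qed.

Lemma bop_pr1 r : bounded_op r -> bounded_op (pr1 r).
Proof.
move=> br; apply/bounded_opP; split=> [a u v|].
  by rewrite /pr1 inj1_lin (bop_linear br).
have [c c0 hc] := bop_bound br; exists c; split=> [|u]; first exact: ltW.
by rewrite -(nm_inj1 u) /pr1 (le_trans (nm_fst _)).
Qed.

Lemma bop_pr2 r : bounded_op r -> bounded_op (pr2 r).
Proof.
move=> br; apply/bounded_opP; split=> [a u v|].
  by rewrite /pr2 inj2_lin (bop_linear br).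
have [c c0 hc] := bop_bound br; exists c; split=> [|u]; first exact: ltW.
by rewrite -(nm_inj2 u) /pr2 (le_trans (nm_snd _)).
Qed.

Lemma bop_dsum x y : bounded_op x -> bounded_op y -> bounded_op (dsum_op x y : HH -> HH).
Proof.
move=> bx by_; apply/bounded_opP; split=> [a u v|].
  by congr pair; rewrite /= ?(bop_linear bx) ?(bop_linear by_).
have [c c0 hc] := bop_bound bx; have [d d0 hd] := bop_bound by_.
exists (c + d); split=> [|w]; first by rewrite addr_ge0 ?ltW.
apply: le_trans (nm_hsum_le _) _; rewrite mulrDl lerD//=.
  by rewrite (le_trans (hc _))// ler_pM2l// nm_fst.
by rewrite (le_trans (hd _))// ler_pM2l// nm_snd.
Qed.

Lemma pr1_dsum x y : pr1 (dsum_op x y) = x. Proof. by []. Qed.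
Lemma pr2_dsum x y : pr2 (dsum_op x y) = y. Proof. by []. Qed.

Lemma dsum_lin a x y x' y' :
  dsum_op (a *: x + x') (a *: y + y') = a *: dsum_op x y + dsum_op x' y' :> (HH -> HH).
Proof. by []. Qed.

Lemma dsumD x y x' y' :
  dsum_op (x + x') (y + y') = dsum_op x y + dsum_op x' y' :> (HH -> HH).
Proof. by []. Qed.

Lemma dsumB x y x' y' :
  dsum_op (x - x') (y - y') = dsum_op x y - dsum_op x' y' :> (HH -> HH).
Proof. by []. Qed.

Lemma dsum0 : dsum_op 0 0 = 0 :> (HH -> HH).
Proof. by []. Qed.

Lemma dsum_comp x y x' y' :
  (dsum_op x y : HH -> HH) \o dsum_op x' y' = dsum_op (x \o x') (y \o y').
Proof. by []. Qed.

Lemma dsum_id : dsum_op idfun idfun = idfun :> (HH -> HH).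
Proof. by apply/funext => -[]. Qed.

Lemma adjoint_dsum x y x' y' : is_adjoint x x' -> is_adjoint y y' ->
  is_adjoint (dsum_op x y : HH -> HH) (dsum_op x' y').
Proof. by move=> hx hy u v; rewrite !hdot_hsum /= hx hy. Qed.

Lemma adj_dsum x y : bounded_op x -> bounded_op y ->
  adj (dsum_op x y : HH -> HH) = dsum_op (adj x) (adj y).
Proof. by move=> bx by_; apply/adjE/adjoint_dsum; exact: adjP. Qed.

Lemma dsum_ge0 x y : op_ge0 x -> op_ge0 y -> op_ge0 (dsum_op x y : HH -> HH).
Proof. by move=> x0 y0 u; exact: (addr_ge0 (x0 u.1) (y0 u.2)). Qed.

Lemma pr1_ge0 r : op_ge0 r -> op_ge0 (pr1 r).
Proof. by move=> r0 u; have := r0 (inj1 u); rewrite hdot_hsum /= hdot0r addr0. Qed.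

Lemma pr2_ge0 r : op_ge0 r -> op_ge0 (pr2 r).
Proof. by move=> r0 u; have := r0 (inj2 u); rewrite hdot_hsum /= hdot0r add0r. Qed.

Lemma diagonal r : bounded_op r ->
  r \o (dsum_op idfun 0 : HH -> HH) = dsum_op idfun 0 \o r ->
  r = dsum_op (pr1 r) (pr2 r).
Proof.
move=> br hr; apply/funext => -[u v].
have e1 : (r (inj1 u)).2 = 0.
  by have /(congr1 snd) := congr1 (fun f : HH -> HH => f (inj1 u)) hr.
have e2 : (r (inj2 v)).1 = 0.
  have := congr1 (fun f : HH -> HH => (f (inj2 v)).1) hr; rewrite /=.
  rewrite [dsum_op idfun 0 _](_ : _ = 0); last by congr pair.
  by rewrite (bop0 br).
have -> : (u, v) = inj1 u + inj2 v :> HH by congr pair; rewrite /= ?addr0 ?add0r.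
rewrite (bopD br); congr pair; rewrite /= ?e1 ?e2 ?addr0 ?add0r /pr1 /pr2.
  by congr (r _).1; congr pair; rewrite /= addr0.
by congr (r _).2; congr pair; rewrite /= add0r.
Qed.

Variables (A1 : set (H1 -> H1)) (A2 : set (H2 -> H2)).

Lemma commutant_dsum1 t : bounded_op t -> (forall x, A1 x -> x \o t = t \o x) ->
  (forall y, A2 y -> bounded_op y) ->
  commutant (dsum A1 A2) (dsum_op t 0 : HH -> HH).
Proof.
move=> bt ht A2b; split; first by apply: bop_dsum => //; exact: bop_zero.
move=> _ [x Ax [y Ay <-]]; rewrite !dsum_comp ht//; congr dsum_op.
by rewrite comp0r//; exact: A2b.
Qed.

Lemma commutant_dsum2 t : bounded_op t -> (forall y, A2 y -> y \o t = t \o y) ->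
  (forall x, A1 x -> bounded_op x) ->
  commutant (dsum A1 A2) (dsum_op 0 t : HH -> HH).
Proof.
move=> bt ht A1b; split; first by apply: bop_dsum => //; exact: bop_zero.
move=> _ [x Ax [y Ay <-]]; rewrite !dsum_comp ht//; congr dsum_op.
by rewrite comp0r//; exact: A1b.
Qed.

(** An element of the bicommutant is tested against [(t, 0)] and [(0, t)] with [t] in the commutant
    of one summand; [(1, 0)] already forces it to be diagonal. *)
Lemma dsum_vN : von_neumann A1 -> von_neumann A2 -> von_neumann (dsum A1 A2).
Proof.
move=> v1 v2; have s1 := vN_star_alg v1; have s2 := vN_star_alg v2.
have b1 := sa_bop s1; have b2 := sa_bop s2.
have db : dsum A1 A2 `<=` @bounded_op R HH.
  by move=> _ [x Ax [y Ay <-]]; apply: bop_dsum; [exact: b1|exact: b2].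
split=> //.
  move=> _ [x Ax [y Ay <-]]; exists (adj x); first exact: (sa_adj s1).
  exists (adj y); first exact: (sa_adj s2).
  by rewrite adj_dsum//; [exact: b1|exact: b2].
apply/seteqP; split; last exact: commutant2.
move=> r [br hr].
have rE : r = dsum_op (pr1 r) (pr2 r).
  by apply: diagonal => //; apply: hr; apply: commutant_dsum1 => //; exact: bop_id.
exists (pr1 r).
  apply/vN_mem => //; split=> [|t [bt ht]]; first exact: bop_pr1.
  have := hr _ (commutant_dsum1 bt (fun x Ax => esym (ht x Ax)) b2).
  by rewrite rE !dsum_comp => /(congr1 pr1).
exists (pr2 r) => //.
apply/vN_mem => //; split=> [|t [bt ht]]; first exact: bop_pr2.
have := hr _ (commutant_dsum2 bt (fun y Ay => esym (ht y Ay)) b1).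
by rewrite rE !dsum_comp => /(congr1 pr2).
Qed.

End dsum.

Section projections.
Variables (R : realType) (H1 H2 : hilbertType R).
Local Notation HH := (hsum H1 H2).
Variables (A : set (HH -> HH)) (vA : von_neumann A).

Let sA : star_alg A := vN_star_alg vA.
Let Acs : csub A := sa_sub sA.

(* A compression [f = V^* . V] to a summand preserves suprema, because these are
   computed on vectors. *)
Lemma npmap_compression (K : hilbertType R) (B : set (K -> K)) f (V : K -> HH) :
  von_neumann B -> (forall r, A r -> B (f r)) -> linear_on A f ->
  (forall r u, hdot (f r u) u = hdot (r (V u)) (V u)) -> npmap A B f.
Proof.
move=> vB AB lin fV; have sB := vN_star_alg vB; have Bb := sa_bop sB.
have pos r : A r -> op_ge0 r -> op_ge0 (f r) by move=> _ r0 u; rewrite fV.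
split=> // S r S0 SA Ssa dS hS; have [Ar ub _] := hS.
have sr := is_sup_slim vA S0 SA Ssa dS hS.
have [s0 Ss0] := S0; have Ab := sa_bop sA.
have [sar _ _] := slim_sup S0 dS sr (Ab _ Ar) (fun s Ss => Ab _ (SA s Ss)) Ssa.
split; first exact: AB.
  move=> _ [s Ss <-]; apply: (linear_pos_le Acs lin pos) => //; first exact: SA.
  exact: ub.
move=> t Bt ht.
have bfr := Bb _ (AB _ Ar); have bt := Bb _ Bt.
have sfs s : S s -> selfadjoint (f s).
  by move=> Ss; apply: (pos_sa sA Bb AB lin pos); [exact: SA|exact: Ssa].
have st : selfadjoint t.
  have b1 : bounded_op (t - f s0).
    by apply: (csubB (csub_bop K)) => //; exact/Bb/AB/SA.
  have := saD (op_ge0_sa b1 (ht _ (ex_intro2 _ _ s0 Ss0 erefl))) (sfs _ Ss0).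
  by rewrite subrK.
apply: op_leP => //; first exact: (pos_sa sA Bb AB lin pos).
move=> u; rewrite /rdot fV -/(rdot _ _).
apply: (@ler_addgt0Ml _ _ _ 1) => e e0 _.
have [s [Ss _]] := slim_rdot dS sr Ss0 (V u) (V u) e0.
have := op_le_rdot u (ht _ (ex_intro2 _ _ s Ss erefl)).
by rewrite {1}/rdot fV -/(rdot _ _) ltr_norml; lra.
Qed.

Lemma npmap_pr1 (B : set (H1 -> H1)) : von_neumann B ->
  (forall r, A r -> B (pr1 r)) -> npmap A B (@pr1 R H1 H2).
Proof.
move=> vB AB; apply: (npmap_compression (V := @inj1 R H1 H2) vB AB) => // r u.
by rewrite hdot_hsum /= hdot0r addr0.
Qed.

Lemma npmap_pr2 (B : set (H2 -> H2)) : von_neumann B ->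
  (forall r, A r -> B (pr2 r)) -> npmap A B (@pr2 R H1 H2).
Proof.
move=> vB AB; apply: (npmap_compression (V := @inj2 R H1 H2) vB AB) => // r u.
by rewrite hdot_hsum /= hdot0r add0r.
Qed.

End projections.

(** * Generated algebras and alternating words *)

Section generated_algebra.
Variables (R : realType) (H : hilbertType R) (G : set (H -> H)).
Implicit Types x y : H -> H.

(** Adjoints need no constructor: the generators will be closed under them, and then so is
    everything built from them. *)
Inductive algebra : (H -> H) -> Prop :=
| algebra_gen x : G x -> algebra x
| algebra_id : algebra idfun
| algebra_lin (a : R[i]) x y : algebra x -> algebra y -> algebra (a *: x + y)
| algebra_comp x y : algebra x -> algebra y -> algebra (x \o y).

Hypotheses (Gb : G `<=` @bounded_op R H) (Ga : forall x, G x -> G (adj x)).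

Lemma star_alg_algebra : star_alg algebra.
Proof.
have bd x : algebra x -> bounded_op x.
  elim=> [y /Gb//||a y z _ by_ _ bz|y z _ by_ _ bz].
  - exact: bop_id.
  - exact: bop_lin.
  - exact: bop_comp.
split=> //.
- split=> [|a x y]; last exact: algebra_lin.
  have := algebra_lin (-1) algebra_id algebra_id.
  by rewrite scaleN1r addNr.
- exact: algebra_id.
- exact: algebra_comp.
move=> x; elim=> [y Gy||a y z ay ay' az az'|y z ay ay' az az'].
- by apply/algebra_gen/Ga.
- by rewrite adj_id; exact: algebra_id.
- by rewrite (adj_lin _ (bd _ ay) (bd _ az)); exact: algebra_lin.
- by rewrite (adj_comp (bd _ ay) (bd _ az)); exact: algebra_comp.
Qed.

Lemma algebra_sub : algebra `<=` commutant (commutant G).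
Proof.
have sC := commutant_star_alg Gb Ga.
have sCC := commutant_star_alg (sa_bop sC) (sa_adj sC).
move=> x; elim=> [y Gy||a y z _ hy _ hz|y z _ hy _ hz].
- exact: (commutant2 Gb).
- exact: (sa_id sCC).
- exact: (sa_sub sCC).2.
- exact: (sa_comp sCC).
Qed.

Lemma commutant3 : commutant (commutant (commutant G)) = commutant G.
Proof. by have [_ _] := commutant_vN Gb Ga. Qed.

End generated_algebra.

(* The algebra generated by two subalgebras [A true], [A false] that split as
   [Lam + K b] over a common subalgebra [Lam] with unit [e0] is spanned by [Lam] and
   the alternating words in the [K b]; [z0 = 1 - e0] accounts for the missing unit. *)
Section reduced_words.
Variables (R : realType) (H : hilbertType R).
Implicit Types (x y k w : H -> H) (b : bool) (m : seq (bool * (H -> H))).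
Variables (A K : bool -> set (H -> H)) (Lam : set (H -> H)) (e0 z0 : H -> H).

(** The empty product is [e0], the unit of the letters, and not [idfun]. *)
Definition word m : H -> H := foldr (fun c x => c.2 \o x) e0 m.

Definition reduced_word m :=
  sorted (fun c d => c.1 != d.1) m /\ List.Forall (fun c => K c.1 c.2) m.

(** The empty word is [e0], already in [Lam]; keeping it out leaves only words that freeness
    annihilates. *)
Inductive wspan : (H -> H) -> Prop :=
| wspan_lam x : Lam x -> wspan x
| wspan_word m : m <> [::] -> reduced_word m -> wspan (word m)
| wspan_lin (a : R[i]) x y : wspan x -> wspan y -> wspan (a *: x + y)
| wspan_z : wspan z0.

Hypotheses (AB : forall b, A b `<=` @bounded_op R H) (Lb : Lam `<=` @bounded_op R H)
  (zb : bounded_op z0).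
Hypothesis LA : forall b, Lam `<=` A b.
Hypothesis KA : forall b, K b `<=` A b.
Hypothesis split_A : forall b x, A b x -> exists l k, [/\ Lam l, K b k & x = l + k].
Hypothesis A_comp : forall b x y, A b x -> A b y -> A b (x \o y).
Hypothesis LK : forall b l k, Lam l -> K b k -> K b (l \o k).
Hypotheses (Le0 : Lam e0) (Ae0 : forall b x, A b x -> x \o e0 = x)
  (Az0 : forall b x, A b x -> x \o z0 = 0) (z0A : forall b x, A b x -> z0 \o x = 0)
  (z0z0 : z0 \o z0 = z0) (e0z0 : e0 + z0 = idfun).

Lemma wspanD x y : wspan x -> wspan y -> wspan (x + y).
Proof. by move=> wx wy; have := wspan_lin 1 wx wy; rewrite scale1r. Qed.

Lemma wspan0 : wspan 0.
Proof. by have := wspan_lin (-1) wspan_z wspan_z; rewrite scaleN1r addNr. Qed.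

Lemma reduced_behead c m : reduced_word (c :: m) -> reduced_word m.
Proof.
move=> [sm /List.Forall_cons_iff[_ hm]]; split=> //.
exact: path_sorted sm.
Qed.

Lemma wspan_cons b k m : K b k -> reduced_word m ->
  (if m is c :: _ then b != c.1 else true) -> wspan (k \o word m).
Proof.
move=> Kk [sm hm] hb; have -> : k \o word m = word ((b, k) :: m) by [].
apply: wspan_word => //; split; last exact: List.Forall_cons.
by case: m sm {hm} hb => //= c m -> ->.
Qed.

Lemma wspan_absorb l m : Lam l -> reduced_word m -> wspan (l \o word m).
Proof.
case: m => [|[b k] m] Ll rm; first by rewrite /= (Ae0 (LA true Ll)); exact: wspan_lam.
rewrite -[l \o _]/((l \o k) \o word m).
have [sm /List.Forall_cons_iff[/= Kk _]] := rm.
apply: (wspan_cons (b := b)); [exact: LK|exact: reduced_behead rm|].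
by case: m sm {rm} => //= d m /andP[].
Qed.

(** A letter from the same algebra as the head is multiplied into it and the product is split again;
    its part in [Lam] is absorbed by the next letter. *)
Lemma wspan_letter b x m : A b x -> reduced_word m -> wspan (x \o word m).
Proof.
move=> Ax; case: m => [|[b' k'] m] rm.
  have [l [k [Ll Kk ->]]] := split_A Ax.
  rewrite compDl; apply: wspanD; first exact: (wspan_absorb (m := [::]) Ll).
  exact: (wspan_cons Kk rm).
have [sm /List.Forall_cons_iff[/= Kk' _]] := rm.
have [eb|nb] := eqVneq b b'; last first.
  have [l [k [Ll Kk ->]]] := split_A Ax.
  rewrite compDl; apply: wspanD; first exact: (wspan_absorb Ll rm).
  exact: (wspan_cons Kk rm).
rewrite -[x \o _]/((x \o k') \o word m).
have Axk : A b (x \o k') by apply: A_comp => //; rewrite eb; exact: KA.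
have [l [k [Ll Kk ->]]] := split_A Axk.
have rm' := reduced_behead rm.
rewrite compDl; apply: wspanD; first exact: (wspan_absorb Ll rm').
apply: (wspan_cons Kk rm').
by case: m sm {rm rm'} => //= d m /andP[]; rewrite eb.
Qed.

Lemma wspan_mulA b x w : A b x -> wspan w -> wspan (x \o w).
Proof.
move=> Ax; have bx := AB Ax; elim=> {w} [l Ll|m _ rm|a y z _ hy _ hz|].
- have Axl : A b (x \o l) by apply: A_comp => //; exact: LA.
  by rewrite -(Ae0 Axl); apply: (wspan_letter (m := [::]) Axl); split.
- exact: wspan_letter Ax rm.
- by rewrite (compDr _ _ bx) (compZr _ _ bx); exact: wspan_lin.
- by rewrite (Az0 Ax); exact: wspan0.
Qed.

Lemma wspan_mulz w : wspan w -> wspan (z0 \o w).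
Proof.
elim=> {w} [l Ll|m m0 rm|a y z _ hy _ hz|].
- by rewrite (z0A (LA true Ll)); exact: wspan0.
- case: m m0 rm => // [[b k] m] _ [_ /List.Forall_cons_iff[/= Kk _]].
  by rewrite -[z0 \o _]/((z0 \o k) \o word m) (z0A (KA Kk)) comp0l; exact: wspan0.
- by rewrite (compDr _ _ zb) (compZr _ _ zb); exact: wspan_lin.
- by rewrite z0z0; exact: wspan_z.
Qed.

Theorem algebra_wspan G : (forall x, G x -> x = z0 \/ exists b, A b x) ->
  algebra G `<=` wspan.
Proof.
move=> hG; have mul x : algebra G x -> forall w, wspan w -> wspan (x \o w).
  elim=> {x} [x /hG[->|[b Ax]]||a x y _ hx _ hy|x y _ hx _ hy] w ww.
  - exact: wspan_mulz.
  - exact: wspan_mulA Ax ww.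
  - exact: ww.
  - by rewrite compDl compZl; apply: wspan_lin; [exact: hx|exact: hy].
  - by rewrite -[(x \o y) \o w]/(x \o (y \o w)); apply/hx/hy.
(* [idfun = e0 + z0] lies in the span, which is stable under left multiplication by [x]. *)
move=> x Gx; apply: (mul x Gx idfun); rewrite -e0z0.
by apply: wspanD; [exact: wspan_lam|exact: wspan_z].
Qed.

End reduced_words.

(** * Embeddings and bimodule maps *)

Lemma embedding_id (R : realType) (H K : hilbertType R) (A : set (H -> H))
    (B : set (K -> K)) f :
  star_alg A -> star_alg B -> normal_embedding A B f -> f idfun = idfun.
Proof.
move=> sA sB [[fB _ _ _] _ fu _].
have [_ h] : is_unit B (f idfun) by apply: fu; split=> //; exact: sa_id.
by have [] := h _ (sa_id sB).
Qed.

Lemma embedding_ge0 (R : realType) (H K : hilbertType R) (A : set (H -> H))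
    (B : set (K -> K)) f :
  star_alg A -> normal_embedding A B f ->
  forall x, A x -> op_ge0 x -> op_ge0 (f x).
Proof.
move=> sA [[_ flin _ _] _ _ fn] x.
by apply: (normal_map_ge0 (sa_sub sA) flin); [exact: sa_bop sA|exact: fn].
Qed.

Lemma embedding_npmap (R : realType) (H K : hilbertType R) (A : set (H -> H))
    (B : set (K -> K)) f :
  star_alg A -> normal_embedding A B f -> npmap A B f.
Proof.
move=> sA fe; have [[fB flin _ _] _ _ fn] := fe; split=> //.
exact: embedding_ge0 sA fe.
Qed.

Lemma is_sup_sub (R : realType) (H : hilbertType R) (A B : set (H -> H)) S s :
  B `<=` A -> B s -> is_sup A S s -> is_sup B S s.
Proof. by move=> BA Bs [_ us ls]; split=> // t /BA; exact: ls. Qed.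

Lemma cond_exp_mull (R : realType) (H : hilbertType R) (A B : set (H -> H)) E a x :
  B idfun -> cond_exp A B E -> B a -> A x -> E (a \o x) = a \o E x.
Proof. by move=> BI hE Ba Ax; have := cond_exp_bimod hE Ba Ax BI. Qed.

Lemma cond_exp_mulr (R : realType) (H : hilbertType R) (A B : set (H -> H)) E x b :
  B idfun -> cond_exp A B E -> A x -> B b -> E (x \o b) = E x \o b.
Proof. by move=> BI hE Ax Bb; have := cond_exp_bimod hE BI Ax Bb. Qed.

(** * The corner of the HNN extension *)

Section main.
Variables (R : realType) (H1 H2 HQ HP HM : hilbertType R).
Variables (P1 : set (H1 -> H1)) (P2 : set (H2 -> H2)) (Q : set (HQ -> HQ)).
Variables (i1 : (HQ -> HQ) -> (H1 -> H1)) (i2 : (HQ -> HQ) -> (H2 -> H2)).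
Variables (E1 : (H1 -> H1) -> (H1 -> H1)) (E2 : (H2 -> H2) -> (H2 -> H2)).
Hypotheses (vN_P1 : von_neumann P1) (vN_P2 : von_neumann P2) (vN_Q : von_neumann Q).
Hypotheses (i1_emb : normal_embedding Q P1 i1) (i2_emb : normal_embedding Q P2 i2).
Hypotheses (E1_exp : fn_cond_exp P1 (i1 @` Q) E1) (E2_exp : fn_cond_exp P2 (i2 @` Q) E2).
Variables (theta EN : (hsum H1 H2 -> hsum H1 H2) -> (hsum H1 H2 -> hsum H1 H2)).
Hypothesis thetaE : forall x y, Q x -> Q y ->
  theta (dsum_op (i1 x) (i2 y)) = dsum_op (i1 y) (i2 x).
Hypothesis ENE : forall x y, P1 x -> P2 y -> EN (dsum_op x y) = dsum_op (E1 x) (E2 y).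
Variables (M : set (HM -> HM)) (j : (hsum H1 H2 -> hsum H1 H2) -> (HM -> HM)).
Variables (EM : (HM -> HM) -> (hsum H1 H2 -> hsum H1 H2)) (u : HM -> HM).
Hypothesis M_hnn : HNN_extension (dsum P1 P2) (dsum (i1 @` Q) (i2 @` Q)) theta EN EN
  M j EM u.

Local Notation N := (dsum P1 P2).
Local Notation p := (j (dsum_op idfun 0)).
Local Notation v := (p \o u).
Local Notation M0 := (vN_generated (j @` N `|` [set v])).
Local Notation pM0p := [set p \o x \o p | x in M0].
Local Notation F := (j \o EN \o EM).
Local Notation k1 x := (j (dsum_op x 0)).
Local Notation k2 x := (u \o j (dsum_op 0 x) \o adj u).
Local Notation K1 := (fun x : H1 -> H1 => k1 x).
Local Notation K2 := (fun x : H2 -> H2 => k2 x).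

Let sP1 : star_alg P1 := vN_star_alg vN_P1.
Let sP2 : star_alg P2 := vN_star_alg vN_P2.
Let sQ : star_alg Q := vN_star_alg vN_Q.
Let vN_N : von_neumann N := dsum_vN vN_P1 vN_P2.
Let sN : star_alg N := vN_star_alg vN_N.
Let vN_M : von_neumann M := hnn_vN M_hnn.
Let sM : star_alg M := vN_star_alg vN_M.
Let Mb : M `<=` @bounded_op R HM := sa_bop sM.

Let P10 : P1 0 := (sa_sub sP1).1.
Let P20 : P2 0 := (sa_sub sP2).1.
Let Q0 : Q 0 := (sa_sub sQ).1.

Let N1 x : P1 x -> N (dsum_op x 0).
Proof. by move=> Px; exists x => //; exists 0. Qed.

Let N2 x : P2 x -> N (dsum_op 0 x).
Proof. by move=> Px; exists 0 => //; exists x. Qed.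

Let j_star : star_morphism N M j. Proof. by have [] := hnn_embedding M_hnn. Qed.
Let j_inj : set_inj N j. Proof. by have [] := hnn_embedding M_hnn. Qed.
Let jM x : N x -> M (j x). Proof. by have [+ _ _ _] := j_star; exact. Qed.
Let j_lin : linear_on N j. Proof. by have [] := j_star. Qed.
Let jX x y : N x -> N y -> j (x \o y) = j x \o j y.
Proof. by have [_ _ + _] := j_star; exact. Qed.
Let j_adj x : N x -> j (adj x) = adj (j x).
Proof. by have [_ _ _ +] := j_star; exact. Qed.
Let j1 : j idfun = idfun := embedding_id sN sM (hnn_embedding M_hnn).
Let j_pos := embedding_ge0 sN (hnn_embedding M_hnn).
Let j0 : j 0 = 0 := lin_on0 (sa_sub sN) j_lin.

Let i1Q x : Q x -> P1 (i1 x). Proof. by have [[+ _ _ _] _ _ _] := i1_emb; exact. Qed.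
Let i2Q x : Q x -> P2 (i2 x). Proof. by have [[+ _ _ _] _ _ _] := i2_emb; exact. Qed.
Let i1_lin : linear_on Q i1. Proof. by have [[]] := i1_emb. Qed.
Let i2_lin : linear_on Q i2. Proof. by have [[]] := i2_emb. Qed.
Let i10 : i1 0 = 0 := lin_on0 (sa_sub sQ) i1_lin.
Let i20 : i2 0 = 0 := lin_on0 (sa_sub sQ) i2_lin.
Let i11 : i1 idfun = idfun := embedding_id sQ sP1 i1_emb.
Let i21 : i2 idfun = idfun := embedding_id sQ sP2 i2_emb.
Let i1Q1 : (i1 @` Q) idfun. Proof. by exists idfun => //; exact: sa_id. Qed.
Let i2Q1 : (i2 @` Q) idfun. Proof. by exists idfun => //; exact: sa_id. Qed.

Let E1c : cond_exp P1 (i1 @` Q) E1. Proof. by have [] := E1_exp. Qed.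
Let E2c : cond_exp P2 (i2 @` Q) E2. Proof. by have [] := E2_exp. Qed.
Let E1_0 : E1 0 = 0 := lin_on0 (sa_sub sP1) (cond_exp_linear E1c).
Let E2_0 : E2 0 = 0 := lin_on0 (sa_sub sP2) (cond_exp_linear E2c).

Let EMc : cond_exp M (j @` N) (j \o EM). Proof. by have [] := hnn_exp M_hnn. Qed.

Let EM_np : npmap M N EM.
Proof.
have [_ _ n] := hnn_exp M_hnn.
apply: (npmap_inv vN_N vN_M j_star j_inj j1 j_pos EMc n) => x Mx.
by split=> //; exact: hnn_into M_hnn _ Mx.
Qed.

Let EM_N x : M x -> N (EM x) := hnn_into M_hnn (x := x).

Let EMj n : N n -> EM (j n) = n.
Proof.
move=> Nn; have := cond_exp_id EMc (ex_intro2 _ _ n Nn erefl) => h.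
by apply: j_inj h; apply/mem_set => //; exact/EM_N/jM.
Qed.

Let jN1 : (j @` N) idfun. Proof. by exists idfun => //; exact: sa_id. Qed.

Let EM_mull n x : N n -> M x -> EM (j n \o x) = n \o EM x.
Proof.
move=> Nn Mx; have Njx := EM_N Mx.
have h := cond_exp_mull jN1 EMc (ex_intro2 _ _ n Nn erefl) Mx.
apply: j_inj; first by apply/mem_set/EM_N/(sa_comp sM) => //; exact: jM.
  by apply/mem_set; exact: (sa_comp sN).
by rewrite jX.
Qed.

Let EM_mulr n x : N n -> M x -> EM (x \o j n) = EM x \o n.
Proof.
move=> Nn Mx; have Njx := EM_N Mx.
have h := cond_exp_mulr jN1 EMc Mx (ex_intro2 _ _ n Nn erefl).
apply: j_inj; first by apply/mem_set/EM_N/(sa_comp sM) => //; exact: jM.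
  by apply/mem_set; exact: (sa_comp sN).
by rewrite jX.
Qed.

Let Np : N (dsum_op idfun 0 : hsum H1 H2 -> hsum H1 H2).
Proof. by apply: N1; exact: sa_id. Qed.

Let Nq : N (dsum_op 0 idfun : hsum H1 H2 -> hsum H1 H2).
Proof. by apply: N2; exact: sa_id. Qed.

Local Notation q := (j (dsum_op 0 idfun)).

Let Mp : M p := jM Np.
Let Mq : M q := jM Nq.
Let bp : bounded_op p := Mb Mp.
Let bq : bounded_op q := Mb Mq.

Let pp : p \o p = p. Proof. by rewrite -jX// dsum_comp. Qed.
Let qq : q \o q = q. Proof. by rewrite -jX// dsum_comp. Qed.
Let qp : q \o p = 0.
Proof. by rewrite -jX// dsum_comp /= -j0; congr (j _). Qed.
Let pq : p \o q = 0.
Proof. by rewrite -jX// dsum_comp /= -j0; congr (j _). Qed.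

Let p_adj : adj p = p.
Proof.
by rewrite -j_adj// (adj_dsum (bop_id _) (bop_zero _)) adj_id adj0.
Qed.
Let q_adj : adj q = q.
Proof.
by rewrite -j_adj// (adj_dsum (bop_zero _) (bop_id _)) adj_id adj0.
Qed.
Let p_sa : selfadjoint p. Proof. by apply/selfadjointE => //; exact: p_adj. Qed.

Let Mu : M u := hnn_u M_hnn.
Let bu : bounded_op u := Mb Mu.
Let Mua : M (adj u) := sa_adj sM Mu.
Let uua : u \o adj u = idfun := hnn_uV M_hnn.
Let uau : adj u \o u = idfun := hnn_Vu M_hnn.
Let uK w : u (adj u w) = w := congr1 (fun f : HM -> HM => f w) uua.
Let uaK w : adj u (u w) = w := congr1 (fun f : HM -> HM => f w) uau.

Let u_conj x y : Q x -> Q y ->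
  u \o j (dsum_op (i1 y) (i2 x)) \o adj u = j (dsum_op (i1 x) (i2 y)).
Proof.
move=> Qx Qy; rewrite -(thetaE Qx Qy); apply: hnn_conj M_hnn _ _.
by exists (i1 x); [exists x|exists (i2 y); [exists y|]].
Qed.

(** The conjugation relation at [(i1 x, 0)], whose image under [theta] is [(0, i2 x)]. It makes the
    two copies of [Q] in the corner coincide; at [x = 1] it says that [u] carries [q] to [p]. *)
Let k2_i2 x : Q x -> k2 (i2 x) = k1 (i1 x).
Proof. by move=> Qx; have := u_conj Qx Q0; rewrite i10 i20. Qed.

Let k2_1 : k2 (@idfun H2) = p.
Proof. by have := k2_i2 (sa_id sQ); rewrite i11 i21. Qed.

Let puE : p \o u = u \o q.
Proof. by rewrite -k2_1; apply/funext => w /=; rewrite uaK. Qed.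

Let k1_p x : P1 x -> k1 x \o p = k1 x.
Proof. by move=> Px; rewrite -jX//; exact: N1. Qed.

Let p_k1 x : P1 x -> p \o k1 x = k1 x.
Proof. by move=> Px; rewrite -jX//; exact: N1. Qed.

(** [u] is not among the generators of [M0]; writing [k2] with [v] puts its values there. *)
Let k2_v x : P2 x -> k2 x = v \o j (dsum_op 0 x) \o adj v.
Proof.
move=> Px; rewrite adj_comp// p_adj puE.
have e : q \o j (dsum_op 0 x) \o q = j (dsum_op 0 x).
  by rewrite -!jX// ?dsum_comp//; [exact: N2|exact: N2].
have -> : adj u \o p = q \o adj u.
  have := congr1 (@adj R HM) puE; rewrite (adj_comp bp bu) (adj_comp bu bq).
  by rewrite p_adj q_adj.
by rewrite -{1}e.
Qed.

(** * The corner and its two embeddings *)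

Let vN_M0 : von_neumann M0.
Proof.
apply: vN_generated_vN => x [[n Nn <-]|->]; first exact/Mb/jM.
exact: bop_comp.
Qed.
Let sM0 : star_alg M0 := vN_star_alg vN_M0.

Let M0M : M0 `<=` M.
Proof.
apply: vN_generated_sub => // x [[n Nn <-]|->]; first exact: jM.
exact: (sa_comp sM).
Qed.

Let jM0 n : N n -> M0 (j n).
Proof. by move=> Nn; apply: sub_vN_generated; left; exists n. Qed.

Let M0v : M0 v. Proof. by apply: sub_vN_generated; right. Qed.

Let M0p : M0 p := jM0 Np.

Let k1M0 x : P1 x -> M0 (k1 x). Proof. by move=> Px; exact: (jM0 (N1 Px)). Qed.

Let k2M0 x : P2 x -> M0 (k2 x).
Proof.
move=> Px; rewrite k2_v//; apply: (sa_comp sM0); last exact: (sa_adj sM0).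
by apply: (sa_comp sM0) => //; exact: (jM0 (N2 Px)).
Qed.

Let p_k2 x : P2 x -> p \o k2 x = k2 x.
Proof. by move=> Px; rewrite k2_v//= -[LHS]/((p \o p) \o (u \o j (dsum_op 0 x) \o adj v)) pp. Qed.

Let k2_p x : P2 x -> k2 x \o p = k2 x.
Proof.
move=> Px; rewrite k2_v// adj_comp// p_adj.
by rewrite -[LHS]/((p \o u \o j (dsum_op 0 x)) \o adj u \o (p \o p)) pp.
Qed.

(** The corner has unit [p], so in general it is not a [von_neumann] set; it is handled through [M0]
    and this description. *)
Let cornerP x : pM0p x <-> [/\ M0 x, p \o x = x & x \o p = x].
Proof.
split=> [[y My <-]|[Mx px xp]]; last by exists x => //; rewrite -[LHS]/(p \o (x \o p)) xp.
split; first by apply: (sa_comp sM0) => //; exact: (sa_comp sM0).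
  by rewrite -[LHS]/((p \o p) \o y \o p) pp.
by rewrite -[LHS]/(p \o y \o (p \o p)) pp.
Qed.

Let corner_M x : pM0p x -> M x. Proof. by move=> /cornerP[/M0M]. Qed.

Let corner_csub : csub pM0p.
Proof.
split; first by exists 0; [exact: (sa_sub sM0).1|rewrite comp0r].
move=> a x y /cornerP[Mx px xp] /cornerP[My py yp]; apply/cornerP; split.
- exact: (sa_sub sM0).2.
- by rewrite compDr// compZr// px py.
- by rewrite compDl compZl xp yp.
Qed.

Let k1_corner x : P1 x -> pM0p (k1 x).
Proof.
by move=> Px; apply/cornerP; split; [exact: k1M0|exact: p_k1|exact: k1_p].
Qed.

Let k2_corner x : P2 x -> pM0p (k2 x).
Proof.
by move=> Px; apply/cornerP; split; [exact: k2M0|exact: p_k2|exact: k2_p].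
Qed.

Let k1_lin : linear_on P1 K1.
Proof.
move=> a x y Px Py; rewrite -j_lin; [|exact: N1|exact: N1].
by rewrite -dsum_lin scaler0 addr0.
Qed.

Let k1_comp x y : P1 x -> P1 y -> k1 (x \o y) = k1 x \o k1 y.
Proof. by move=> Px Py; rewrite -jX ?dsum_comp//; exact: N1. Qed.

Let k1_adj x : P1 x -> k1 (adj x) = adj (k1 x).
Proof.
move=> Px; rewrite -j_adj; last exact: N1.
by rewrite adj_dsum ?adj0//; [exact: sa_bop sP1 _ Px|exact: bop_zero].
Qed.

Let k2_lin : linear_on P2 K2.
Proof.
move=> a x y Px Py.
have -> : dsum_op 0 (a *: x + y) = a *: dsum_op 0 x + dsum_op 0 y
    :> (hsum H1 H2 -> hsum H1 H2).
  by rewrite -dsum_lin scaler0 addr0.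
rewrite j_lin; [|exact: N2|exact: N2].
by apply/funext => w; rewrite /= !opE (bop_linear bu).
Qed.

Let k2_comp x y : P2 x -> P2 y -> k2 (x \o y) = k2 x \o k2 y.
Proof.
move=> Px Py; have -> : dsum_op 0 (x \o y) = dsum_op 0 x \o dsum_op 0 y
    :> (hsum H1 H2 -> hsum H1 H2) by [].
rewrite jX; [|exact: N2|exact: N2].
by apply/funext => w /=; rewrite uaK.
Qed.

Let k2_adj x : P2 x -> k2 (adj x) = adj (k2 x).
Proof.
move=> Px; have bx := sa_bop sP2 Px; have bjx := Mb (jM (N2 Px)).
rewrite (adj_comp (bop_comp bu bjx) (bop_adj bu)) (adj_comp bu bjx) adjK//.
rewrite -j_adj; last exact: N2.
by rewrite adj_dsum ?adj0//; exact: bop_zero.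
Qed.

Let k1_inj : set_inj P1 K1.
Proof.
move=> x y /set_mem Px /set_mem Py e.
have := j_inj (mem_set (N1 Px)) (mem_set (N1 Py)) e.
by move=> /(congr1 (@pr1 R H1 H2)).
Qed.

Let k2_inj : set_inj P2 K2.
Proof.
move=> x y /set_mem Px /set_mem Py e.
have e2 : j (dsum_op 0 x) = j (dsum_op 0 y).
  have := congr1 (fun f : HM -> HM => adj u \o f \o u) e => /= e3.
  have h z : adj u \o (u \o j z \o adj u) \o u = j z.
    by apply/funext => w /=; rewrite !uaK.
  by rewrite -(h (dsum_op 0 x)) -(h (dsum_op 0 y)) e.
have := j_inj (mem_set (N2 Px)) (mem_set (N2 Py)) e2.
by move=> /(congr1 (@pr2 R H1 H2)).
Qed.

Let corner_unit : is_unit pM0p p.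
Proof.
split; last by move=> x /cornerP[].
by apply/cornerP; split.
Qed.

Let unit_eq (H : hilbertType R) (A : set (H -> H)) e :
  star_alg A -> is_unit A e -> e = idfun.
Proof. by move=> sA [_ h]; have [] := h _ (sa_id sA). Qed.

Let j_normal : normal_map N M j. Proof. by have [] := hnn_embedding M_hnn. Qed.

Let op_le_dsum1 x y : op_le x y -> op_le (dsum_op x 0 : hsum H1 H2 -> _) (dsum_op y 0).
Proof.
by move=> xy; rewrite /op_le -dsumB subrr; apply: dsum_ge0 => // w; rewrite hdot0l.
Qed.

Let op_le_dsum2 x y : op_le x y -> op_le (dsum_op 0 x : hsum H1 H2 -> _) (dsum_op 0 y).
Proof.
by move=> xy; rewrite /op_le -dsumB subrr; apply: dsum_ge0 => // w; rewrite hdot0l.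
Qed.

(** The supremum is computed in [N], where [j] is normal, and then restricted from [M] to the
    corner. An upper bound in [N] of the elements [x + 0] has a positive second entry because [S] is
    nonempty. *)
Let k1_normal : normal_map P1 pM0p K1.
Proof.
move=> S s S0 SP Ssa dS [Ps us ls].
apply: (is_sup_sub corner_M); first exact: k1_corner.
pose T : set (hsum H1 H2 -> hsum H1 H2) := [set dsum_op x 0 | x in S].
have -> : K1 @` S = j @` T by rewrite -image_comp.
apply: j_normal.
- by have [x Sx] := S0; exists (dsum_op x 0), x.
- by move=> _ [x Sx <-]; exact/N1/SP.
- by move=> _ [x Sx <-]; apply: adjoint_dsum; [exact: Ssa|exact: is_adjoint0].
- move=> _ _ [x Sx <-] [y Sy <-]; have [z [Sz xz yz]] := dS _ _ Sx Sy.
  by exists (dsum_op z 0); split; [exists z|exact: op_le_dsum1|exact: op_le_dsum1].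
split; first exact: N1.
  by move=> _ [x Sx <-]; exact/op_le_dsum1/us.
move=> _ [t Pt [t' Pt' <-]] ht; have [x0 Sx0] := S0.
have ht' x : S x -> op_le x t /\ op_ge0 t'.
  move=> Sx; have := ht _ (ex_intro2 _ _ x Sx erefl); rewrite /op_le -dsumB subr0 => h.
  by split; [exact: pr1_ge0 h|exact: pr2_ge0 h].
rewrite /op_le -dsumB subr0; apply: dsum_ge0; last by have [] := ht' _ Sx0.
by apply: ls => // x /ht'[].
Qed.

Let k2_normal : normal_map P2 pM0p K2.
Proof.
move=> S s S0 SP Ssa dS [Ps us ls].
apply: (is_sup_sub corner_M); first exact: k2_corner.
pose T : set (hsum H1 H2 -> hsum H1 H2) := [set dsum_op 0 x | x in S].
have [|||||Mj uj lj] := @j_normal T (dsum_op 0 s).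
- by have [x Sx] := S0; exists (dsum_op 0 x), x.
- by move=> _ [x Sx <-]; exact/N2/SP.
- by move=> _ [x Sx <-]; apply: adjoint_dsum; [exact: is_adjoint0|exact: Ssa].
- move=> _ _ [x Sx <-] [y Sy <-]; have [z [Sz xz yz]] := dS _ _ Sx Sy.
  by exists (dsum_op 0 z); split; [exists z|exact: op_le_dsum2|exact: op_le_dsum2].
- split; first exact: N2.
    by move=> _ [x Sx <-]; exact/op_le_dsum2/us.
  move=> _ [t' Pt' [t Pt <-]] ht; have [x0 Sx0] := S0.
  have ht' x : S x -> op_le x t /\ op_ge0 t'.
    move=> Sx; have := ht _ (ex_intro2 _ _ x Sx erefl); rewrite /op_le -dsumB subr0 => h.
    by split; [exact: pr2_ge0 h|exact: pr1_ge0 h].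
  rewrite /op_le -dsumB subr0; apply: dsum_ge0; first by have [] := ht' _ Sx0.
  by apply: ls => // x /ht'[].
(* Conjugation by [u] is an order isomorphism of [M], so the supremum is formed in [M] and then
   restricted to the corner. *)
have cj x y : op_le x y -> op_le (u \o x \o adj u) (u \o y \o adj u).
  move=> xy w; rewrite opDE opNE /= -(bopB bu).
  by have := xy (adj u w); rewrite -(adjP bu).
split; first by apply/(sa_comp sM) => //; apply: (sa_comp sM).
  move=> _ [x Sx <-]; apply: cj; apply: uj; exists (dsum_op 0 x) => //.
  by exists x.
move=> t Mt ht.
have tE : t = u \o (adj u \o t \o u) \o adj u by apply/funext => w /=; rewrite !uK.
rewrite tE; apply: cj; apply: lj.
  by apply: (sa_comp sM) => //; exact: (sa_comp sM).
move=> _ [_ [x Sx <-] <-] w.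
have := ht _ (ex_intro2 _ _ x Sx erefl) (u w); rewrite !opDE !opNE /= uaK.
have -> : t (u w) - u (j (dsum_op 0 x) w) = u (adj u (t (u w)) - j (dsum_op 0 x) w).
  by rewrite (bopB bu) uK.
by rewrite (adjP bu) uaK.
Qed.

Let k1_star : star_morphism P1 pM0p K1.
Proof. by split; [exact: k1_corner|exact: k1_lin|exact: k1_comp|exact: k1_adj]. Qed.

Let k2_star : star_morphism P2 pM0p K2.
Proof. by split; [exact: k2_corner|exact: k2_lin|exact: k2_comp|exact: k2_adj]. Qed.

Lemma k1_embedding : normal_embedding P1 pM0p K1.
Proof.
split; [exact: k1_star|exact: k1_inj| |exact: k1_normal].
by move=> e /(unit_eq sP1) ->; exact: corner_unit.
Qed.

Lemma k2_embedding : normal_embedding P2 pM0p K2.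
Proof.
split; [exact: k2_star|exact: k2_inj| |exact: k2_normal].
by move=> e /(unit_eq sP2) ->; rewrite k2_1; exact: corner_unit.
Qed.

(** * The expectation of the corner, read in Q *)

Definition Q1_exp (x : H1 -> H1) : HQ -> HQ := xget 0 [set a | Q a /\ i1 a = E1 x].

Let Q1_expP x : P1 x -> Q (Q1_exp x) /\ i1 (Q1_exp x) = E1 x.
Proof.
move=> Px; have [a Qa e] := cond_exp_into E1c Px.
by apply: (xgetPex 0 (P := [set a | Q a /\ i1 a = E1 x])); exists a.
Qed.

Let Q1_np : npmap P1 Q Q1_exp.
Proof.
have [s i _ _] := i1_emb; have [_ _ n] := E1_exp.
exact: (npmap_inv vN_Q vN_P1 s i i11 (embedding_ge0 sQ i1_emb) E1c n).
Qed.

(** On the corner this is [F] followed by the inverse of [k1 \o i1]. Its values lie in [Q], where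
    they can be compared with those of the free product. *)
Definition M_exp (x : HM -> HM) : HQ -> HQ := Q1_exp (pr1 (EM x)).

Let NP1 n : N n -> P1 (pr1 n). Proof. by move=> [x Px [y Py <-]]. Qed.

Let NP2 n : N n -> P2 (pr2 n). Proof. by move=> [x Px [y Py <-]]. Qed.

Let N_E n : N n -> n = dsum_op (pr1 n) (pr2 n).
Proof. by move=> [x Px [y Py <-]]. Qed.

Lemma M_exp_np : npmap M Q M_exp.
Proof.
have h1 : npmap M P1 (@pr1 R H1 H2 \o EM).
  apply: (npmap_comp sM (sa_bop sN) (sa_sub sN) EM_np).
  exact: npmap_pr1.
exact: (npmap_comp sM (sa_bop sP1) (sa_sub sP1) h1 Q1_np).
Qed.

Let M_expP x : M x -> Q (M_exp x) /\ i1 (M_exp x) = E1 (pr1 (EM x)).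
Proof. by move=> Mx; apply/Q1_expP/NP1/EM_N. Qed.

Let EM_corner x : M x -> p \o x = x -> x \o p = x -> EM x = dsum_op (pr1 (EM x)) 0.
Proof.
move=> Mx px xp; have := EM_N Mx; have e1 := EM_mulr Np Mx; rewrite xp in e1.
have e2 := EM_mull Np Mx; rewrite px in e2.
move=> /N_E; set n := EM x in e1 e2 *; move=> nE.
rewrite [LHS]e1 {1}nE dsum_comp comp0r//.
by apply: (sa_bop sP2); apply: NP2; exact: EM_N.
Qed.

Let F_E x : pM0p x -> F x = k1 (E1 (pr1 (EM x))).
Proof.
move=> cx; have [/M0M Mx px xp] := (cornerP x).1 cx.
rewrite /= (EM_corner Mx px xp) ENE//; last exact/NP1/EM_N.
by rewrite E2_0.
Qed.

Lemma F_M_exp x : pM0p x -> F x = k1 (i1 (M_exp x)).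
Proof. by move=> cx; have [_ ->] := M_expP (corner_M cx); exact: F_E. Qed.

(** Faithfulness is given on elements [adj x \o x]; the inequality [y ^ 2 <= c y] carries it over to
    positive elements. *)
Let E1_faithful y : P1 y -> op_ge0 y -> E1 y = 0 -> y = 0.
Proof.
move=> Py y0 Ey; have by_ := sa_bop sP1 Py; have sy := op_ge0_sa by_ y0.
have [_ + _] := E1_exp; apply => //; rewrite (adjE sy).
have [c c0 hc] := bop_bound by_; have Pyy : P1 (y \o y) := sa_comp sP1 Py Py.
have Pcy : P1 (c%:C%C *: y) by exact: csubZ (sa_sub sP1) Py.
have byy := sa_bop sP1 Pyy.
have yy0 : op_ge0 (y \o y) by rewrite -{1}(adjE sy); exact: op_ge0_adjM.
have le : op_le (y \o y) (c%:C%C *: y).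
  apply: op_leP => //; [exact: sa_bop sP1 _ Pcy|exact: op_ge0_sa|exact: saZ|].
  move=> w; rewrite opZE rdotZl /= (sa_rdot by_ sy).
  by apply: op_ge0_sqr => // w'; apply: nm_rdot => //; exact: ltW.
have Eb x : P1 x -> bounded_op (E1 x).
  by move=> /(cond_exp_into E1c) [a Qa <-]; apply: (sa_bop sP1); exact: i1Q.
apply: op_ge0_eq0; first exact: Eb.
  exact: (cond_exp_ge0 E1c).
have := linear_pos_le (sa_sub sP1) (cond_exp_linear E1c) (cond_exp_ge0 E1c) Pyy Pcy le.
by rewrite (lin_onZ (sa_sub sP1) (cond_exp_linear E1c))// Ey scaler0 /op_le sub0r.
Qed.

(** [M_exp] sees only the entry of [EM] under [p], so faithfulness of [j \o EM] is applied to
    [y \o p]. *)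
Lemma M_exp_faithful y : M y -> M_exp (adj y \o y) = 0 -> y \o p = 0.
Proof.
move=> My h; have Mya := sa_adj sM My; have Myy := sa_comp sM Mya My.
have [_ e] := M_expP Myy; rewrite h i10 in e.
have byy := Mb Myy.
have n0 : op_ge0 (pr1 (EM (adj y \o y))).
  by apply/pr1_ge0/(nm_pos EM_np) => //; apply/op_ge0_adjM/Mb.
have {e} e := E1_faithful (NP1 (EM_N Myy)) n0 (esym e).
have [_ + _] := hnn_exp M_hnn; apply; first exact: (sa_comp sM).
rewrite (adj_comp (Mb My) bp) p_adj.
have Mz : M (p \o (adj y \o y) \o p) by apply: (sa_comp sM) => //; exact: (sa_comp sM).
change (j (EM (p \o (adj y \o y) \o p)) = 0).
rewrite EM_mulr//; last exact: (sa_comp sM).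
rewrite EM_mull// (N_E (EM_N Myy)) e !dsum_comp.
by rewrite -[RHS]j0; congr (j _).
Qed.

Let BQ : set (HM -> HM) := (K1 \o i1) @` Q.

Let BQ_corner : BQ `<=` pM0p.
Proof. by move=> _ [a Qa <-]; apply: k1_corner; exact: i1Q. Qed.

Let k1_pos x : P1 x -> op_ge0 x -> op_ge0 (k1 x).
Proof.
move=> Px x0; apply: j_pos; first exact: N1.
by apply: dsum_ge0 => // w; rewrite op0E hdot0l.
Qed.

Let i1_np : npmap Q P1 i1 := embedding_npmap sQ i1_emb.

Let k1_np : npmap P1 pM0p K1.
Proof. by split; [exact: k1_corner|exact: k1_lin|exact: k1_pos|exact: k1_normal]. Qed.

Let corner_b : pM0p `<=` @bounded_op R HM.
Proof. by move=> x /corner_M /Mb. Qed.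

Let F_np : npmap M pM0p (fun x => k1 (i1 (M_exp x))).
Proof.
have h1 := npmap_comp sM (sa_bop sQ) (sa_sub sQ) M_exp_np i1_np.
exact: (npmap_comp sM (sa_bop sP1) (sa_sub sP1) h1 k1_np).
Qed.

Let pr1_EM_bimod a x b : P1 a -> M x -> P1 b ->
  pr1 (EM (k1 a \o x \o k1 b)) = a \o pr1 (EM x) \o b.
Proof.
move=> Pa Mx Pb; have Mka := jM (N1 Pa); have Max := sa_comp sM Mka Mx.
rewrite (EM_mulr (N1 Pb) Max) (EM_mull (N1 Pa) Mx).
by rewrite (N_E (EM_N Mx)) !dsum_comp.
Qed.

Let F_cond_exp : cond_exp pM0p BQ F.
Proof.
split.
- exact: BQ_corner.
- move=> x cx; rewrite (F_M_exp cx); have [Qx _] := M_expP (corner_M cx).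
  by exists (M_exp x).
- move=> _ [a Qa <-]; have Pa := i1Q Qa; rewrite F_E; last exact: k1_corner.
  by rewrite (EMj (N1 Pa)) pr1_dsum (cond_exp_id E1c)//; exists a.
- move=> a x y cx cy; have cxy := corner_csub.2 a x y cx cy.
  rewrite !F_M_exp//; apply: (nm_lin F_np); exact: corner_M.
- move=> x cx x0; rewrite F_M_exp//; apply: (nm_pos F_np) => //; exact: corner_M.
move=> _ x _ [a Qa <-] cx [b Qb <-].
have Pa := i1Q Qa; have Pb := i1Q Qb; have Mx := corner_M cx.
have [M0x px xp] := (cornerP x).1 cx.
have cz : pM0p (k1 (i1 a) \o x \o k1 (i1 b)).
  apply/cornerP; split.
  - by apply: (sa_comp sM0); [apply: (sa_comp sM0) => //|]; exact: k1M0.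
  - by rewrite -[LHS]/((p \o k1 (i1 a)) \o x \o k1 (i1 b)) p_k1.
  - by rewrite -[LHS]/(k1 (i1 a) \o x \o (k1 (i1 b) \o p)) k1_p.
rewrite (F_E cz) (F_E cx) pr1_EM_bimod//.
have Py := NP1 (EM_N Mx).
have Ia : (i1 @` Q) (i1 a) by exists a.
have Ib : (i1 @` Q) (i1 b) by exists b.
rewrite (cond_exp_bimod E1c Ia Py Ib).
have PE : P1 (E1 (pr1 (EM x))) by have [c Qc <-] := cond_exp_into E1c Py; exact: i1Q.
by rewrite (k1_comp (sa_comp sP1 Pa PE) Pb) (k1_comp Pa PE).
Qed.

(** A supremum in the corner competes with fewer upper bounds than one in [M]. The strong limit
    taken in [M0] is fixed by [p] on both sides, so it lies in the corner and is the supremum in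
    both. *)
Let corner_slim S x : S !=set0 -> S `<=` pM0p -> (forall y, S y -> selfadjoint y) ->
  directed S -> is_sup pM0p S x -> is_sup M S x.
Proof.
move=> S0 SC Ssa dS [cx ux lx].
have SM0 : S `<=` M0 by move=> y /SC/cornerP[].
have [s M0s ss] := vigier vN_M0 S0 SM0 (corner_b cx) Ssa dS ux.
have bs := sa_bop sM0 M0s.
have sp : s \o p = s.
  apply/funext => w /=; apply/eqP; rewrite -subr_eq0 -(bopB bs).
  apply/eqP/nm_eq0/eqP; rewrite eq_le nm_ge0 andbT.
  apply: (@ler_addgt0Ml _ _ _ 1) => e e0 _; rewrite add0r mulr1.
  have [y Sy hy] := ss (p w - w) e e0; have := hy y Sy (@op_le_refl _ _ _).
  have /cornerP[_ _ yp] := SC _ Sy.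
  have y0 : y (p w - w) = 0.
    rewrite (bopB (corner_b (SC _ Sy))).
    by rewrite (congr1 (fun f : HM -> HM => f w) yp : y (p w) = y w) subrr.
  by rewrite y0 subr0; exact: ltW.
have ps : p \o s = s.
  rewrite -[in RHS]sp; apply/esym; apply: (slim_commute S0 dS ss bp) => y Sy.
  by have /cornerP[_ -> ->] := SC _ Sy.
have cs : pM0p s by apply/cornerP.
have hs := slim_is_sup cs corner_b S0 SC Ssa dS ss.
have [_ us ls] := hs.
have <- : s = x.
  apply: op_le_anti; [exact: corner_b|exact: corner_b|exact: ls|exact: lx].
apply: (slim_is_sup (corner_M cs) Mb S0 _ Ssa dS ss) => y /SC; exact: corner_M.
Qed.

Lemma F_fn_cond_exp : fn_cond_exp pM0p BQ F.
Proof.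
split; first exact: F_cond_exp.
  move=> x cx; have [M0x px xp] := (cornerP x).1 cx; have Mx := corner_M cx.
  have cxx : pM0p (adj x \o x).
    apply/cornerP; split.
    - by apply: (sa_comp sM0) => //; exact: (sa_adj sM0).
    - rewrite -[LHS]/((p \o adj x) \o x); congr (_ \o x).
      by rewrite -{1}p_adj -(adj_comp (Mb Mx) bp) xp.
    - by rewrite -[LHS]/(adj x \o (x \o p)) xp.
  have Mxx := corner_M cxx; have [Qxx exx] := M_expP Mxx.
  rewrite (F_M_exp cxx) => h; rewrite -xp; apply: M_exp_faithful => //.
  have k10 : k1 (0 : H1 -> H1) = 0 by rewrite -[RHS]j0; congr (j _).
  have [_ i1i _ _] := i1_emb; apply: i1i; [exact/mem_set|exact/mem_set|].
  rewrite i10; apply: k1_inj; [apply/mem_set; exact: i1Q|exact/mem_set|].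
  by rewrite /= h -[LHS]k10.
move=> S x S0 SC Ssa dS hS; have cx : pM0p x by have [] := hS.
have hM := corner_slim S0 SC Ssa dS hS.
have SM : S `<=` M by move=> y /SC; exact: corner_M.
have := nm_normal F_np S0 SM Ssa dS hM; rewrite -(F_M_exp cx).
have -> : [set k1 (i1 (M_exp y)) | y in S] = F @` S.
  by apply/seteqP; split=> _ [y Sy <-]; exists y => //; rewrite (F_M_exp (SC _ Sy)).
apply: is_sup_sub; first exact: BQ_corner.
exact: (cond_exp_into F_cond_exp).
Qed.

(** Generation of the corner by [k1] and [k2], in commutant form. The operator [p s + adj v s v], a
    diagonal matrix with both entries [s], commutes with [N], [v] and [adj v], hence with [M0]; its
    first entry gives the claim on the corner. *)
Let corner_commute s : bounded_op s -> (forall x, P1 x -> k1 x \o s = s \o k1 x) ->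
  (forall x, P2 x -> k2 x \o s = s \o k2 x) -> forall z, pM0p z -> z \o s = s \o z.
Proof.
move=> bs s1 s2 z /cornerP[M0z pz zp].
have sp w : s (p w) = p (s w).
  exact (congr1 (fun f : HM -> HM => f w) (esym (s1 _ (sa_id sP1)))).
have s1' x w : P1 x -> s (k1 x w) = k1 x (s w).
  by move=> Px; exact (congr1 (fun f : HM -> HM => f w) (esym (s1 _ Px))).
have s2' x w : P2 x -> s (u (j (dsum_op 0 x) (adj u w))) = u (j (dsum_op 0 x) (adj u (s w))).
  by move=> Px; exact (congr1 (fun f : HM -> HM => f w) (esym (s2 _ Px))).
have pu w : p (u w) = u (q w) by exact (congr1 (fun f : HM -> HM => f w) puE).
have uap w : adj u (p w) = q (adj u w).
  by rewrite -[RHS]uaK -pu uK.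
have ppw w : p (p w) = p w by exact (congr1 (fun f : HM -> HM => f w) pp).
have qqw w : q (q w) = q w by exact (congr1 (fun f : HM -> HM => f w) qq).
have pqw w : p (q w) = 0 by exact (congr1 (fun f : HM -> HM => f w) pq).
have qpw w : q (p w) = 0 by exact (congr1 (fun f : HM -> HM => f w) qp).
have bua := bop_adj bu.
pose t w := p (s w) + adj u (s (u (q w))).
have bt : bounded_op t.
  apply: (csubD (csub_bop HM)); first exact: bop_comp.
  by apply: (bop_comp bua); apply: (bop_comp bs); exact: bop_comp.
have tj n : N n -> j n \o t = t \o j n.
  move=> [x Px [y Py <-]]; apply/funext => w; rewrite /= /t.
  have jp w' : j (dsum_op x y) (p w') = k1 x w'.
    rewrite -[LHS]/((j (dsum_op x y) \o p) w') -jX//; last by exists x => //; exists y.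
    by rewrite dsum_comp comp0r//; exact: (sa_bop sP2 Py).
  have pj w' : p (j (dsum_op x y) w') = k1 x w'.
    rewrite -[LHS]/((p \o j (dsum_op x y)) w') -jX//; last by exists x => //; exists y.
  have jq w' : j (dsum_op x y) (q w') = j (dsum_op 0 y) w'.
    rewrite -[LHS]/((j (dsum_op x y) \o q) w') -jX//; last by exists x => //; exists y.
    by rewrite dsum_comp comp0r//; exact: (sa_bop sP1 Px).
  have qj w' : q (j (dsum_op x y) w') = j (dsum_op 0 y) w'.
    rewrite -[LHS]/((q \o j (dsum_op x y)) w') -jX//; last by exists x => //; exists y.
  have bj : bounded_op (j (dsum_op x y)) by apply/Mb/jM; exists x => //; exists y.
  rewrite (bopD bj) jp -sp pj s1' // qj; congr (_ + _).
  by rewrite -pu sp uap jq -{2}(uaK w) s2'// uaK.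
have tv : v \o t = t \o v.
  apply/funext => w; rewrite /= /t (bopD bu) (bopD bp) !uK pu qpw (bop0 bu) add0r.
  by rewrite qpw (bop0 bu) (bop0 bs) (bop0 bua) addr0 -pu.
have tva : adj v \o t = t \o adj v.
  rewrite adj_comp// p_adj; apply/funext => w; rewrite /= /t.
  rewrite (bopD bp) ppw -pu sp uap pqw addr0 uap.
  rewrite uap -sp pqw (bop0 bs) add0r qqw -uap.
  by rewrite -uap uK sp.
have ct : commutant ((j @` N `|` [set v]) `|` (@adj R HM) @` (j @` N `|` [set v])) t.
  split=> // x [[[n Nn <-]|->]|[y [[n Nn <-]|->] <-]]; rewrite ?tj ?tv ?tva//.
  by rewrite -j_adj// tj//; exact: (sa_adj sN).
have Sb : j @` N `|` [set v] `<=` @bounded_op R HM.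
  by move=> x [[n Nn <-]|->]; [exact/Mb/jM|exact: bop_comp].
have cz : z \o t = t \o z.
  move: M0z; rewrite vN_generated_adj// vN_generatedE.
  - by move=> [_ /(_ t ct)].
  - by move=> x [/Sb//|[y /Sb yb <-]]; exact: bop_adj.
  - move=> x [Sx|[y Sy <-]]; [by right; exists x|left].
    by rewrite adjK//; exact: Sb.
have bz := Mb (M0M M0z).
have zpw w : z (p w) = z w by exact (congr1 (fun f : HM -> HM => f w) zp).
have pzw w : p (z w) = z w by exact (congr1 (fun f : HM -> HM => f w) pz).
apply/funext => w /=.
have := congr1 (fun f : HM -> HM => f w) cz; rewrite /= /t (bopD bz) zpw => e.
have e1 : z (adj u (s (u (q w)))) = 0.
  by rewrite -pu sp uap -zpw pqw (bop0 bz).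
have e2 : q (z w) = 0 by rewrite -pzw qpw.
by rewrite e1 e2 addr0 (bop0 bu) (bop0 bs) (bop0 bua) addr0 -sp pzw in e.
Qed.

(** * The free product and its expectation, read in Q *)

Variables (P : set (HP -> HP)).
Variables (l1 : (H1 -> H1) -> (HP -> HP)) (l2 : (H2 -> H2) -> (HP -> HP)).
Variable E : (HP -> HP) -> (HP -> HP).
Hypothesis P_afp : amalgamated_free_product P1 P2 Q i1 i2 E1 E2 P l1 l2 E.

Let vN_P : von_neumann P := afp_vN P_afp.
Let sP : star_alg P := vN_star_alg vN_P.
Let Pb : P `<=` @bounded_op R HP := sa_bop sP.
Let l1_emb := afp_embedding1 P_afp.
Let l2_emb := afp_embedding2 P_afp.
Let l1P x : P1 x -> P (l1 x). Proof. by have [[+ _ _ _] _ _ _] := l1_emb; exact. Qed.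
Let l2P x : P2 x -> P (l2 x). Proof. by have [[+ _ _ _] _ _ _] := l2_emb; exact. Qed.
Let l1_lin : linear_on P1 l1. Proof. by have [[]] := l1_emb. Qed.
Let l2_lin : linear_on P2 l2. Proof. by have [[]] := l2_emb. Qed.
Let l1_comp x y : P1 x -> P1 y -> l1 (x \o y) = l1 x \o l1 y.
Proof. by have [[_ _ + _] _ _ _] := l1_emb; exact. Qed.
Let l2_comp x y : P2 x -> P2 y -> l2 (x \o y) = l2 x \o l2 y.
Proof. by have [[_ _ + _] _ _ _] := l2_emb; exact. Qed.
Let l1_adj x : P1 x -> l1 (adj x) = adj (l1 x).
Proof. by have [[_ _ _ +] _ _ _] := l1_emb; exact. Qed.
Let l2_adj x : P2 x -> l2 (adj x) = adj (l2 x).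
Proof. by have [[_ _ _ +] _ _ _] := l2_emb; exact. Qed.
Let l1_1 : l1 idfun = idfun := embedding_id sP1 sP l1_emb.
Let Ec : cond_exp P ((l1 \o i1) @` Q) E. Proof. by have [] := afp_exp P_afp. Qed.

Let li_star : star_morphism Q P (l1 \o i1).
Proof.
have [[_ _ i1m i1a] _ _ _] := i1_emb; split.
- by move=> x Qx; exact/l1P/i1Q.
- by move=> a x y Qx Qy /=; rewrite i1_lin// l1_lin//; exact: i1Q.
- by move=> x y Qx Qy /=; rewrite i1m// l1_comp//; exact: i1Q.
- by move=> x Qx /=; rewrite i1a// l1_adj//; exact: i1Q.
Qed.

Let li_inj : set_inj Q (l1 \o i1).
Proof.
move=> x y /set_mem Qx /set_mem Qy e; have [_ ii _ _] := i1_emb.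
have [_ li _ _] := l1_emb.
apply: ii; [exact/mem_set|exact/mem_set|].
by apply: li e; apply/mem_set; exact: i1Q.
Qed.

Definition P_exp (x : HP -> HP) : HQ -> HQ :=
  xget 0 [set a | Q a /\ (l1 \o i1) a = E x].

Let P_expP x : P x -> Q (P_exp x) /\ (l1 \o i1) (P_exp x) = E x.
Proof.
move=> Px; have [a Qa e] := cond_exp_into Ec Px.
by apply: (xgetPex 0 (P := [set a | Q a /\ (l1 \o i1) a = E x])); exists a.
Qed.

Lemma P_exp_np : npmap P Q P_exp.
Proof.
have [_ _ n] := afp_exp P_afp.
have li1 : (l1 \o i1) idfun = idfun by rewrite /= i11 l1_1.
apply: (npmap_inv vN_Q vN_P li_star li_inj li1 _ Ec n) => // x Qx x0 /=.
apply: (embedding_ge0 sP1 l1_emb); first exact: i1Q.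
exact: (embedding_ge0 sQ i1_emb).
Qed.

Lemma P_exp_faithful x : P x -> P_exp (adj x \o x) = 0 -> x = 0.
Proof.
move=> Px h; have [_ f _] := afp_exp P_afp; apply: f => //.
have [_ <-] := P_expP (sa_comp sP (sa_adj sP Px) Px).
by rewrite h /= i10 (lin_on0 (sa_sub sP1) l1_lin).
Qed.

(** * Pairs of letters and their alternating words *)

Local Notation HH := (hsum HP HM).
Local Notation L1 x := (dsum_op (l1 x) (k1 x) : HH -> HH).
Local Notation L2 x := (dsum_op (l2 x) (k2 x) : HH -> HH).
Local Notation e0 := (dsum_op idfun p : HH -> HH).
Local Notation z0 := (dsum_op 0 (idfun - p) : HH -> HH).

Definition letters (b : bool) : set (HH -> HH) :=
  [set r | if b then exists2 x, P1 x & r = L1 x else exists2 x, P2 x & r = L2 x].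

Definition centered (b : bool) : set (HH -> HH) :=
  [set r | if b then exists2 x, ker_on P1 E1 x & r = L1 x
           else exists2 x, ker_on P2 E2 x & r = L2 x].

Definition scalars : set (HH -> HH) := [set L1 (i1 a) | a in Q].

Let L2i2 a : Q a -> L2 (i2 a) = L1 (i1 a).
Proof. by move=> Qa; rewrite k2_i2// -(afp_amalgam P_afp Qa). Qed.

Let L1_lin a x y : P1 x -> P1 y -> L1 (a *: x + y) = a *: L1 x + L1 y.
Proof. by move=> Px Py; rewrite l1_lin// (k1_lin a Px Py). Qed.

Let L2_lin a x y : P2 x -> P2 y -> L2 (a *: x + y) = a *: L2 x + L2 y.
Proof. by move=> Px Py; rewrite l2_lin// (k2_lin a Px Py). Qed.

Let bL1 x : P1 x -> bounded_op (L1 x).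
Proof. by move=> Px; apply: bop_dsum; [exact/Pb/l1P|exact/corner_b/k1_corner]. Qed.

Let bL2 x : P2 x -> bounded_op (L2 x).
Proof. by move=> Px; apply: bop_dsum; [exact/Pb/l2P|exact/corner_b/k2_corner]. Qed.

Let letters_b b : letters b `<=` @bounded_op R HH.
Proof. by case: b => r [x Px ->]; [exact: bL1|exact: bL2]. Qed.

Let scalars_letters b : scalars `<=` letters b.
Proof.
case: b => r [a Qa <-]; first by exists (i1 a) => //; exact: i1Q.
by exists (i2 a); [exact: i2Q|rewrite L2i2].
Qed.

Let centered_letters b : centered b `<=` letters b.
Proof. by case: b => r [x [Px _] ->]; exists x. Qed.

Let bz0 : bounded_op z0.
Proof. by apply: bop_dsum; [exact: bop_zero|exact: (csubB (csub_bop HM) (bop_id HM) bp)]. Qed.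

Let split_letters b r : letters b r ->
  exists l k, [/\ scalars l, centered b k & r = l + k].
Proof.
case: b => -[x Px ->].
  have [a Qa ea] := cond_exp_into E1c Px; have PE : P1 (E1 x) by rewrite -ea; exact: i1Q.
  have Pd : P1 (x - E1 x) := csubB (sa_sub sP1) Px PE.
  exists (L1 (E1 x)), (L1 (x - E1 x)); split.
  - by exists a => //; rewrite ea.
  - exists (x - E1 x) => //; split=> //.
    rewrite (lin_onB (cond_exp_linear E1c))// -ea (cond_exp_id E1c); last by exists a.
    by rewrite subrr.
  - by have := L1_lin 1 Pd PE; rewrite !scale1r subrK [RHS]addrC.
have [a Qa ea] := cond_exp_into E2c Px; have PE : P2 (E2 x) by rewrite -ea; exact: i2Q.
have Pd : P2 (x - E2 x) := csubB (sa_sub sP2) Px PE.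
exists (L2 (E2 x)), (L2 (x - E2 x)); split.
- by exists a => //; rewrite -ea -L2i2.
- exists (x - E2 x) => //; split=> //.
  rewrite (lin_onB (cond_exp_linear E2c))// -ea (cond_exp_id E2c); last by exists a.
  by rewrite subrr.
- by have := L2_lin 1 Pd PE; rewrite !scale1r subrK [RHS]addrC.
Qed.

Let L1_comp x y : P1 x -> P1 y -> L1 (x \o y) = L1 x \o L1 y.
Proof. by move=> Px Py; rewrite dsum_comp (l1_comp Px Py) (k1_comp Px Py). Qed.

Let L2_comp x y : P2 x -> P2 y -> L2 (x \o y) = L2 x \o L2 y.
Proof. by move=> Px Py; rewrite dsum_comp (l2_comp Px Py) (k2_comp Px Py). Qed.

Let letters_comp b r s : letters b r -> letters b s -> letters b (r \o s).
Proof.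
case: b => -[x Px ->] [y Py ->].
  by exists (x \o y); [exact: (sa_comp sP1)|rewrite (L1_comp Px Py)].
by exists (x \o y); [exact: (sa_comp sP2)|rewrite (L2_comp Px Py)].
Qed.

Let scalars_centered b l k : scalars l -> centered b k -> centered b (l \o k).
Proof.
case: b => -[a Qa <-] [x [Px Ex] ->].
  have Pa := i1Q Qa; exists (i1 a \o x); last by rewrite (L1_comp Pa Px).
  split; first exact: (sa_comp sP1).
  rewrite (cond_exp_mull i1Q1 E1c (ex_intro2 _ _ a Qa erefl) Px).
  have bP := sa_bop sP1 Pa.
  by rewrite Ex comp0r.
have Pa := i2Q Qa; exists (i2 a \o x); last by rewrite -(L2i2 Qa) (L2_comp Pa Px).
split; first exact: (sa_comp sP2).
rewrite (cond_exp_mull i2Q1 E2c (ex_intro2 _ _ a Qa erefl) Px).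
have bP := sa_bop sP2 Pa.
by rewrite Ex comp0r.
Qed.

Let scalars_e0 : scalars e0.
Proof. by exists idfun; [exact: sa_id|rewrite i11 l1_1]. Qed.

Let letters_e0 b r : letters b r -> r \o e0 = r.
Proof. by case: b => -[x Px ->]; rewrite dsum_comp ?k1_p ?k2_p. Qed.

Let letters_z0 b r : letters b r -> r \o z0 = 0.
Proof.
case: b => -[x Px ->]; rewrite dsum_comp.
  have bl := Pb (l1P Px); have bk := corner_b (k1_corner Px).
  by rewrite comp0r// compBr// k1_p// subrr.
have bl := Pb (l2P Px); have bk := corner_b (k2_corner Px).
by rewrite comp0r// compBr// k2_p// subrr.
Qed.

Let z0_letters b r : letters b r -> z0 \o r = 0.
Proof.
case: b => -[x Px ->]; rewrite dsum_comp compBl.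
  by rewrite p_k1// subrr.
by rewrite p_k2// subrr.
Qed.

Let z0z0 : z0 \o z0 = z0.
Proof.
rewrite dsum_comp; congr dsum_op; apply/funext => w.
rewrite /= !opDE !opNE /= (bopB bp).
by rewrite (congr1 (fun f : HM -> HM => f w) pp : p (p w) = p w) subrr subr0.
Qed.

Let e0z0 : e0 + z0 = idfun.
Proof. by rewrite -dsumD addr0 addrC subrK dsum_id. Qed.

Definition generators : set (HH -> HH) := [set r | r = z0 \/ exists b, letters b r].

Let algebra_words : algebra generators `<=` wspan centered scalars e0 z0.
Proof.
apply: (@algebra_wspan _ _ letters centered scalars e0 z0).
- exact: letters_b.
- exact: bz0.
- exact: scalars_letters.
- exact: centered_letters.
- exact: split_letters.
- exact: letters_comp.
- exact: scalars_centered.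
- exact: scalars_e0.
- exact: letters_e0.
- exact: letters_z0.
- exact: z0_letters.
- exact: z0z0.
- exact: e0z0.
- by move=> r [->|]; [left|right].
Qed.

Definition word1 (m : seq (bool * (HH -> HH))) := [seq (c.1, pr1 c.2) | c <- m].

(** The product ends in [p], the second component of the empty word [e0]. *)
Definition word2 (m : seq (bool * (HH -> HH))) : HM -> HM :=
  foldr (fun c x => pr2 c.2 \o x) p m.

Let word_pair m : List.Forall (fun c => centered c.1 c.2) m ->
  word e0 m = dsum_op (afp_word (word1 m)) (word2 m) /\
  List.Forall (afp_letter P1 P2 E1 E2 l1 l2) (word1 m).
Proof.
elim: m => [|[b r] m IH]; first by split=> //; exact: List.Forall_nil.
move=> /List.Forall_cons_iff[/= hr /IH[IH1 IH2]]; rewrite IH1; split.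
  by case: b hr => -[x _ ->]; rewrite dsum_comp.
apply: List.Forall_cons => //; rewrite /afp_letter /=.
by case: b hr => -[x kx ->]; exists x.
Qed.

Let P_exp_word m : m <> [::] -> reduced_word centered m -> P_exp (pr1 (word e0 m)) = 0.
Proof.
move=> m0 [sm hm]; have [-> hw] := word_pair hm.
have E0 : E (afp_word (word1 m)) = 0.
  apply: (afp_free P_afp) hw _; first by case: m m0 {sm hm}.
  by rewrite sorted_map.
have Pw : P (afp_word (word1 m)).
  elim: m {m0 sm E0} hm hw => [|[b r] m IH]; first by move=> _ _; exact: sa_id.
  move=> /List.Forall_cons_iff[/= hr hm] /List.Forall_cons_iff[_ hw].
  apply: (sa_comp sP); last exact: IH.
  by case: b hr => -[x [Px _] ->]; [exact: l1P|exact: l2P].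
have [Qa ea] := P_expP Pw; rewrite pr1_dsum.
apply: li_inj; [exact/mem_set|exact/mem_set|].
by rewrite ea E0 /= i10 (lin_on0 (sa_sub sP1) l1_lin).
Qed.

Let ker_N1 x : ker_on P1 E1 x -> ker_on N EN (dsum_op x 0).
Proof. by move=> [Px Ex]; split; [exact: N1|rewrite ENE// Ex E2_0]. Qed.

Let ker_N2 x : ker_on P2 E2 x -> ker_on N EN (dsum_op 0 x).
Proof. by move=> [Px Ex]; split; [exact: N2|rewrite ENE// Ex E1_0]. Qed.

Let hnn_word_M e w : hnn_reduced N EN EN e w -> M (hnn_word j u e w).
Proof.
have Mpow b : M (upow u b) by case: b.
elim: w e => [|[n e'] w IH] e /=; first by move=> _; exact: Mpow.
move=> [Nn _ _ /IH Mw]; apply: (sa_comp sM) => //.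
by apply: (sa_comp sM) => //; exact: jM.
Qed.

(* A reduced word starting in [K2 P2] is, up to its last letter, a reduced word of
   the HNN extension, as [k2 y = u (0 + y) u^*]. *)
Let word2_hnn k c m : (size m <= k)%N -> c.1 = false -> reduced_word centered (c :: m) ->
  exists w n, [/\ hnn_reduced N EN EN true w, N n &
    word2 (c :: m) = hnn_word j u true w \o j n].
Proof.
(* Two letters are removed at a time, one of each kind, so the induction runs on a bound for the
   length. *)
elim: k c m => [|k IH] [b r] m; case: m => [|[b' r'] m]//= sm hb.
- move=> [_ /List.Forall_cons_iff[/= hr _]]; rewrite hb in hr; case: hr => y ky ->.
  have [Ny _] := ker_N2 ky.
  (* The coefficient after the last [adj u] is the final [p] of [word2]. *)
  exists [:: (dsum_op 0 y, false)], (dsum_op idfun 0); split=> //=.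
  by split=> // _ _; exact: ker_N2.
- move=> [_ /List.Forall_cons_iff[/= hr _]]; rewrite hb in hr; case: hr => y ky ->.
  have [Ny _] := ker_N2 ky.
  exists [:: (dsum_op 0 y, false)], (dsum_op idfun 0); split=> //=.
  by split=> // _ _; exact: ker_N2.
move=> [/= sm' /List.Forall_cons_iff[/= hr hm]]; rewrite hb in hr sm'.
case: hr => y ky ->; have [Ny _] := ker_N2 ky.
have /andP[hb' sm2] := sm'; have {}hb' : b' = true by case: (b') hb'.
have /List.Forall_cons_iff[/= hr' hm'] := hm; rewrite hb' in hr'.
case: hr' => x kx ->; have [Nx _] := ker_N1 kx; have [Px _] := kx.
case: m sm sm2 hm hm' sm' => [|c m] sm sm2 hm hm' sm'.
  exists [:: (dsum_op 0 y, false)], (dsum_op x 0); split=> //=.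
    by split=> // _ _; exact: ker_N2.
  by rewrite /word2 /= k1_p.
have hc : c.1 = false by move: sm2; rewrite hb' /=; case: (c.1).
have rc : reduced_word centered (c :: m).
  split=> //; exact: path_sorted sm2.
have [|w [n [hw Nn ew]]] := IH c m _ hc rc; first exact: ltnW.
(* The word reads [u (0 + y) adj u (x + 0) u ...]: the sign changes at every step, and every letter
   is in the kernel of [EN], as reducedness demands. *)
exists ((dsum_op 0 y, false) :: (dsum_op x 0, true) :: w), n; split=> //=.
  by split=> [//|_ _|//|]; [exact: ker_N2|split=> // _ _; exact: ker_N1].
by rewrite -[LHS]/(k2 y \o (k1 x \o word2 (c :: m))) ew.
Qed.

Let M_exp0 x : M x -> E1 (pr1 (EM x)) = 0 -> M_exp x = 0.
Proof.
move=> Mx e; have [Qx ex] := M_expP Mx; have [_ ii _ _] := i1_emb.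
by apply: ii; [exact/mem_set|exact/mem_set|rewrite ex e i10].
Qed.

Let EM_hnn w n : hnn_reduced N EN EN true w -> N n -> EM (hnn_word j u true w \o j n) = 0.
Proof.
by move=> hw Nn; rewrite EM_mulr ?(hnn_free M_hnn hw)//; exact: hnn_word_M.
Qed.

(** A leading letter [k1 x] comes from [N] and is pulled out of [EM]; what remains starts in [k2].
    The single letter [k1 x] is settled by [E1 x = 0]. *)
Let M_exp_word m : m <> [::] -> reduced_word centered m ->
  M (word2 m) /\ M_exp (word2 m) = 0.
Proof.
have start2 c m' : c.1 = false -> reduced_word centered (c :: m') ->
    M (word2 (c :: m')) /\ EM (word2 (c :: m')) = 0.
  move=> hc rm; have [w [n [hw Nn ->]]] := word2_hnn (leqnn _) hc rm.
  split; last exact: EM_hnn.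
  by apply: (sa_comp sM); [exact: hnn_word_M|exact: jM].
case: m => [//|[b r] m] _ rm.
have [_ /List.Forall_cons_iff[/= hr _]] := rm.
case: b hr rm => hr rm; last first.
  have [Mm Em] := start2 (false, r) m erefl rm; split=> //.
  by apply: M_exp0 => //; rewrite Em.
case: hr rm => x [Px Ex] -> rm; have Nx := N1 Px.
rewrite pr2_dsum.
case: m rm => [|[b' r'] m] rm.
  rewrite /word2 /= k1_p//; split; first exact: jM.
  by apply: M_exp0; [exact: jM|rewrite EMj].
have hb' : b' = false by case: rm => /=; case: (b') => // /andP[].
have [Mm Em] := start2 (b', r') m hb' (reduced_behead rm).
have Mxm : M (k1 x \o word2 ((b', r') :: m)) by apply: (sa_comp sM) => //; exact: jM.
split=> //; apply: M_exp0 => //; rewrite EM_mull// Em.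
rewrite comp0r//; exact: sa_bop sN _ Nx.
Qed.

Let P_exp_lin : linear_on P P_exp := nm_lin P_exp_np.
Let M_exp_lin : linear_on M M_exp := nm_lin M_exp_np.

Let exp_eq_span r : wspan centered scalars e0 z0 r ->
  [/\ P (pr1 r), M (pr2 r) & P_exp (pr1 r) = M_exp (pr2 r)].
Proof.
elim=> {r} [_ [a Qa <-]|m m0 rm|a x y _ [Px Mx ex] _ [Py My ey]|].
- have Pa := i1Q Qa; have Mk := corner_M (k1_corner Pa).
  split; [exact: l1P|exact: Mk|].
  rewrite pr1_dsum pr2_dsum.
  have [Q1 e1] := P_expP (l1P Pa); have [Q2 e2] := M_expP Mk.
  have -> : P_exp (l1 (i1 a)) = a.
    apply: li_inj; [exact/mem_set|exact/mem_set|].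
    by rewrite e1 (cond_exp_id Ec)//; exists a.
  have [_ ii _ _] := i1_emb; apply: ii; [exact/mem_set|exact/mem_set|].
  by rewrite e2 (EMj (N1 Pa)) pr1_dsum (cond_exp_id E1c)//; exists a.
- have [Mw e2] := M_exp_word m0 rm; have [_ hm] := rm.
  have [ew _] := word_pair hm.
  split; last by rewrite (P_exp_word m0 rm) ew pr2_dsum.
    elim: m {m0 rm Mw e2 ew} hm => [|[b r] m IH]; first by move=> _; exact: sa_id.
    move=> /List.Forall_cons_iff[/= hr hm]; have [ew _] := word_pair hm.
    rewrite /= ew; have := IH hm; rewrite ew pr1_dsum => Pm.
    by case: b hr => -[x [Px _] ->]; rewrite dsum_comp pr1_dsum;
      apply: (sa_comp sP) => //; [exact: l1P|exact: l2P].
  by rewrite ew pr2_dsum.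
- split; [exact: (sa_sub sP).2|exact: (sa_sub sM).2|].
  rewrite -[pr1 _]/(a *: pr1 x + pr1 y) -[pr2 _]/(a *: pr2 x + pr2 y).
  by rewrite P_exp_lin// M_exp_lin// ex ey.
rewrite pr1_dsum pr2_dsum; split; first exact: (sa_sub sP).1.
  exact: (csubB (sa_sub sM) (sa_id sM) Mp).
(* For the generator [(0, 1 - p)]: [M_exp] takes the same value at [idfun] and at [p], as both have
   first entry [idfun] in [N]. *)
rewrite (lin_on0 (sa_sub sP) P_exp_lin) (lin_onB M_exp_lin)//; last exact: sa_id.
apply/esym/eqP; rewrite subr_eq0; apply/eqP.
have [_ ii _ _] := i1_emb; have [Q1 e1] := M_expP (sa_id sM); have [Q2 e2] := M_expP Mp.
apply: ii; [exact/mem_set|exact/mem_set|].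
by rewrite e1 e2 -[idfun]j1 !EMj//; exact: sa_id.
Qed.

(** * The graph algebra *)

Let gen_b : generators `<=` @bounded_op R HH.
Proof. by move=> r [->|[b /letters_b]]. Qed.

Let gen_adj r : generators r -> generators (adj r).
Proof.
move=> [->|[[] [x Px ->]]].
- left; rewrite adj_dsum ?adj0; last 2 first.
  + exact: bop_zero.
  + exact: (csubB (csub_bop HM) (bop_id HM) bp).
  by rewrite adjB ?adj_id ?p_adj//; exact: bop_id.
- right; exists true; exists (adj x); first exact: (sa_adj sP1).
  have bl := Pb (l1P Px); have bk := corner_b (k1_corner Px).
  by rewrite adj_dsum// l1_adj// k1_adj.
right; exists false; exists (adj x); first exact: (sa_adj sP2).
have bl := Pb (l2P Px); have bk := corner_b (k2_corner Px).
by rewrite adj_dsum// l2_adj// (k2_adj Px).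
Qed.

Definition graph_vN : set (HH -> HH) := commutant (commutant generators).

Local Notation G := graph_vN.

Let vN_G : von_neumann G.
Proof.
have sC := commutant_star_alg gen_b gen_adj.
exact: (commutant_vN (sa_bop sC) (sa_adj sC)).
Qed.

Let sG : star_alg G := vN_star_alg vN_G.
Let Gb : G `<=` @bounded_op R HH := sa_bop sG.

Let genG : generators `<=` G := commutant2 gen_b.

Let GC : commutant G = commutant generators := commutant3 gen_b gen_adj.

Let comm_fst t : bounded_op t -> (forall x, P1 x -> l1 x \o t = t \o l1 x) ->
  (forall x, P2 x -> l2 x \o t = t \o l2 x) ->
  commutant generators (dsum_op t 0 : HH -> HH).
Proof.
move=> bt h1 h2; split; first by apply: bop_dsum => //; exact: bop_zero.
move=> r [->|[[] [x Px ->]]]; rewrite !dsum_comp.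
- rewrite comp0r//; congr dsum_op; rewrite comp0r//.
  exact: (csubB (csub_bop HM) (bop_id HM) bp).
- by rewrite h1// comp0r//; exact/corner_b/k1_corner.
- by rewrite h2// comp0r//; exact/corner_b/k2_corner.
Qed.

Let comm_snd t : bounded_op t -> (forall x, P1 x -> k1 x \o t = t \o k1 x) ->
  (forall x, P2 x -> k2 x \o t = t \o k2 x) ->
  commutant generators (dsum_op 0 t : HH -> HH).
Proof.
move=> bt h1 h2; split; first by apply: bop_dsum => //; exact: bop_zero.
move=> r [->|[[] [x Px ->]]]; rewrite !dsum_comp.
- by congr dsum_op; rewrite compBl compBr// (h1 _ (sa_id sP1)).
- by rewrite h1// comp0r//; exact/Pb/l1P.
- by rewrite h2// comp0r//; exact/Pb/l2P.
Qed.

Let P_generated : P = commutant (commutant (l1 @` P1 `|` l2 @` P2)).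
Proof.
rewrite (afp_generated P_afp) vN_generatedE//.
  by move=> x [[y Py <-]|[y Py <-]]; [exact/Pb/l1P|exact/Pb/l2P].
move=> x [[y Py <-]|[y Py <-]]; [left|right].
  by exists (adj y); [exact: (sa_adj sP1)|exact: l1_adj].
by exists (adj y); [exact: (sa_adj sP2)|exact: l2_adj].
Qed.

(** Diagonality and commutation with [p] follow from testing with [(1, 0)] and [(0, 1 - p)], which
    commute with all generators. *)
Lemma graph_elt r : G r -> [/\ r = dsum_op (pr1 r) (pr2 r), P (pr1 r), M0 (pr2 r) &
  pr2 r \o p = p \o pr2 r].
Proof.
move=> Gr; have br := Gb Gr; have [_ hr] := Gr.
have rE : r = dsum_op (pr1 r) (pr2 r).
  by apply: diagonal => //; apply: hr; apply: comm_fst => //; exact: bop_id.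
split=> //.
- rewrite P_generated; split=> [|t [bt ht]]; first exact: bop_pr1.
  have ct : commutant generators (dsum_op t 0 : HH -> HH).
    by apply: comm_fst => // x Px; apply/esym/ht; [left|right]; exists x.
  by have := hr _ ct; rewrite rE !dsum_comp => /(congr1 (@pr1 R HP HM)).
- apply/vN_mem => //; split=> [|t [bt ht]]; first exact: bop_pr2.
  have ct : commutant generators (dsum_op 0 t : HH -> HH).
    by apply: comm_snd => // x Px; apply/esym/ht; [exact: k1M0|exact: k2M0].
  by have := hr _ ct; rewrite rE !dsum_comp => /(congr1 (@pr2 R HP HM)).
have cz : commutant generators z0.
  apply: comm_snd; first exact: (csubB (csub_bop HM) (bop_id HM) bp).
    move=> x Px; rewrite compBr; last exact/corner_b/k1_corner.
    by rewrite compBl k1_p// p_k1.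
  move=> x Px; rewrite compBr; last exact/corner_b/k2_corner.
  by rewrite compBl k2_p// p_k2.
have := hr _ cz; rewrite rE !dsum_comp => /(congr1 (@pr2 R HP HM)).
rewrite !pr2_dsum compBl compBr; last exact: bop_pr2.
by move=> /addrI/oppr_inj.
Qed.

(** Both sides are normal positive maps from [G] to [Q] that agree on the span of the words;
    [npmap_eq] extends this to [G]. *)
Let exp_eq r : G r -> P_exp (pr1 r) = M_exp (pr2 r).
Proof.
have GP s : G s -> P (pr1 s) by move=> /graph_elt[].
have GM s : G s -> M (pr2 s) by move=> /graph_elt[_ _ /M0M].
have h1 := npmap_comp sG Pb (sa_sub sP) (npmap_pr1 vN_G vN_P GP) P_exp_np.
have h2 := npmap_comp sG Mb (sa_sub sM) (npmap_pr2 vN_G vN_M GM) M_exp_np.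
have sA := star_alg_algebra gen_b gen_adj.
have AG : algebra generators `<=` G := algebra_sub gen_b gen_adj.
have CA : commutant (algebra generators) `<=` commutant G.
  by rewrite GC; apply: commutantS => x; exact: algebra_gen.
apply: (npmap_eq vN_G vN_Q sA AG CA h1 h2) => a /algebra_words/exp_eq_span[_ _].
by [].
Qed.

(** [exp_eq] at [adj r \o r] carries faithfulness from one component to the other. The second
    component is controlled only under [p], hence the multiplication by [e0] in the converse. *)
Let graph_inj r : G r -> pr1 r = 0 <-> pr2 r \o p = 0.
Proof.
move=> Gr; have [rE Pr Mr pr] := graph_elt Gr; have Mr' := M0M Mr.
have Gra := sa_adj sG Gr.
split=> e.
  have Grr := sa_comp sG Gra Gr; have := exp_eq Grr.
  rewrite {1 2 3 4}rE adj_dsum; last 2 first.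
  - exact: Pb.
  - exact: Mb.
  rewrite dsum_comp pr1_dsum pr2_dsum e comp0r; last by rewrite adj0; exact: bop_zero.
  rewrite (lin_on0 (sa_sub sP) P_exp_lin) => /esym h.
  exact: M_exp_faithful.
have Ge : G e0.
  by apply: genG; right; exists true; exists idfun; [exact: sa_id|rewrite l1_1].
have Gs : G (r \o e0) := sa_comp sG Gr Ge.
have Gss := sa_comp sG (sa_adj sG Gs) Gs; have := exp_eq Gss.
have -> : r \o e0 = dsum_op (pr1 r) 0 by rewrite {1}rE dsum_comp e.
rewrite adj_dsum; last 2 first.
- exact: Pb.
- exact: bop_zero.
rewrite dsum_comp pr1_dsum pr2_dsum.
rewrite (_ : adj 0 \o 0 = 0); last by rewrite adj0.
rewrite (lin_on0 (sa_sub sM) M_exp_lin) => h.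
exact: P_exp_faithful.
Qed.

Let comm_pr1 t : commutant generators t -> (forall x, P x -> x \o pr1 t = pr1 t \o x).
Proof.
move=> [bt ht] x; rewrite P_generated => -[_ hx]; apply: hx.
split=> [|y [[z Pz <-]|[z Pz <-]]]; first exact: bop_pr1.
  have := ht (L1 z) (or_intror (ex_intro _ true (ex_intro2 _ _ z Pz erefl))).
  move=> e; apply/funext => w; have := congr1 (fun f : HH -> HH => (f (inj1 HM w)).1) e.
  rewrite /= /pr1 => <-; congr (t _).1; congr pair.
  by rewrite /= (bop0 (corner_b (k1_corner Pz))).
have := ht (L2 z) (or_intror (ex_intro _ false (ex_intro2 _ _ z Pz erefl))).
move=> e; apply/funext => w; have := congr1 (fun f : HH -> HH => (f (inj1 HM w)).1) e.
rewrite /= /pr1 => <-; congr (t _).1; congr pair.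
by have := bop0 (corner_b (k2_corner Pz)) => /= ->.
Qed.

(** The entry commutes with the values of [k1] and [k2]; [corner_commute] extends this to the whole
    corner. *)
Let comm_pr2 t : commutant generators t -> (forall z, pM0p z -> z \o pr2 t = pr2 t \o z).
Proof.
move=> [bt ht]; apply: corner_commute; first exact: bop_pr2.
  move=> z Pz; have := ht (L1 z) (or_intror (ex_intro _ true (ex_intro2 _ _ z Pz erefl))).
  move=> e; apply/funext => w; have := congr1 (fun f : HH -> HH => (f (inj2 HP w)).2) e.
  rewrite /= /pr2 => <-; congr (t _).2; congr pair.
  by rewrite /= (bop0 (Pb (l1P Pz))).
move=> z Pz; have := ht (L2 z) (or_intror (ex_intro _ false (ex_intro2 _ _ z Pz erefl))).
move=> e; apply/funext => w; have := congr1 (fun f : HH -> HH => (f (inj2 HP w)).2) e.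
rewrite /= /pr2 => <-; congr (t _).2; congr pair.
by rewrite /= (bop0 (Pb (l2P Pz))).
Qed.

Lemma graph_total x : P x -> exists y, G (dsum_op x y).
Proof.
move=> Px; have bx := Pb Px.
have bp' := csubB (csub_bop HM) (bop_id HM) bp.
(* [(1, 0)] need not be faithful on [G], which contains [(0, 1 - p)]; the second entry [1 - p]
   repairs this. *)
pose e := dsum_op idfun (idfun - p) : HH -> HH.
have be : bounded_op e by apply: bop_dsum => //; exact: bop_id.
have sp' : selfadjoint (idfun - p) by apply: saB => //; exact: is_adjoint_id.
have se : selfadjoint e by exact: adjoint_dsum.
have p'p' : (idfun - p) \o (idfun - p) = idfun - p := congr1 (@pr2 R HP HM) z0z0.
have ef r : G r -> r \o e = 0 -> r = 0.
  move=> Gr; have [rE Pr Mr pr] := graph_elt Gr.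
  rewrite rE dsum_comp => h; have e1 := congr1 (@pr1 R HP HM) h.
  have e2 := congr1 (@pr2 R HP HM) h; rewrite pr1_dsum in e1; rewrite pr2_dsum in e2.
  have {}e1 : pr1 r = 0 by exact: e1.
  have := (graph_inj Gr).1 e1; rewrite e1.
  rewrite compBr in e2; last exact/Mb/M0M.
  move=> e3; rewrite e3 subr0 in e2.
  have {}e2 : pr2 r = 0 by exact: e2.
  by rewrite e2.
pose X := dsum_op x 0 : HH -> HH.
have rX : reduced G e X.
  split.
  - by apply: bop_dsum => //; exact: bop_zero.
  - by rewrite dsum_comp.
  - by rewrite dsum_comp; congr dsum_op; rewrite comp0r.
  move=> t; rewrite GC => ct; have [bt ht] := ct.
  (* As [t] commutes with [z0], the operator [e t e] is diagonal, and only its entry [pr1 t] meets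
     [X]. *)
  have hz := ht z0 (or_introl erefl).
  have tz w : t (z0 w) = z0 (t w) by exact (congr1 (fun f : HH -> HH => f w) hz).
  have hx := comm_pr1 ct Px.
  have xt w : x (pr1 t w) = pr1 t (x w) by exact (congr1 (fun f : HP -> HP => f w) hx).
  apply/funext => -[a b].
  have eab : e (a, b) = inj1 HM a + z0 (0, b).
    by congr pair; rewrite /= ?addr0 ?add0r.
  have eX : e (X (a, b)) = inj1 HM (x a) by congr pair; rewrite /= (bop0 bp').
  have z1 : z0 (inj1 HM (x a)) = 0 by congr pair; rewrite /= (bop0 bp').
  have e1 : (X \o (e \o t \o e)) (a, b) = inj1 HM (x (pr1 t a)).
    rewrite /= eab (bopD bt) tz; congr pair.
    by rewrite /= addr0.
  have e2 : ((e \o t \o e) \o X) (a, b) = inj1 HM (pr1 t (x a)).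
    rewrite /= eX; congr pair.
    by rewrite -[LHS]/((z0 (t (inj1 HM (x a)))).2) -tz z1 (bop0 bt).
  by rewrite e1 e2 xt.
have [r Gr rX'] := reduction_lift vN_G be se ef rX.
have [rE Pr Mr pr] := graph_elt Gr; exists (pr2 r).
have <- : pr1 r = x by have := congr1 (@pr1 R HP HM) rX'; rewrite {1}rE.
by rewrite -rE.
Qed.

Lemma graph_onto z : pM0p z -> exists2 x, P x & G (dsum_op x z).
Proof.
move=> cz; have [M0z pz zp] := (cornerP z).1 cz; have bz := corner_b cz.
(* By [graph_inj] an element of [G] with zero second component is zero, so the whole second summand
   can be taken here. *)
pose e := dsum_op 0 idfun : HH -> HH.
have be : bounded_op e by apply: bop_dsum; [exact: bop_zero|exact: bop_id].
have se : selfadjoint e by apply: adjoint_dsum; [exact: is_adjoint0|exact: is_adjoint_id].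
have ef r : G r -> r \o e = 0 -> r = 0.
  move=> Gr; have [rE Pr Mr pr] := graph_elt Gr.
  rewrite {1}rE dsum_comp => h; have {h} e2 : pr2 r = 0 by exact: (congr1 (@pr2 R HP HM) h).
  have e1 : pr1 r = 0 by apply/(graph_inj Gr); rewrite e2.
  by rewrite rE e1 e2 dsum0.
pose X := dsum_op 0 z : HH -> HH.
have rX : reduced G e X.
  split.
  - by apply: bop_dsum => //; exact: bop_zero.
  - by rewrite dsum_comp.
  - by rewrite dsum_comp.
  move=> t; rewrite GC => ct; have [bt ht] := ct.
  have hx := comm_pr2 ct cz.
  apply/funext => -[a b]; congr pair.
  by exact (congr1 (fun f : HM -> HM => f b) hx).
have [r Gr rX'] := reduction_lift vN_G be se ef rX.
have [rE Pr Mr pr] := graph_elt Gr; exists (pr1 r) => //.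
have <- : pr2 r = z by have := congr1 (@pr2 R HP HM) rX'; rewrite {1}rE.
by rewrite -rE.
Qed.

(** As [G] contains [(0, 1 - p)], the second component [y] is determined by [x] only up to operators
    that vanish on the range of [p]; [y \o p] does not depend on the choice. *)
Definition afp_iso (x : HP -> HP) : HM -> HM :=
  xget 0 [set y \o p | y in [set y | G (dsum_op x y)]].

Let afp_isoE x y : G (dsum_op x y) -> afp_iso x = y \o p.
Proof.
move=> Gxy; have h : [set y \o p | y in [set y | G (dsum_op x y)]] (y \o p) by exists y.
have [y' Gxy' <-] : [set y \o p | y in [set y | G (dsum_op x y)]] (afp_iso x).
  exact: xgetPex (ex_intro _ _ h).
have Gd := csubB (sa_sub sG) Gxy' Gxy; rewrite -dsumB subrr in Gd.
have := (graph_inj Gd).1 erefl; rewrite pr2_dsum compBl => /eqP.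
by rewrite subr_eq0 => /eqP.
Qed.

Let afp_iso_graph x : P x -> exists2 y, G (dsum_op x y) & afp_iso x = y \o p.
Proof. by move=> /graph_total[y Gxy]; exists y => //; exact: afp_isoE. Qed.

Let graph_corner x y : G (dsum_op x y) -> pM0p (y \o p).
Proof.
move=> /graph_elt[_ _]; rewrite pr2_dsum => My yp; apply/cornerP; split.
- exact: (sa_comp sM0).
- by rewrite -[LHS]/((p \o y) \o p) -yp -[LHS]/(y \o (p \o p)) pp.
- by rewrite -[LHS]/(y \o (p \o p)) pp.
Qed.

Lemma afp_iso_star : star_isomorphism P pM0p afp_iso.
Proof.
split; split.
- by move=> x /afp_iso_graph[y Gxy ->]; exact: graph_corner Gxy.
- move=> a x y /afp_iso_graph[x' Gx ->] /afp_iso_graph[y' Gy ->].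
  have Gxy : G (dsum_op (a *: x + y) (a *: x' + y')) := (sa_sub sG).2 a _ _ Gx Gy.
  by rewrite (afp_isoE Gxy).
- move=> x y /afp_iso_graph[x' Gx ->] /afp_iso_graph[y' Gy ->].
  have Gxy := sa_comp sG Gx Gy; rewrite dsum_comp in Gxy; rewrite (afp_isoE Gxy).
  have [_ _ _] := graph_elt Gy; rewrite pr2_dsum => yp.
  rewrite -[RHS]/(x' \o (p \o y') \o p) -yp.
  by rewrite -[RHS]/(x' \o y' \o (p \o p)) pp.
- move=> x Px; have [y Gx ->] := afp_iso_graph Px.
  have [_ _] := graph_elt Gx; rewrite pr2_dsum => My yp.
  have by_ := Mb (M0M My); have Gxa := sa_adj sG Gx.
  rewrite (adj_dsum (Pb Px) by_) in Gxa; rewrite (afp_isoE Gxa).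
  by rewrite yp (adj_comp bp by_) p_adj.
- by move=> x /afp_iso_graph[y Gxy ->]; exact: graph_corner Gxy.
- move=> x y /set_mem Px /set_mem Py.
  have [x' Gx ->] := afp_iso_graph Px; have [y' Gy ->] := afp_iso_graph Py => e.
  have Gd := csubB (sa_sub sG) Gx Gy; rewrite -dsumB in Gd.
  have : x - y = 0 by apply: (graph_inj Gd).2; rewrite pr2_dsum compBl e subrr.
  by move=> /eqP; rewrite subr_eq0 => /eqP.
move=> z cz; have [x Px Gx] := graph_onto cz; exists x => //.
by rewrite (afp_isoE Gx); have [_ _] := (cornerP z).1 cz.
Qed.

Lemma afp_iso1 x : P1 x -> afp_iso (l1 x) = k1 x.
Proof.
move=> Px; have h : G (L1 x) by apply: genG; right; exists true; exists x.
by rewrite (afp_isoE h) k1_p.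
Qed.

Lemma afp_iso2 x : P2 x -> afp_iso (l2 x) = k2 x.
Proof.
move=> Px; have h : G (L2 x) by apply: genG; right; exists false; exists x.
by rewrite (afp_isoE h) k2_p.
Qed.

Lemma afp_iso_exp x : P x -> afp_iso (E x) = F (afp_iso x).
Proof.
move=> Px; have [Qa ea] := P_expP Px.
rewrite -ea /= afp_iso1; last exact: i1Q.
have [y Gx ey] := afp_iso_graph Px; have cy := graph_corner Gx.
rewrite -[RHS]/((j \o EN \o EM) (afp_iso x)) ey (F_M_exp cy).
have Ge : G e0.
  by apply: genG; right; exists true; exists idfun; [exact: sa_id|rewrite l1_1].
(* Multiplication by [e0] keeps [x] and replaces [y] by [y \o p], the value of the isomorphism. *)
have Gxp := sa_comp sG Gx Ge; rewrite dsum_comp in Gxp.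
by have := exp_eq Gxp; rewrite pr1_dsum pr2_dsum => ->.
Qed.

End main.

Theorem proposition2p6 (R : realType) (H1 H2 HQ HP HM : hilbertType R)
    (P1 : set (H1 -> H1)) (P2 : set (H2 -> H2)) (Q : set (HQ -> HQ))
    (i1 : (HQ -> HQ) -> (H1 -> H1)) (i2 : (HQ -> HQ) -> (H2 -> H2))
    (E1 : (H1 -> H1) -> (H1 -> H1)) (E2 : (H2 -> H2) -> (H2 -> H2))
    (vN_P1 : von_neumann P1) (vN_P2 : von_neumann P2) (vN_Q : von_neumann Q)
    (sf_P1 : vN_sigma_finite P1) (sf_P2 : vN_sigma_finite P2)
    (sf_Q : vN_sigma_finite Q)
    (i1_emb : normal_embedding Q P1 i1) (i2_emb : normal_embedding Q P2 i2)
    (E1_exp : fn_cond_exp P1 (i1 @` Q) E1)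
    (E2_exp : fn_cond_exp P2 (i2 @` Q) E2)
    (P : set (HP -> HP))
    (l1 : (H1 -> H1) -> (HP -> HP)) (l2 : (H2 -> H2) -> (HP -> HP))
    (E : (HP -> HP) -> (HP -> HP))
    (P_afp : amalgamated_free_product P1 P2 Q i1 i2 E1 E2 P l1 l2 E)
    (theta EN : (hsum H1 H2 -> hsum H1 H2) -> (hsum H1 H2 -> hsum H1 H2))
    (thetaE : forall x y, Q x -> Q y ->
      theta (dsum_op (i1 x) (i2 y)) = dsum_op (i1 y) (i2 x))
    (ENE : forall x y, P1 x -> P2 y ->
      EN (dsum_op x y) = dsum_op (E1 x) (E2 y))
    (M : set (HM -> HM)) (j : (hsum H1 H2 -> hsum H1 H2) -> (HM -> HM))
    (EM : (HM -> HM) -> (hsum H1 H2 -> hsum H1 H2)) (u : HM -> HM)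
    (M_hnn : HNN_extension (dsum P1 P2) (dsum (i1 @` Q) (i2 @` Q)) theta EN EN
      M j EM u) :
  let p := j (dsum_op idfun 0) in
  let v := p \o u in
  let M0 := vN_generated (j @` dsum P1 P2 `|` [set v]) in
  let pM0p := [set p \o x \o p | x in M0] in
  let F := j \o EN \o EM in
  let k1 := fun x : H1 -> H1 => j (dsum_op x 0) in
  let k2 := fun x : H2 -> H2 => u \o j (dsum_op 0 x) \o adj u in
  [/\ fn_cond_exp pM0p ((k1 \o i1) @` Q) F,
      normal_embedding P1 pM0p k1,
      normal_embedding P2 pM0p k2 &
      exists Phi : (HP -> HP) -> (HM -> HM),
        [/\ star_isomorphism P pM0p Phi,
            (forall x, P1 x -> Phi (l1 x) = k1 x),
            (forall x, P2 x -> Phi (l2 x) = k2 x) &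
            forall x, P x -> Phi (E x) = F (Phi x)]].
Proof.
move=> p v M0 pM0p F k1 k2; split.
- exact: (F_fn_cond_exp vN_P1 vN_P2 vN_Q i1_emb E1_exp E2_exp ENE M_hnn).
- exact: (k1_embedding vN_P1 vN_P2 M_hnn).
- exact: (k2_embedding vN_P1 vN_P2 vN_Q i1_emb i2_emb thetaE M_hnn).
exists (afp_iso P1 P2 j u l1 l2); split.
- exact: (afp_iso_star vN_P1 vN_P2 vN_Q i1_emb i2_emb E1_exp E2_exp thetaE ENE M_hnn P_afp).
- exact: (afp_iso1 vN_P1 vN_P2 vN_Q i1_emb i2_emb E1_exp E2_exp thetaE ENE M_hnn P_afp).
- exact: (afp_iso2 vN_P1 vN_P2 vN_Q i1_emb i2_emb E1_exp E2_exp thetaE ENE M_hnn P_afp).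
- exact: (afp_iso_exp vN_P1 vN_P2 vN_Q i1_emb i2_emb E1_exp E2_exp thetaE ENE M_hnn P_afp).
Qed.
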